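(* Let $\Omega\subsetneq\mathbb{R}^d$ be a nonempty open set admitting the Hardy inequality: there is $\mathrm{C}_0(\Omega)>0$ such that $$\int_{\Omega}\Big|\frac{f(x)}{\rho(x)}\Big|^2dx\le\mathrm{C}_0(\Omega)\int_\Omega|\nabla f|^2\,dx\quad\text{for all }f\in C_c^\infty(\Omega).$$ For any $p\in(1,\infty)$, $c\in(-p+1,1)$ and any positive superharmonic function $\phi$ in $\Omega$, the following holds. Let $u\in C(\Omega)$ be such that $\mathrm{supp}(u)$ is a compact subset of $\Omega$, $u\in C^2_{\mathrm{loc}}(\{x\in\Omega:u(x)\ne0\})$, $\int_{\{u\ne0\}}|u|^{p-1}|D^2u|\,dx<\infty$, and $(\Delta u)1_{\{u\ne0\}}$ is bounded. Then for any $\lambda\ge0$, $$\int_\Omega|u|^p\phi^c\rho^{-2}\,dx\le N\int_{\Omega\cap\{u\ne0\}}|\Delta u-\lambda u|^p\phi^c\rho^{2p-2}\,dx,$$ where $N$ depends only on $p,c,\mathrm{C}_0(\Omega)$.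
   Context: $\rho(x)=\mathrm{dist}(x,\partial\Omega)$. A function $\phi\in L_{1,\mathrm{loc}}(\Omega)$ is superharmonic if $\int_\Omega\phi\,\Delta\zeta\,dx\le0$ for all nonnegative $\zeta\in C_c^\infty(\Omega)$. $C^2_{\mathrm{loc}}(U)$ is the set of functions $v$ on the open set $U$ such that $v\zeta\in C^2(U)$ for all $\zeta\in C_c^\infty(U)$. *)

(* Defs.v *)
From HB Require Import structures.
From mathcomp Require Import all_boot all_order all_algebra.
From mathcomp Require Import all_classical all_reals all_analysis.

Set Implicit Arguments.
Unset Strict Implicit.
Unset Printing Implicit Defensive.

Import Order.TTheory GRing.Theory Num.Theory.
Import numFieldNormedType.Exports.

Local Open Scope classical_set_scope.
Local Open Scope ring_scope.

(* R^d is 'rV[R]_d.  Its sigma-algebra is the one generated by the coordinates,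
   i.e. the Borel sigma-algebra (same construction as for n.-tuple in the
   library). *)
Definition measure_rV_display : measure_display -> measure_display.
Proof. exact. Qed.

Section measurable_rV.
Context {R : realType} (d : nat).

Let coord (i : 'I_d) (v : 'rV[R]_d) : R := v ord0 i.

Let rV_set0 : g_sigma_preimage coord set0.
Proof. exact: sigma_algebra0. Qed.

Let rV_setC A : g_sigma_preimage coord A -> g_sigma_preimage coord (~` A).
Proof. exact: sigma_algebraC. Qed.

Let rV_bigcup (F : (set 'rV[R]_d)^nat) :
  (forall i, g_sigma_preimage coord (F i)) ->
  g_sigma_preimage coord (\bigcup_i (F i)).
Proof. exact: sigma_algebra_bigcup. Qed.

HB.instance Definition _ :=
  @isMeasurable.Build (measure_rV_display (R.-ocitv.-measurable).-sigma)
    'rV[R]_d (g_sigma_preimage coord) rV_set0 rV_setC rV_bigcup.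

End measurable_rV.

Definition rV_cons (R : realType) (d : nat) (xv : R * 'rV[R]_d) : 'rV[R]_d.+1 :=
  row_mx (const_mx xv.1 : 'rV[R]_1) xv.2.

(* d-dimensional Lebesgue measure: the d-fold product of the one-dimensional
   one, transported along R * R^d -> R^(d+1). *)
Fixpoint lebesgue_rV (R : realType) (d : nat) : set 'rV[R]_d -> \bar R :=
  match d with
  | 0 => \d_(0 : 'rV[R]_0)
  | d'.+1 => pushforward (lebesgue_measure \x lebesgue_rV (R := R) (d := d'))%E
               (@rV_cons R d')
  end.

Arguments lebesgue_rV {R d}.

Section lebesgue_rV_measure.
Context {R : realType}.

Lemma measurable_rV_coord d (i : 'I_d) :
  measurable_fun [set: 'rV[R]_d] (fun v : 'rV[R]_d => v ord0 i).
Proof.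
move=> _ Y mY; rewrite setTI; apply: sub_sigma_algebra => /=.
rewrite -bigcup_seq/=; exists i => /=; first by rewrite mem_index_enum.
by exists Y => //; rewrite setTI.
Qed.

Lemma measurable_fun_rVP d1 (T : measurableType d1) d (f : T -> 'rV[R]_d) :
  (forall i, measurable_fun [set: T] (fun t => f t ord0 i)) ->
  measurable_fun [set: T] f.
Proof.
move=> mf _ A; rewrite setTI.
suff : @measurable _ 'rV[R]_d `<=` [set B | measurable (f @^-1` B)] by exact.
apply: smallest_sub.
  split => /= [|B mB|F mF].
  - by rewrite preimage_set0.
  - by rewrite setTD preimage_setC; exact: measurableC.
  - by rewrite preimage_bigcup; exact: bigcupT_measurable.
rewrite -bigcup_seq/= => _ [i _ [B mB <-]] /=.
by rewrite setTI -[X in measurable X]setTI; exact: (mf i measurableT B mB).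
Qed.

Lemma measurable_rV_cons d :
  measurable_fun setT (@rV_cons R d : measurableTypeR R * 'rV[R]_d -> _).
Proof.
apply: measurable_fun_rVP => i; case: (split_ordP (i : 'I_(1 + d))) => j ->.
  apply: (eq_measurable_fun fst); last exact: measurable_fst.
  by move=> x _; rewrite (row_mxEl (const_mx x.1 : 'rV[R]_1)) mxE.
apply: (eq_measurable_fun
    (fun x : measurableTypeR R * 'rV[R]_d => x.2 ord0 j)).
  by move=> x _; rewrite (row_mxEr (const_mx x.1 : 'rV[R]_1)).
by apply: (measurableT_comp (measurable_rV_coord j)); exact: measurable_snd.
Qed.

Definition rV_split d (v : 'rV[R]_d.+1) : (measurableTypeR R * 'rV[R]_d)%type :=
  (v ord0 ord0, rsubmx (v : 'rV[R]_(1 + d))).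

Lemma measurable_rV_split d : measurable_fun setT (@rV_split d).
Proof.
apply/measurable_fun_pairP; split; first exact: measurable_rV_coord.
apply: measurable_fun_rVP => i /=.
apply: (eq_measurable_fun (fun v : 'rV[R]_d.+1 => v ord0 (rshift 1 i))).
  by move=> v _; rewrite /= mxE.
exact: measurable_rV_coord.
Qed.

Lemma rV_consK d : cancel (@rV_cons R d) (@rV_split d).
Proof.
move=> [x v]; rewrite /rV_split; congr (_, _); last exact: row_mxKr.
transitivity (row_mx (const_mx x : 'rV[R]_1) v ord0 (lshift d ord0)).
  by congr (row_mx _ _ _ _); exact: val_inj.
by rewrite row_mxEl mxE.
Qed.

Section step.
Context d (mu : {sigma_finite_measure set 'rV[R]_d -> \bar R}).

Definition lebesgue_rV_step :=
  pushforward (lebesgue_measure \x mu)%E (@rV_cons R d).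

Local Notation nu := lebesgue_rV_step.

Let nu_measure : {measure set 'rV[R]_d.+1 -> \bar R} :=
  measure_function_pushforward__canonical__measure_function_Measure
    (lebesgue_measure \x mu)%E (@measurable_rV_cons d).

Let nu0 : nu set0 = 0%E.
Proof. exact: (measure0 nu_measure). Qed.

Let nu_ge0 A : (0 <= nu A)%E.
Proof. exact: (measure_ge0 nu_measure). Qed.

Let nu_sigma_additive : semi_sigma_additive nu.
Proof. exact: (@measure_semi_sigma_additive _ _ _ nu_measure). Qed.

HB.instance Definition _ := isMeasure.Build _ _ _ nu
  nu0 nu_ge0 nu_sigma_additive.

Let nu_sigma_finite : sigma_finite setT nu.
Proof.
have /sigma_finiteP[F [TF ndF Foo]] :=
  sigma_finiteT (@lebesgue_measure R).
have /sigma_finiteP[G [TG ndG Goo]] := sigma_finiteT mu.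
exists (fun n => @rV_split d @^-1` (F n `*` G n)).
  rewrite -preimage_bigcup (_ : \bigcup_i _ = setT) ?preimage_setT//.
  rewrite -setXTT TF TG predeqE => -[x y]; split.
    by move=> [n _ [/= Fx Gy]]; split; exists n.
  move=> [/= [n _ Fnx] [k _ Gky]]; exists (maxn n k) => //; split => /=.
  - by move: x Fnx; exact/subsetPset/ndF/leq_maxl.
  - by move: y Gky; exact/subsetPset/ndG/leq_maxr.
move=> n; have [mF Foon] := Foo n; have [mG Goon] := Goo n; split.
  rewrite -[X in measurable X]setTI.
  by apply: measurable_rV_split => //; exact: measurableX.
rewrite /lebesgue_rV_step /pushforward -comp_preimage (_ : _ \o _ = id).
  by rewrite preimage_id product_measure1E// lte_mul_pinfty// ge0_fin_numE.
by rewrite funeqE => x /=; rewrite rV_consK.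
Qed.

HB.instance Definition _ := Measure_isSigmaFinite.Build _ _ _ nu
  nu_sigma_finite.

End step.

Let lebesgue_rV_packed d :
  {mu : {sigma_finite_measure set 'rV[R]_d -> \bar R} |
    mu = lebesgue_rV :> (set 'rV[R]_d -> \bar R)}.
Proof.
elim: d => [|d [mu muE]].
  by exists (\d_(0 : 'rV[R]_0) : {sigma_finite_measure set _ -> \bar R}).
exists (lebesgue_rV_step mu : {sigma_finite_measure set _ -> \bar R}).
by rewrite /lebesgue_rV_step /= -muE.
Qed.

Variable d : nat.

Let lebesgue_rV0 : (@lebesgue_rV R d) set0 = 0%E.
Proof. by case: (lebesgue_rV_packed d) => mu <-; rewrite measure0. Qed.

Let lebesgue_rV_ge0 A : (0 <= (@lebesgue_rV R d) A)%E.
Proof. by case: (lebesgue_rV_packed d) => mu <-; rewrite measure_ge0. Qed.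

Let lebesgue_rV_sigma_additive : semi_sigma_additive (@lebesgue_rV R d).
Proof.
by case: (lebesgue_rV_packed d) => mu <-; exact: measure_semi_sigma_additive.
Qed.

HB.instance Definition _ := isMeasure.Build _ _ _ (@lebesgue_rV R d)
  lebesgue_rV0 lebesgue_rV_ge0 lebesgue_rV_sigma_additive.

Let lebesgue_rV_sigma_finite : sigma_finite setT (@lebesgue_rV R d).
Proof. by case: (lebesgue_rV_packed d) => mu <-; exact: sigma_finiteT. Qed.

HB.instance Definition _ := Measure_isSigmaFinite.Build _ _ _
  (@lebesgue_rV R d) lebesgue_rV_sigma_finite.

End lebesgue_rV_measure.

Section euclidean.
Context {R : realType} {d : nat}.
Implicit Types (U Omega : set 'rV[R]_d) (f u phi : 'rV[R]_d -> R).

(* The library norm of 'rV[R]_d is the sup norm. *)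
Definition enorm (x : 'rV[R]_d) : R := Num.sqrt (\sum_i x ord0 i ^+ 2).

Definition boundary Omega : set 'rV[R]_d := closure Omega `\` interior Omega.

Definition rho Omega (x : 'rV[R]_d) : R :=
  inf [set enorm (x - y) | y in boundary Omega].

(* Functions on an open set U are total functions whose values outside U are
   irrelevant: all notions below only depend on the restriction to U. *)

Definition partial (i : 'I_d) f : 'rV[R]_d -> R :=
  fun x => 'D_(delta_mx 0 i) f x.

Definition grad_norm f (x : 'rV[R]_d) : R :=
  Num.sqrt (\sum_i partial i f x ^+ 2).

Definition laplacian f (x : 'rV[R]_d) : R :=
  \sum_i partial i (partial i f) x.

Definition hess_norm f (x : 'rV[R]_d) : R :=
  Num.sqrt (\sum_i \sum_j partial i (partial j f) x ^+ 2).

Fixpoint Ck (k : nat) U f : Prop :=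
  {within U, continuous f} /\
  match k with
  | 0 => True
  | k'.+1 => forall i : 'I_d,
      (forall x, U x -> derivable f x (delta_mx 0 i)) /\ Ck k' U (partial i f)
  end.

Definition supp U f : set 'rV[R]_d := closure (U `&` [set x | f x != 0]).

Definition compactly_supported U f : Prop :=
  compact (supp U f) /\ supp U f `<=` U.

Definition Cc_infty U f : Prop :=
  (forall k, Ck k U f) /\ compactly_supported U f.

Definition C2_loc U f : Prop :=
  forall zeta, Cc_infty U zeta -> Ck 2 U (fun x => f x * zeta x).

(* f is Lebesgue measurable on U when it agrees almost everywhere with a Borel
   function.  The library integral of a nonnegative function is the supremum of
   the integrals of the Borel simple functions below it, so for such an f it is
   the usual Lebesgue integral. *)
Definition locally_integrable_on U f : Prop :=
  (exists2 g : 'rV[R]_d -> R, measurable_fun U g &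
     {ae lebesgue_rV, forall x, U x -> f x = g x}) /\
  (forall K, compact K -> K `<=` U ->
     (\int[lebesgue_rV]_(x in K) `|f x|%:E < +oo)%E).

Definition superharmonic Omega phi : Prop :=
  locally_integrable_on Omega phi /\
  (forall zeta, Cc_infty Omega zeta -> (forall x, Omega x -> 0 <= zeta x) ->
     (\int[lebesgue_rV]_(x in Omega) (phi x * laplacian zeta x)%:E <= 0)%E).

Definition hardy Omega (C0 : R) : Prop :=
  forall f, Cc_infty Omega f ->
    (\int[lebesgue_rV]_(x in Omega) (`|f x / rho Omega x| ^+ 2)%:E <=
     C0%:E * \int[lebesgue_rV]_(x in Omega) (grad_norm f x ^+ 2)%:E)%E.

Definition nonzero_set Omega u : set 'rV[R]_d :=
  Omega `&` [set x | u x != 0].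

End euclidean.

(* Main.v *)
Require Import Defs.
From mathcomp Require Import all_boot all_order all_algebra.
From mathcomp Require Import all_classical all_reals all_analysis.
From mathcomp Require Import measurable_realfun ring lra.

Set Implicit Arguments.
Unset Strict Implicit.
Unset Printing Implicit Defensive.

Import Order.TTheory GRing.Theory Num.Theory.
Import numFieldNormedType.Exports.

Local Open Scope classical_set_scope.
Local Open Scope ring_scope.

(** The estimate comes from testing the Hardy inequality with
[f = v^(p/2) phi^(c/2)], where [v] is one of the parts [u^+], [u^-] of [u].

Suppose first that [phi] is smooth and bounded below by a positive constant.
Write [X = grad v / v] and [Y = grad phi / phi] on [{v > 0}].  Then
[|grad f|^2 = v^p phi^c |p X + c Y|^2 / 4], while the divergences of
[v^(p-1) phi^c grad v] and [v^p phi^(c-1) grad phi] integrate to zero: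

  int v^p phi^c ((p-1) |X|^2 + c X.Y) = - int v^(p-1) phi^c Delta v,
  int v^p phi^c (p X.Y + (c-1) |Y|^2) = - int v^p phi^(c-1) Delta phi >= 0.

Subtracting [t] times the second line from the first leaves on the left the
quadratic form [(p-1) |X|^2 + (c - t p) X.Y + t (1-c) |Y|^2].  For
[t = (c p + 2 (p-1) (1-c)) / p^2 > 0] its discriminant has the good sign
exactly because [1 - p < c < 1], so the form dominates [|p X + c Y|^2 / 4] up to
a constant [M(p, c)] ([coercive_exists]).  Since [- Delta v <= |Delta u - lambda u|]
where [v > 0] (this is where [lambda >= 0] enters), the Hardy inequality gives

  int v^p phi^c rho^-2 <= C0 M int_{v > 0} v^(p-1) phi^c |Delta u - lambda u|.

The left side is finite, and Young's inequality with exponents [p] and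
[p/(p-1)] absorbs half of it; this yields the claim with [N = (2 C0 M)^p]
([smooth_weight_bound]).

Two regularizations make this rigorous.  First, [v] is only [C^2] on the open
set [{v > 0}] and its powers need not be differentiable at its zeros, so every
power [s^m] of [v] is replaced by [s^m th(s)^2] with [th(s) = (1 - e^p s^-p)_+], which vanishes for
[s <= e].  This choice makes the error in the quadratic form explicit: it is at
most [p t^2 e^p |grad phi|^2 phi^(c-2)], which disappears as [e -> 0]
([core_pointwise], [energy_estimate], [weighted_hardy]).  Secondly, [phi] is replaced by
[psi = J * phi + eta] for a mollifier [J]; testing the superharmonicity of [phi]
with translates of [J] shows that [psi] is superharmonic near the support of [u]
([mollified_superharmonic]).  With [eta] fixed, [s -> (s + eta)^c] is Lipschitz, so the
convergence of the mollifications in [L^1] suffices to pass to the limit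
([weighted_pow_limit]); then [eta -> 0] by Fatou's lemma on one side and by
monotonicity ([c <= 0]) or domination ([c > 0]) on the other
([positive_weight_limit]).

The Hardy inequality is assumed for smooth functions only and is first extended to
[C^1] functions of compact support ([hardy_C1]).  Adding the estimates for [u^+]
and [u^-], which are never simultaneously positive, ends the proof.  When the
boundary of the open set is empty, [rho] is the infimum of the empty set, that
is [0], and the left side vanishes. *)

(** * Borel sets and Lebesgue measure on R^d *)

Section rV_measurability.
Context {R : realType} {d : nat}.
Implicit Types (A U : set 'rV[R]_d) (x y : 'rV[R]_d).

Lemma ball_rVP x (e : R) y :
  ball x e y <-> 0 < e /\ forall i, `|x ord0 i - y ord0 i| < e.
Proof.
split=> -[e0 H]; split => // i; first exact: (H ord0 i).
by move=> j; rewrite ord1; exact: H.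
Qed.

Lemma normr_rV_le x (e : R) : 0 <= e ->
  (`|x| <= e) <-> forall i, `|x ord0 i| <= e.
Proof.
move=> e0; rewrite /Num.norm/= mx_normrE; split.
  by move=> /bigmax_leP[_ H] i; exact: (H (ord0, i)).
by move=> H; apply/bigmax_leP; split => // -[j i] _; rewrite ord1; exact: H.
Qed.

Lemma normr_rV_coord x i : `|x ord0 i| <= `|x|.
Proof. by have [+ _] := @normr_rV_le x `|x| (normr_ge0 _); exact. Qed.

Definition box (L : R) : set 'rV[R]_d := [set x | forall i, `|x ord0 i| <= L].

Lemma measurable_ball_rV x (e : R) : measurable (ball x e).
Proof.
have [e0|e0] := ltP 0 e; last first.
  rewrite (_ : ball x e = set0)//; apply/seteqP; split => y //.
  by move=> /ball_rVP[]; rewrite ltNge e0.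
rewrite (_ : ball x e = \bigcap_(i in [set: 'I_d])
    ((fun y : 'rV[R]_d => y ord0 i) @^-1` ball (x ord0 i) e)).
  apply: fin_bigcap_measurable => // i _.
  rewrite -[X in measurable X]setTI.
  apply: measurable_rV_coord => //; by rewrite ball_itv; exact: measurable_itv.
apply/seteqP; split => y; first by move=> /ball_rVP[_ H] i _; exact: H.
by move=> H; apply/ball_rVP; split => // i; exact: H.
Qed.

(** An open set is a countable union of balls with rational centre and radius
    [1/(k+1)], and a ball of the sup norm is a product of intervals. Hence the
    sigma-algebra generated by the coordinates contains the Borel sets. *)
Lemma open_measurable_rV U : open U -> measurable U.
Proof.
move=> oU.
pose c (q : 'rV[rat]_d) : 'rV[R]_d := map_mx (@ratr R) q.
pose F (k : nat) (q : 'rV[rat]_d) :=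
  if pselect (ball (c q) k.+1%:R^-1 `<=` U) then ball (c q) k.+1%:R^-1 else set0.
have -> : U = \bigcup_k \bigcup_(q in [set: 'rV[rat]_d]) F k q.
  apply/seteqP; split => [x Ux|x [k _ [q _]]]; last first.
    by rewrite /F; case: pselect => // H; exact: H.
  have /nbhs_ballP[e /= e0 eU] : nbhs x U by exact: open_nbhs_nbhs.
  have [k kU] : exists k : nat, k.+1%:R^-1 < e / 2.
    near \oo => k; exists k; near: k.
    have e20 : 0 < e / 2 by rewrite divr_gt0.
    exact: (near_infty_natSinv_lt (PosNum e20)).
  have dq i : {q : rat | ratr q \in `]x ord0 i, (x ord0 i + k.+1%:R^-1)[}.
    by apply/cid; apply: rat_in_itvoo; rewrite ltrDl invr_gt0.
  exists k => //; exists (\row_i sval (dq i)) => //.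
  have xq i : `|ratr (sval (dq i)) - x ord0 i| < k.+1%:R^-1.
    case: (dq i) => q /=; rewrite in_itv/= => /andP[h1 h2].
    by rewrite ger0_norm ?subr_ge0 ?ltW// ltrBlDl.
  rewrite /F; case: pselect => [?|].
    apply/ball_rVP; split; first by rewrite invr_gt0.
    by move=> i; rewrite !mxE; exact: xq.
  case=> y /ball_rVP[_ yq]; apply: eU; apply/ball_rVP; split => // i.
  rewrite (splitr e); apply: le_lt_trans (ltrD (lt_trans (xq i) kU) (lt_trans (yq i) kU)).
  rewrite !mxE -(normrN (_ - x ord0 i)) opprB.
  by apply: le_trans (ler_normD _ _); rewrite subrKA.
apply: bigcupT_measurable => k.
apply: countable_bigcupT_measurable => [|q]; first exact: countableP.
rewrite /F; case: pselect => ?; last exact: measurable0.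
exact (measurable_ball_rV (c q) _).
Unshelve. all: by end_near. Qed.

Lemma within_continuous_measurable_rV U (f : 'rV[R]_d -> R) :
  open U -> {within U, continuous f} -> measurable_fun U f.
Proof.
move=> oU /continuousP cf.
move=> mU; apply: (measurability _ (RGenOpens.measurableE R)) => // _ [_ [a [b ->] <-]].
have oI : open `]a, b[%classic by exact: itv_open.
have /open_subspaceP[V oV VE] := cf _ oI.
rewrite setIC -VE; apply: open_measurable_rV; exact: openI.
Qed.

Lemma continuous_measurable_rV (f : 'rV[R]_d -> R) :
  continuous f -> measurable_fun setT f.
Proof.
move=> cf; apply: within_continuous_measurable_rV; first exact: openT.
exact: continuous_subspaceT.
Qed.

Lemma closed_measurable_rV A : closed A -> measurable A.
Proof.
move=> cA; rewrite -(setCK A); apply: measurableC; apply: open_measurable_rV.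
exact: closed_openC.
Qed.

Lemma compact_closed_rV A : compact A -> closed A.
Proof. by apply: compact_closed; exact: norm_hausdorff. Qed.

Lemma compact_measurable_rV A : compact A -> measurable A.
Proof. by move=> /compact_closed_rV/closed_measurable_rV. Qed.

Lemma compact_sub_box A : compact A -> exists L, A `<=` box L.
Proof.
move=> /compact_bounded[M [_ HM]]; exists (`|M| + 1) => x Ax i.
apply: le_trans (normr_rV_coord _ _) _.
by apply: (HM (`|M| + 1)) => //; rewrite ltr_pwDr// ler_norm.
Qed.

Lemma measurable_box L : measurable (box L).
Proof.
rewrite (_ : box L = \bigcap_(i in [set: 'I_d])
    ((fun y : 'rV[R]_d => y ord0 i) @^-1` `[- L, L]%classic)).
  apply: fin_bigcap_measurable => // i _.
  by rewrite -[X in measurable X]setTI; apply: measurable_rV_coord.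
apply/seteqP; split => y H.
  by move=> i _ /=; rewrite in_itv/= -ler_norml.
by move=> i; have := H i I; rewrite /= in_itv/= -ler_norml.
Qed.

Lemma box_compact L : compact (box L).
Proof.
have := @rV_compact R d (fun=> `[- L, L]%classic) (fun=> @segment_compact R _ _).
rewrite (_ : [set v | _] = box L)//; apply/seteqP; split => y H i; have := H i.
  by rewrite /= in_itv/= -ler_norml.
by rewrite /= in_itv/= -ler_norml.
Qed.

End rV_measurability.

Section rV_fubini.
Context {R : realType}.

Lemma rV_cons_coord0 d (x : R * 'rV[R]_d) : rV_cons x ord0 ord0 = x.1.
Proof. by have := congr1 fst (rV_consK x). Qed.

Lemma rV_cons_lift d (x : R * 'rV[R]_d) j : rV_cons x ord0 (lift ord0 j) = x.2 ord0 j.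
Proof.
have /(congr1 (fun v : R * 'rV[R]_d => v.2 ord0 j)) /= := rV_consK x.
rewrite mxE => <-; congr (rV_cons _ _ _); exact: val_inj.
Qed.

Lemma box_cons d L (x : R * 'rV[R]_d) :
  box L (rV_cons x) <-> (`|x.1| <= L /\ box L x.2).
Proof.
split=> [H|[H1 H2] i].
  split; first by have := H ord0; rewrite rV_cons_coord0.
  by move=> j; have := H (lift ord0 j); rewrite rV_cons_lift.
case: (unliftP ord0 i) => [j ->|->]; first by rewrite rV_cons_lift; exact: H2.
by rewrite rV_cons_coord0.
Qed.

Lemma lebesgue_rV_box_lty d L : (@lebesgue_rV R d (box L) < +oo)%E.
Proof.
elim: d => [|d IH] /=; first by rewrite diracE; case: (_ \in _); rewrite ltry.
rewrite /pushforward (_ : _ @^-1` _ = `[- L, L]%classic `*` box L).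
  rewrite product_measure1E//; last exact: measurable_box.
  rewrite lte_mul_pinfty//= lebesgue_measure_itv/=.
  by case: ifP => // _; rewrite EFinN oppeK.
apply/seteqP; split => x /=; rewrite box_cons in_itv/= -ler_norml//.
Qed.

(** The measure on [R^(d+1)] is the image of a product measure, so this is
    Tonelli's theorem. *)
Lemma ge0_integral_rV_cons d (f : 'rV[R]_d.+1 -> \bar R) :
  measurable_fun setT f -> (forall x, 0 <= f x)%E ->
  (\int[lebesgue_rV]_x f x =
   \int[lebesgue_measure]_t \int[lebesgue_rV]_x f (rV_cons (t, x)))%E.
Proof.
move=> mf f0.
rewrite -[LHS]/(\int[pushforward (lebesgue_measure \x @lebesgue_rV R d) (@rV_cons R d)]_x f x)%E.

rewrite (ge0_integral_pushforward (measurable_rV_cons (d := d)))//=.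
rewrite preimage_setT fubini_tonelli1//=; apply: measurableT_comp => //.
exact: measurable_rV_cons.
Qed.

End rV_fubini.

Section rV_calculus.
Context {R : realType}.

Local Notation e_ i := (delta_mx 0 i).

Lemma continuous_rV_coords (T : topologicalType) d (f : T -> 'rV[R]_d) :
  (forall i, continuous (fun t => f t ord0 i)) -> continuous f.
Proof.
move=> cf t; apply/cvg_ballP => e e0.
have H : \forall s \near t, forall i, ball (f t ord0 i) e (f s ord0 i).
  apply: filter_forall => i.
  by have /cvg_ballP/(_ _ e0) := cf i t.
by apply: filterS H => s H; apply/ball_rVP; split => // i; exact: H.
Qed.

(** Restricting to a line turns partial derivatives into ordinary ones, so
    that the chain rule and Fubini arguments can be carried out in one
    variable. *)
Lemma is_derive1P (V W : normedModType R) (f : V -> W) x v df :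
  is_derive x v f df <-> is_derive (0 : R) 1 (fun h : R => f (h *: v + x)) df.
Proof.
have E : 'D_1 (fun h : R => f (h *: v + x)) 0 = 'D_v f x.
  rewrite /derive; set g1 := fun h => h^-1 *: _; set g2 := fun h => h^-1 *: _.
  suff -> : g1 = g2 by [].
  rewrite funeqE /g1 /g2 => h /=; by rewrite addr0 scale0r add0r [_%:A]mulr1.
split=> -[h1 h2]; apply: DeriveDef.
- by move/derivable1P: h1.
- by rewrite E.
- by apply/derivable1P.
- by rewrite -E.
Qed.

Lemma rV_cons_shift0 d (t h : R) (x : 'rV[R]_d) :
  rV_cons (h + t, x) = h *: e_ ord0 + rV_cons (t, x).
Proof.
apply/rowP => i; rewrite [RHS]mxE [X in _ = X + _]mxE [delta_mx _ _ _ _]mxE eqxx/=.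
case: (unliftP ord0 i) => [j ->|->].
  by rewrite !rV_cons_lift mulr0 add0r.
by rewrite !rV_cons_coord0 mulr1.
Qed.

Lemma rV_cons_shift_lift d (t h : R) (x : 'rV[R]_d) j :
  rV_cons (t, h *: e_ j + x) = h *: e_ (lift ord0 j) + rV_cons (t, x).
Proof.
apply/rowP => i; rewrite [RHS]mxE [X in _ = X + _]mxE [delta_mx _ _ _ _]mxE eqxx/=.
case: (unliftP ord0 i) => [k ->|->].
  by rewrite !rV_cons_lift/= !mxE eqxx/= (inj_eq lift_inj).
by rewrite !rV_cons_coord0 mulr0 add0r.
Qed.

End rV_calculus.

(** * Integrable functions and integration by parts *)

Section integrability.
Context {R : realType} {d : nat}.
Implicit Types f g : 'rV[R]_d -> R.

Definition bdd_supp f := exists L, forall x, ~ box L x -> f x = 0.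

(** The bounded Borel analogue of [Cc]. *)
Definition Bc f :=
  [/\ measurable_fun setT f, exists M, forall x, `|f x| <= M & bdd_supp f].

Definition Cc f := continuous f /\ bdd_supp f.

Lemma integrable_Bc f : Bc f -> lebesgue_rV.-integrable setT (EFin \o f).
Proof.
move=> [mf [M fM] [L fL]].
have : lebesgue_rV.-integrable (box L) (EFin \o f).
  apply: measurable_bounded_integrable.
  - exact: measurable_box.
  - exact: lebesgue_rV_box_lty.
  - exact: measurable_funTS.
  - exists M; split; first exact: num_real.
    by move=> N MN x _; apply: le_trans (fM x) (ltW MN).
move/(integrable_mkcond _ (measurable_box L)).
rewrite (_ : (EFin \o f) \_ (box L) = EFin \o f)//.
apply/funext => x; rewrite patchE; case: ifPn => // /negP xL.
by rewrite /= fL// => Lx; apply: xL; rewrite inE.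
Qed.

Lemma Cc_bounded f : Cc f -> exists2 M, 0 < M & forall x, `|f x| <= M.
Proof.
move=> [cf [L fL]].
have : compact (f @` box L).
  apply: continuous_compact; last exact: box_compact.
  exact: continuous_subspaceT.
move=> /compact_bounded[M [_ HM]]; exists (`|M| + 1); first by rewrite ltr_wpDl.
move=> x; have [Lx|nLx] := pselect (box L x); last by rewrite fL// normr0 addr_ge0.
by apply: (HM (`|M| + 1)); [rewrite ltr_pwDr// ler_norm|exists x].
Qed.

Lemma Cc_Bc f : Cc f -> Bc f.
Proof.
move=> fC; have [M _ fM] := Cc_bounded fC; case: fC => cf fL.
by split => //; [exact: continuous_measurable_rV|exists M].
Qed.

Lemma integrable_Cc f : Cc f -> lebesgue_rV.-integrable setT (EFin \o f).
Proof. by move=> /Cc_Bc/integrable_Bc. Qed.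

Lemma bdd_supp_box f (L : R) : (exists2 L0, L0 <= L & forall x, ~ box L0 x -> f x = 0) ->
  forall x, ~ box L x -> f x = 0.
Proof.
move=> [L0 L0L H] x nL; apply: H => B; apply: nL => i; exact: le_trans (B i) L0L.
Qed.

Lemma bdd_supp2 f g : bdd_supp f -> bdd_supp g ->
  exists L, (forall x, ~ box L x -> f x = 0) /\ (forall x, ~ box L x -> g x = 0).
Proof.
move=> [L1 H1] [L2 H2]; exists (Num.max L1 L2); split; apply: bdd_supp_box.
  by exists L1 => //; rewrite le_max lexx.
by exists L2 => //; rewrite le_max lexx orbT.
Qed.

Lemma bdd_suppD f g : bdd_supp f -> bdd_supp g -> bdd_supp (f \+ g).
Proof.
move=> sf sg; have [L [H1 H2]] := bdd_supp2 sf sg.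
by exists L => x nL; rewrite /= H1// H2// addr0.
Qed.

Lemma bdd_suppMl f g : bdd_supp f -> bdd_supp (f \* g).
Proof. by move=> [L H]; exists L => x nL; rewrite /= H// mul0r. Qed.

Lemma CcD f g : Cc f -> Cc g -> Cc (f \+ g).
Proof.
move=> [cf sf] [cg sg]; split; last exact: bdd_suppD.
by move=> x; apply: continuousD; [exact: cf|exact: cg].
Qed.

Lemma CcMl f g : Cc f -> continuous g -> Cc (f \* g).
Proof.
move=> [cf sf] cg; split; last exact: bdd_suppMl.
by move=> x; apply: continuousM; [exact: cf|exact: cg].
Qed.

Lemma Cc0 : Cc (cst 0).
Proof. by split; [move=> x; exact: cst_continuous|exists 0]. Qed.

Lemma CcZ f (k : R) : Cc f -> Cc (fun x => k * f x).
Proof.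
move=> fC; rewrite (_ : (fun _ => _) = f \* cst k); last by apply/funext => x /=; rewrite mulrC.
apply: CcMl => //; move=> x; exact: cst_continuous.
Qed.

Lemma CcN f : Cc f -> Cc (fun x => - f x).
Proof.
move=> /(CcZ (-1)); congr Cc; apply/funext => x; exact: mulN1r.
Qed.

Lemma CcB f g : Cc f -> Cc g -> Cc (fun x => f x - g x).
Proof. move=> fC gC; exact: CcD fC (CcN gC). Qed.

Lemma Cc_sum (I : finType) (F : I -> 'rV[R]_d -> R) :
  (forall i, Cc (F i)) -> Cc (fun x => \sum_i F i x).
Proof.
move=> FC; rewrite (_ : (fun _ => _) = \sum_i F i).
  elim/big_ind : _ => //; [exact: Cc0|by move=> *; exact: CcD].
by apply/funext => x; rewrite fct_sumE.
Qed.

End integrability.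

Section fubini_integrable.
Context {R : realType} {d : nat}.
Variable f : 'rV[R]_d.+1 -> \bar R.
Hypothesis intf : lebesgue_rV.-integrable setT f.

Let mf : measurable_fun setT f. Proof. exact: measurable_int intf. Qed.

Let intp : (lebesgue_measure \x @lebesgue_rV R d)%E.-integrable setT
  (f \o @rV_cons R d).
Proof.
apply/integrableP; split; first by apply: measurableT_comp => //; exact: measurable_rV_cons.
move/integrableP : intf => [_]; apply: le_lt_trans.
rewrite -[leRHS]/(\int[pushforward (lebesgue_measure \x @lebesgue_rV R d) (@rV_cons R d)]_x `|f x|)%E.
rewrite (ge0_integral_pushforward (measurable_rV_cons (d := d)))//=.
exact: measurableT_comp.
Qed.

(** Fubini's theorem, with the first coordinate outside; the next lemma has it
    inside. Both orders are needed: the second one to integrate along the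
    first coordinate, the first one to reduce the dimension. *)
Lemma integral_rV_cons : (\int[lebesgue_rV]_x f x =
   \int[lebesgue_measure]_t \int[lebesgue_rV]_x f (rV_cons (t, x)))%E.
Proof.
rewrite -[LHS]/(\int[pushforward (lebesgue_measure \x @lebesgue_rV R d) (@rV_cons R d)]_x f x)%E.
rewrite (integral_pushforward (measurable_rV_cons (d := d)))//=.
by rewrite preimage_setT (integral12_prod_meas1 intp).
Qed.

Lemma integral_rV_cons_sym : (\int[lebesgue_rV]_x f x =
   \int[lebesgue_rV]_x \int[lebesgue_measure]_t f (rV_cons (t, x)))%E.
Proof.
rewrite -[LHS]/(\int[pushforward (lebesgue_measure \x @lebesgue_rV R d) (@rV_cons R d)]_x f x)%E.
rewrite (integral_pushforward (measurable_rV_cons (d := d)))//=.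
by rewrite preimage_setT (integral21_prod_meas1 intp).
Qed.

End fubini_integrable.

Section divergence.
Context {R : realType}.
Local Notation e_ i := (delta_mx 0 i).

Lemma integral_derive1_eq0 (h h' : R -> R) (L : R) :
  (forall t : R, is_derive t 1 h (h' t)) -> continuous h' ->
  (forall t, L < `|t| -> h t = 0) ->
  (\int[lebesgue_measure]_t (h' t)%:E = 0)%E.
Proof.
move=> dh ch' h0.
have h'0 t : L < `|t| -> h' t = 0.
  move=> Lt; have [_ <-] := dh t.
  rewrite (@near_eq_derive _ _ _ _ (cst 0)) ?derive_cst//.
  have : \forall s \near t, L < `|s|.
    by have /cvgr_gt/(_ _ Lt) := @norm_continuous R R t.
  by apply: filterS => s /h0 ->.
pose M := `|L| + 1.
have M0 : 0 < M by rewrite ltr_wpDl.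
have LM : L < M by rewrite ltr_pwDr// ler_norm.
have -> : (\int[lebesgue_measure]_t (h' t)%:E =
    \int[lebesgue_measure]_(t in `[(- M)%R, M]) (h' t)%:E)%E.
  rewrite [RHS]integral_mkcond; apply: eq_integral => t _.
  rewrite patchE; case: ifPn => // /negP tM; rewrite h'0//.
  rewrite ltNge; apply/negP => tL; apply: tM; rewrite inE/= in_itv/= -ler_norml.
  exact: le_trans tL (ltW LM).
have ch : continuous h.
  by move=> t; apply/differentiable_continuous/derivable1_diffP; case: (dh t).
rewrite (@continuous_FTC2 _ h' h).
- by rewrite !h0 ?subee// ?normrN gtr0_norm.
- by rewrite gtrN.
- exact: continuous_subspaceT.
- split; first by move=> t _; case: (dh t).
  + by apply: cvg_at_right_filter; exact: ch.
  + by apply: cvg_at_left_filter; exact: ch.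
- by move=> t _; rewrite derive1E; case: (dh t).
Qed.

Lemma partial_bdd_supp d (g g' : 'rV[R]_d -> R) i L :
  (forall x, is_derive x (e_ i) g (g' x)) ->
  (forall x, ~ box L x -> g x = 0) -> forall x, ~ box L x -> g' x = 0.
Proof.
move=> dg g0 x nL; have [_ <-] := dg x.
rewrite (@near_eq_derive _ _ _ _ (cst 0)) ?derive_cst//.
have oB : open (~` box L : set 'rV[R]_d).
  by apply: closed_openC; apply: compact_closed_rV; exact: box_compact.
by have : nbhs x (~` box L) by [exact: open_nbhs_nbhs]; apply: filterS => y /g0 ->.
Qed.

Lemma continuous_rV_cons1 d (x : 'rV[R]_d) : continuous (fun t : R => rV_cons (t, x)).
Proof.
apply: continuous_rV_coords => i; case: (unliftP ord0 i) => [j ->|->].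
  under eq_fun do rewrite rV_cons_lift/=; by move=> t; exact: cst_continuous.
under eq_fun do rewrite rV_cons_coord0/=; by move=> t.
Qed.

Lemma continuous_rV_cons2 d (t : R) : continuous (fun x : 'rV[R]_d => rV_cons (t, x)).
Proof.
apply: continuous_rV_coords => i; case: (unliftP ord0 i) => [j ->|->].
  under eq_fun do rewrite rV_cons_lift/=; by move=> x; exact: coord_continuous.
under eq_fun do rewrite rV_cons_coord0/=; by move=> x; exact: cst_continuous.
Qed.

(** The divergence theorem for one component of a field of bounded support.
    For the first coordinate, integrate along it first and apply the
    fundamental theorem of calculus; for another coordinate, slice along the
    first one and use induction on the dimension. *)
Theorem integral_partial_eq0 d (i : 'I_d) (g g' : 'rV[R]_d -> R) :
  (forall x, is_derive x (e_ i) g (g' x)) -> continuous g' -> bdd_supp g ->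
  (\int[lebesgue_rV]_x (g' x)%:E = 0)%E.
Proof.
move=> dg cg' [L gL].
have g'L := partial_bdd_supp dg gL.
have ig' : lebesgue_rV.-integrable setT (EFin \o g').
  by apply: integrable_Cc; split => //; exists L.
(* The integrability and support statements are kept in the induction: they
   are inherited by slices. *)
elim: d => [|d IH] in i g g' dg cg' L gL g'L ig' *; first by case: i dg.
case: (unliftP ord0 i) dg => [j ->|->] dg.
  rewrite integral_rV_cons// -[RHS](integral0 lebesgue_measure setT).
  apply: eq_integral => t _ /=.
  have g2L x : ~ box L x -> g (rV_cons (t, x)) = 0.
    by move=> nL; apply: gL => /box_cons[].
  have g2'L x : ~ box L x -> g' (rV_cons (t, x)) = 0.
    by move=> nL; apply: g'L => /box_cons[].
  have cg2 : continuous (fun x => g' (rV_cons (t, x))).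
    move=> x; apply: (@continuous_comp _ _ _ (fun x => rV_cons (t, x)) g').
      exact: continuous_rV_cons2.
    exact: cg'.
  apply: (IH j (fun x => g (rV_cons (t, x))) _ _ _ L) => //.
  - move=> x; have /is_derive1P H := dg (rV_cons (t, x)); apply/is_derive1P.
    by under eq_fun do rewrite rV_cons_shift_lift.
  - by apply: integrable_Cc; split => //; exists L.
rewrite integral_rV_cons_sym// -[RHS](integral0 (@lebesgue_rV R d) setT).
apply: eq_integral => x _ /=.
apply: (@integral_derive1_eq0 (fun t => g (rV_cons (t, x))) (fun t => g' (rV_cons (t, x))) L).
- move=> t; have /is_derive1P H := dg (rV_cons (t, x)); apply/is_derive1P.
  under eq_fun do rewrite [_ *: _]mulr1 rV_cons_shift0; exact: H.
- move=> t; apply: (@continuous_comp _ _ _ (fun t => rV_cons (t, x)) g').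
    exact: continuous_rV_cons1.
  exact: cg'.
- by move=> t Lt; apply: gL => /box_cons[/=]; rewrite leNgt Lt.
Qed.

End divergence.

(** * Pointwise derivatives, flat functions, pointwise continuity *)

Section real_derivatives.
Context {R : realType} {V : normedModType R}.
Implicit Types (f g : V -> R).

Lemma is_derive_ext f g (x v : V) (df df' : R) :
  (\forall y \near x, f y = g y) -> df = df' ->
  is_derive x v f df -> is_derive x v g df'.
Proof. by move=> fg <-; exact: near_eq_is_derive. Qed.

Lemma is_derive_extT f g (x v : V) (df df' : R) :
  (forall y, f y = g y) -> df = df' ->
  is_derive x v f df -> is_derive x v g df'.
Proof. by move=> /funext -> <-. Qed.

Lemma is_derive_add f g (x v : V) (df dg : R) :
  is_derive x v f df -> is_derive x v g dg ->
  is_derive x v (fun y => f y + g y) (df + dg).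
Proof. by move=> hf hg; exact: is_deriveD. Qed.

Lemma is_derive_mul f g (x v : V) (df dg : R) :
  is_derive x v f df -> is_derive x v g dg ->
  is_derive x v (fun y => f y * g y) (df * g x + f x * dg).
Proof.
move=> hf hg; apply: is_derive_ext (is_deriveM hf hg); first exact: nearW.
by rewrite /GRing.scale/=; ring.
Qed.

Lemma is_derive_scale (k : R) f (x v : V) (df : R) :
  is_derive x v f df -> is_derive x v (fun y => k * f y) (k * df).
Proof. by move=> hf; exact: is_deriveZ. Qed.

Lemma is_derive_const (k : R) (x v : V) : is_derive x v (fun=> k) 0.
Proof. exact: is_derive_cst. Qed.

Lemma is_derive_comp f (g : R -> R) (x v : V) (df dg : R) :
  is_derive x v f df -> is_derive (f x) 1 g dg ->
  is_derive x v (fun y => g (f y)) (dg * df).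
Proof.
move=> /is_derive1P hf hg; apply/is_derive1P.
have E : f (0 *: v + x) = f x by rewrite scale0r add0r.
have hg' : is_derive (f (0 *: v + x)) 1 g dg by rewrite E.
exact: (@is_derive1_comp _ g (fun h : R => f (h *: v + x)) 0 dg df hg' hf).
Qed.

Lemma is_derive_unique f (x v : V) (d1 d2 : R) :
  is_derive x v f d1 -> is_derive x v f d2 -> d1 = d2.
Proof. by move=> [_ <-] [_ <-]. Qed.

End real_derivatives.

(** Differentiation turns even functions into odd ones and conversely; [s] is
    the sign. *)
Lemma derive_parity (R : realType) (s : R) (f f' : R -> R) (t : R) :
  (forall t : R, is_derive t 1 f (f' t)) -> (forall t, f (- t) = s * f t) ->
  f' (- t) = - (s * f' t).
Proof.
move=> df fN.
have dN : is_derive t 1 (fun s : R => - s) (-1).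
  by apply: is_derive_extT (is_derive_scale (-1) (is_derive_id t 1)) => [y|];
    rewrite ?mulN1r// mulr1.
have := is_derive_comp dN (df (- t)); rewrite mulrN1.
under eq_fun do rewrite fN.
by move=> /is_derive_unique/(_ (is_derive_scale s (df t))) <-; rewrite opprK.
Qed.

Section bumps.
Context {R : realType}.

(** The family of flat functions [t^-n exp(-1/t)], extended by [0] to [t <=
    0]. A derivative of a member is a combination of members, so smoothness
    never requires handling higher derivatives. *)
Definition expinv (n : nat) (t : R) : R :=
  if 0 < t then t^-1 ^+ n * expR (- t^-1) else 0.

Lemma expXN_le (n : nat) (s : R) : 0 <= s -> s ^+ n * expR (- s) <= n`!%:R.
Proof.
move=> s0; rewrite expRN ler_pdivrMr ?expR_gt0//.
case: n => [|n]; first by rewrite expr0 fact0 mul1r -expR0 ler_expR.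
have := expR_ge1Dxn n s0 => H.
rewrite mulrC -ler_pdivrMr ?ltr0n ?fact_gt0//; apply: le_trans H.
by rewrite lerDr.
Qed.

(** At [0] the difference quotient is [h^-(n+1) exp(-1/h)], which tends to [0]
    because [exp] grows faster than any power. *)
Lemma is_derive_expinv n (t : R) :
  is_derive t 1 (expinv n) (expinv n.+2 t - n%:R * expinv n.+1 t).
Proof.
have [t0|t0|->] := ltgtP t 0.
- apply: (is_derive_ext _ _ (is_derive_const 0 t 1)).
    by near=> s; rewrite /expinv ltNge (ltW _)//; near: s; exact: lt_nbhsl.
  by rewrite /expinv ltNge (ltW t0)/= mulr0 subr0.
- have tn0 : t != 0 by rewrite gt_eqF.
  have dV : is_derive t 1 (fun s : R => s^-1) (- t ^- 2).
    apply: is_derive_extT (is_deriveV tn0 (is_derive_id t 1)); first by [].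
    by rewrite /GRing.scale/= mulr1.
  have dX : is_derive t 1 (fun s : R => s^-1 ^+ n) (n%:R * t^-1 ^+ n.-1 * (- t ^- 2)).
    apply: is_derive_extT (is_deriveX n dV); first by move=> y; rewrite exprfctE.
    by rewrite /GRing.scale/= -mulr_natl.
  have dE : is_derive t 1 (fun s : R => expR (- s^-1)) (expR (- t^-1) * t ^- 2).
    have dN : is_derive t 1 (fun s : R => - s^-1) (t ^- 2).
      apply: is_derive_extT (is_deriveN dV); first by [].
      by rewrite opprK.
    exact: (is_derive_comp dN (is_derive_expR _)).
  apply: (is_derive_ext _ _ (is_derive_mul dX dE)).
    by near=> s; rewrite /expinv ifT//; near: s; exact: lt_nbhsr.
  rewrite /expinv t0 -exprVn !exprS; case: n dX => [|n] _; first by rewrite !mul0r; ring.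
  by rewrite /= !exprS; ring.
have E0 m : expinv m 0 = 0 by rewrite /expinv ltxx.
rewrite !E0 mulr0 subr0.
have C : (fun h : R => h^-1 *: ((expinv n \o shift 0) (h *: 1) - expinv n 0)) @ 0^' --> (0 : R).
  apply/cvgr0Pnorm_lt => e e0.
  pose k : R := n.+2`!%:R.
  have k0 : 0 < k by rewrite ltr0n fact_gt0.
  near=> h.
  rewrite /= E0 subr0 addr0 [_ *: 1]mulr1 /expinv; case: ifPn => h0; last first.
    by rewrite scaler0 normr0.
  have hV0 : 0 <= h^-1 by rewrite invr_ge0 ltW.
  rewrite ger0_norm; last first.
    by rewrite mulr_ge0// mulr_ge0 ?expR_ge0// exprn_ge0.
  have := @expXN_le n.+2 h^-1 hV0.
  rewrite !exprS -!mulrA ler_pdivrMl// => /le_lt_trans; apply.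
  rewrite -ltr_pdivlMr// (le_lt_trans (ler_norm _))//; near: h.
  by apply: dnbhs0_lt; rewrite divr_gt0.
apply: DeriveDef; first by apply/cvg_ex; exists 0.
exact: cvg_lim C.
Unshelve. all: by end_near. Qed.

End bumps.

Section continuity_pointwise.
Context {R : realType} {T : topologicalType}.
Implicit Types (f g : T -> R) (x : T).

Lemma cont_cst (k : R) x : continuous_at x (fun _ : T => k).
Proof. exact: cst_continuous. Qed.

Lemma cont_add f g x : continuous_at x f -> continuous_at x g ->
  continuous_at x (fun y => f y + g y).
Proof. by move=> cf cg; exact: (@cvgD _ R^o _ _ _ _ _ _ _ cf cg). Qed.

Lemma cont_opp f x : continuous_at x f -> continuous_at x (fun y => - f y).
Proof. by move=> cf; exact: (@cvgN _ R^o _ _ _ _ _ cf). Qed.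

Lemma cont_mul f g x : continuous_at x f -> continuous_at x g ->
  continuous_at x (fun y => f y * g y).
Proof. by move=> cf cg; exact: (@cvgM _ _ _ _ _ _ _ _ cf cg). Qed.

Lemma cont_sum (I : finType) (F : I -> T -> R) x :
  (forall i, continuous_at x (F i)) -> continuous_at x (fun y => \sum_i F i y).
Proof.
move=> cF; elim: (index_enum I) => [|i s IH].
  by under eq_fun do rewrite big_nil; exact: cont_cst.
by under eq_fun do rewrite big_cons; exact: cont_add.
Qed.

Lemma cont_comp f (g : R -> R) x : continuous_at x f -> continuous_at (f x) g ->
  continuous_at x (fun y => g (f y)).
Proof. by move=> cf cg; exact: (@continuous_comp _ _ _ f g x cf cg). Qed.

Lemma cont_ext f g x : (\forall y \near x, f y = g y) -> continuous_at x f ->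
  continuous_at x g.
Proof.
move=> fg cf; have fgx := nbhs_singleton fg.
rewrite /continuous_at -fgx; apply: cvg_trans cf.
by apply: near_eq_cvg; apply: filterS fg => y ->.
Qed.

End continuity_pointwise.

Arguments cont_cst {R T} k x.

(** * Smooth bumps on the line *)

Section bump_class.
Context {R : realType}.
Implicit Types (f g : R -> R) (e : R).

(** An explicit class of smooth functions supported in [[-e, e]]: combinations
    of products of flat functions at the two endpoints. The class is stable
    under differentiation ([bump_derivable]), so any first-order property
    proved for its members holds for all their derivatives. *)
Inductive bump e : (R -> R) -> Prop :=
| bump_mul (c : R) m n : bump e (fun t => c * (expinv m (e - t) * expinv n (e + t)))
| bump_add f g : bump e f -> bump e g -> bump e (fun t => f t + g t).

Lemma bump_derivable e f : bump e f ->
  exists2 f', bump e f' & forall t : R, is_derive t 1 f (f' t).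
Proof.
elim=> [c m n|{}f g _ [f' bf' df] _ [g' bg' dg]]; last first.
  exists (fun t => f' t + g' t); first exact: bump_add.
  by move=> t; exact: is_derive_add.
pose F c m n t : R := c * (expinv m (e - t) * expinv n (e + t)).
(* The four terms of the product rule, the derivative of each flat factor
   having two terms. *)
exists (fun t => F (- c) m.+2 n t + (F (c * m%:R) m.+1 n t +
  (F c m n.+2 t + F (- c * n%:R) m n.+1 t))).
  by do 3?[apply: bump_add]; exact: bump_mul.
move=> t.
have d1 : is_derive t 1 (fun s => expinv m (e - s)) ((expinv m.+2 (e - t) - m%:R * expinv m.+1 (e - t)) * -1).
  apply: is_derive_comp; last exact: is_derive_expinv.
  apply: is_derive_extT (is_derive_add (is_derive_const e t 1) (is_derive_scale (-1) (is_derive_id t 1))).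
    by move=> s /=; rewrite mulN1r.
  by rewrite add0r mulr1.
have d2 : is_derive t 1 (fun s => expinv n (e + s)) ((expinv n.+2 (e + t) - n%:R * expinv n.+1 (e + t)) * 1).
  apply: is_derive_comp; last exact: is_derive_expinv.
  apply: is_derive_extT (is_derive_add (is_derive_const e t 1) (is_derive_id t 1)) => //.
  by rewrite add0r.
apply: is_derive_extT (is_derive_scale c (is_derive_mul d1 d2)) => //.
by rewrite /F; ring.
Qed.

Lemma bump_supp e f : bump e f -> forall t, e <= `|t| -> f t = 0.
Proof.
elim=> [c m n t|{}f g _ f0 _ g0 t te]; last by rewrite f0// g0// addr0.
rewrite ler_normr => /orP[te|te].
  by rewrite /expinv ltNge subr_le0 te/= mul0r mulr0.
by rewrite [expinv n _]/expinv ltNge -lerBrDl sub0r lerNr te/= !mulr0.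
Qed.

Lemma bump_continuous e f : bump e f -> continuous f.
Proof.
move=> /bump_derivable[f' _ df] t.
by apply/differentiable_continuous/derivable1_diffP; case: (df t).
Qed.

Lemma bump_bounded e f : bump e f -> exists M, forall t, `|f t| <= M.
Proof.
move=> bf; have : compact (f @` `[- e, e]%classic).
  apply: continuous_compact; last exact: segment_compact.
  by apply: continuous_subspaceT; exact: bump_continuous bf.
move=> /compact_bounded[M [_ HM]]; exists (`|M| + 1) => t.
have [te|te] := ltP `|t| e; last by rewrite (bump_supp bf te) normr0 addr_ge0.
apply: (HM (`|M| + 1)); first by rewrite ltr_pwDr// ler_norm.
by exists t => //=; rewrite in_itv/= -ler_norml ltW.
Qed.

Lemma MVT_exists f f' (s t : R) : (forall x : R, is_derive x 1 f (f' x)) ->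
  exists2 x, `|x - s| <= `|t - s| & f t - f s = f' x * (t - s).
Proof.
move=> df.
have cf (i : interval R) : {within [set` i], continuous f}.
  apply: continuous_subspaceT => x.
  by apply/differentiable_continuous/derivable1_diffP; case: (df x).
have [st|ts|->] := ltgtP s t; last by exists t => //; rewrite !subrr mulr0.
  have [x xst fx] := @MVT R f f' s t st (fun x _ => df x) (cf `[s, t]).
  exists x => //; move: xst; rewrite in_itv/= => /andP[sx xt].
  by rewrite !ger0_norm ?subr_ge0 ?(ltW sx) ?(ltW st)//; lra.
have [x xst fx] := @MVT R f f' t s ts (fun x _ => df x) (cf `[t, s]).
exists x; last by rewrite -opprB fx; ring.
move: xst; rewrite in_itv/= => /andP[tx xs].
by rewrite !ler0_norm ?subr_le0 ?(ltW xs) ?(ltW ts)//; lra.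
Qed.

Lemma bump_lipschitz e f : bump e f ->
  exists M, forall s t, `|f t - f s| <= M * `|t - s|.
Proof.
move=> /bump_derivable[f' /bump_bounded[M HM] df]; exists M => s t.
have [x _ ->] := MVT_exists s t df.
by rewrite normrM ler_wpM2r.
Qed.

(** The bound is uniform in the base point, which is what permits
    differentiation under the integral sign. *)
Lemma bump_taylor e f f' : bump e f -> (forall t : R, is_derive t 1 f (f' t)) ->
  exists M, forall t h, `|f (t + h) - f t - h * f' t| <= M * h ^+ 2.
Proof.
move=> bf df; have [g bg dg] := bump_derivable bf.
have gE t : g t = f' t by exact: is_derive_unique (dg t) (df t).
have [M HM] := bump_lipschitz bg; exists M => t h.
have [x xh ->] := MVT_exists t (t + h) df.
have hE : t + h - t = h by rewrite addrAC subrr add0r.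
rewrite hE in xh *.
have M0 : 0 <= M by have := HM 0 1; rewrite subr0 normr1 mulr1; exact: le_trans.
rewrite -!gE (mulrC h) -mulrBl normrM -real_normK ?num_real// expr2 mulrA ler_wpM2r//.
by apply: le_trans (HM _ _) _; rewrite ler_wpM2l.
Qed.

Lemma bump_even_ge0 e : let f := fun t : R => 1 * (expinv 0 (e - t) * expinv 0 (e + t)) in
  bump e f /\ (forall t, f (- t) = f t) /\ (forall t, 0 <= f t).
Proof.
move=> f; split; first exact: bump_mul.
split=> t; first by rewrite /f opprK [X in 1 * X]mulrC.
rewrite /f mul1r /expinv; do 2 case: ifPn => _; rewrite ?mul0r ?mulr0//.
by rewrite !mulr_ge0 ?expR_ge0.
Qed.

(** The translate of Lebesgue measure takes the right values on intervals, so
    it is Lebesgue measure. *)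
Lemma integral_shift (f : R -> \bar R) (s : R) :
  measurable_fun setT f -> (forall t, 0 <= f t)%E ->
  (\int[lebesgue_measure]_t f (t + s)%R = \int[lebesgue_measure]_t f t)%E.
Proof.
move=> mf f0.
have ms : measurable_fun [set: measurableTypeR R] ((fun t => t + s) : measurableTypeR R -> measurableTypeR R).
  exact: measurable_funD.
pose nu : {measure set (measurableTypeR R) -> \bar R} :=
  measure_function_pushforward__canonical__measure_function_Measure lebesgue_measure ms.
have nuE A : measurable A -> lebesgue_measure A = nu A.
  move=> mA; apply: lebesgue_measure_unique => // _ [[a b]] _ <-.
  rewrite /nu/= /pushforward.
  rewrite (_ : _ @^-1` _ = `](a - s), (b - s)]%classic); last first.
    by apply/seteqP; split => t /=; rewrite !in_itv/= ltrBlDr lerBrDr.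
  rewrite !lebesgue_measure_itv/= !lte_fin ltrD2r; case: ifP => // _.
  by rewrite -!EFinD; congr EFin; ring.
rewrite [RHS](eq_measure_integral nu)//; last by move=> A mA _; first [exact: nuE|exact/esym/nuE].
transitivity (\int[pushforward (@lebesgue_measure R) (fun t : measurableTypeR R => (t + s)%R : measurableTypeR R)]_t f t)%E; last by [].
by symmetry; apply: etrans; first exact: (@ge0_integral_pushforward _ _ _ _ _ _ ms lebesgue_measure setT f measurableT mf (fun t _ => f0 t)).
Qed.

Lemma integrable_continuous_supp (f : R -> R) (L : R) : continuous f ->
  (forall t, L < `|t| -> f t = 0) ->
  lebesgue_measure.-integrable setT (EFin \o f).
Proof.
move=> cf f0.
have : lebesgue_measure.-integrable `[- L, L]%classic (EFin \o f).
  apply: continuous_compact_integrable; first exact: segment_compact.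
  exact: continuous_subspaceT.
have [H _] := @integrable_mkcond _ (measurableTypeR R) R lebesgue_measure
  `[- L, L]%classic (EFin \o f) (measurable_itv _).
move/H; rewrite (_ : (EFin \o f) \_ _ = EFin \o f)//.
apply/funext => x; rewrite patchE; case: ifPn => // /negP xL.
rewrite /= f0// ltNge; apply/negP => xL'; apply: xL.
by rewrite inE/= in_itv/= -ler_norml.
Qed.

(** Normalize the simplest even member of the class; its integral is positive
    because it is bounded below on [[-e/2, e/2]]. *)
Lemma mollifier1 e : 0 < e -> exists k : R -> R,
  [/\ bump e k, forall t, k (- t) = k t, forall t, 0 <= k t &
      (\int[lebesgue_measure]_t (k t)%:E = 1)%E].
Proof.
move=> e0; pose f (t : R) := 1 * (expinv 0 (e - t) * expinv 0 (e + t)).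
have [bf [fN f0]] : bump e f /\ (forall t, f (- t) = f t) /\ (forall t, 0 <= f t) := bump_even_ge0 e.
have cf := bump_continuous bf.
have fi : lebesgue_measure.-integrable setT (EFin \o f).
  by apply: (@integrable_continuous_supp f e cf) => t /ltW; exact: bump_supp bf _.
have If0 : (0 < \int[lebesgue_measure]_t (f t)%:E)%E.
  pose a := expinv 0 (e / 2).
  have a0 : 0 < a by rewrite /a /expinv ifT ?divr_gt0// mulr_gt0 ?expR_gt0 ?exprn_gt0 ?invr_gt0 ?divr_gt0.
  have am (s : R) : e / 2 <= s -> a <= expinv 0 s.
    move=> es; rewrite /a /expinv !ifT ?divr_gt0// ?(lt_le_trans _ es) ?divr_gt0//.
    by rewrite !expr0 !mul1r ler_expR lerN2 lef_pV2// posrE ?(lt_le_trans _ es) ?divr_gt0.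
  apply: (@lt_le_trans _ _ (\int[lebesgue_measure]_(t in `[(- (e / 2))%R, (e / 2)%R]) (a * a)%:E)%E).
    rewrite integral_cst//= lebesgue_measure_itv/= lte_fin ifT; last by rewrite gtrN// divr_gt0.
    by rewrite -EFinD -EFinM lte_fin mulr_gt0 ?mulr_gt0// opprK -splitr.
  rewrite integral_mkcond; apply: ge0_le_integral => //.
  - by move=> t _; rewrite patchE; case: ifPn => // _; rewrite lee_fin mulr_ge0 ?ltW.
  - apply: (proj1 (@measurable_restrictT _ _ (measurableTypeR R) (\bar R) `[(- (e / 2))%R, (e / 2)%R]%classic (cst (a * a)%:E) (measurable_itv _))).
    exact: measurable_cst.
  - exact: measurable_int fi.
  - move=> t _; rewrite patchE; case: ifPn => [|_]; last by rewrite lee_fin f0.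
    rewrite inE/= in_itv/= => /andP[t1 t2]; rewrite lee_fin /f mul1r.
    have e2 := splitr e.
    by apply: ler_pM; rewrite ?(ltW a0)//; apply: am; lra.
have Ify : (\int[lebesgue_measure]_t (f t)%:E < +oo)%E.
  by apply: integrable_lty fi.
pose Z := fine (\int[lebesgue_measure]_t (f t)%:E)%E.
have ZE : (Z%:E = \int[lebesgue_measure]_t (f t)%:E)%E.
  by rewrite fineK// ge0_fin_numE// ltW.
have Z0 : 0 < Z by rewrite -lte_fin ZE.
exists (fun t => Z^-1 * (expinv 0 (e - t) * expinv 0 (e + t))).
have E t : Z^-1 * (expinv 0 (e - t) * expinv 0 (e + t)) = Z^-1 * f t by rewrite /f mul1r.
split.
- exact: bump_mul.
- by move=> t; rewrite !E fN.
- by move=> t; rewrite E mulr_ge0 ?f0// invr_ge0 ltW.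
under eq_integral do rewrite E EFinM.
by rewrite integralZl// -ZE -EFinM mulVf ?gt_eqF.
Qed.

End bump_class.

(** * Product kernels and convolution *)

Section smooth_classes.
Context {R : realType}.
Local Notation e_ i := (delta_mx 0 i).

Lemma lipschitz_cont (V : normedModType R) (F : V -> R) :
  (exists C, forall x x', `|F x - F x'| <= C * `|x - x'|) -> continuous F.
Proof.
move=> [C HC] x; apply/cvgrPdist_lt => e e0.
near=> y; apply: le_lt_trans (HC _ _) _.
apply: (@le_lt_trans _ _ ((`|C| + 1) * `|x - y|)).
  by rewrite ler_wpM2r// (le_trans (ler_norm C))// lerDl.
rewrite -ltr_pdivlMl ?ltr_wpDl//; near: y.
by apply: cvgr_dist_lt; [exact: cvg_id|rewrite mulr_gt0// invr_gt0 ltr_wpDl].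
Unshelve. all: by end_near. Qed.

(** A quadratic remainder identifies the derivative. Unlike a limit, such a
    bound survives integration in a parameter. *)
Lemma is_derive_quad (V : normedModType R) (F : V -> R) x v D :
  (exists C, forall h : R, `|F (h *: v + x) - F x - h * D| <= C * h ^+ 2) ->
  is_derive x v F D.
Proof.
move=> [C HC].
have H : (fun h : R => h^-1 *: ((F \o shift x) (h *: v) - F x)) @ 0^' --> D.
  apply/cvgrPdist_lt => e e0; near=> h.
  have h0 : h != 0 by near: h; exact: nbhs_dnbhs_neq.
  have -> : D - h^-1 *: ((F \o shift x) (h *: v) - F x) =
      - (h^-1 * (F (h *: v + x) - F x - h * D)).
    by rewrite /= /GRing.scale/=; field.
  rewrite normrN normrM normfV mulrC ltr_pdivrMr ?normr_gt0//.
  apply: le_lt_trans (HC _) _.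
  rewrite -real_normK ?num_real// expr2 mulrA ltr_pM2r ?normr_gt0//.
  apply: (@le_lt_trans _ _ ((`|C| + 1) * `|h|)).
    by rewrite ler_wpM2r// (le_trans (ler_norm C))// lerDl.
  rewrite -ltr_pdivlMl ?ltr_wpDl//; near: h.
  by apply: dnbhs0_lt; rewrite mulr_gt0// invr_gt0 ltr_wpDl.
by apply: DeriveDef; [apply/cvg_ex; exists D|exact: cvg_lim H].
Unshelve. all: by end_near. Qed.

(** A class of continuous functions stable under partial derivatives consists
    of smooth functions. *)
Lemma Ck_class d (S : ('rV[R]_d -> R) -> Prop) :
  (forall f, S f -> continuous f /\
     forall i, exists2 f', S f' & forall x, is_derive x (e_ i) f (f' x)) ->
  forall f, S f -> forall k U, Ck k U f.
Proof.
move=> HS f Sf k U; elim: k f Sf => [|k IH] f Sf; have [cf df] := HS _ Sf.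
  by split => //; exact: continuous_subspaceT.
split; first exact: continuous_subspaceT.
move=> i; have [f' Sf' Df] := df i.
split; first by move=> x _; case: (Df x).
rewrite (_ : partial i f = f'); first exact: IH.
by apply/funext => x; rewrite /partial; case: (Df x).
Qed.

End smooth_classes.

Section kernels.
Context {R : realType} {d : nat}.
Local Notation e_ i := (delta_mx 0 i).
Implicit Types (G : 'I_d -> R -> R) (x y : 'rV[R]_d).

(** Product kernels. Replacing the factor [G i] by its derivative, as [upd]
    does, is partial differentiation in [x_i], so these kernels again form a
    class stable under differentiation. *)
Definition kern G x y := \prod_i G i (x ord0 i - y ord0 i).

Definition upd G (i : 'I_d) (g : R -> R) : 'I_d -> R -> R :=
  fun j => if j == i then g else G j.

Definition bumps e G := forall i, bump e (G i).

Lemma bumps_upd e G i g : bumps e G -> bump e g -> bumps e (upd G i g).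
Proof. by move=> bG bg j; rewrite /upd; case: ifP. Qed.

Lemma updD1 G i g x y : kern (upd G i g) x y =
  g (x ord0 i - y ord0 i) * \prod_(j | j != i) G j (x ord0 j - y ord0 j).
Proof.
rewrite /kern (bigD1 i)//= /upd eqxx; congr (_ * _).
by apply: eq_bigr => j /negPf ->.
Qed.

Lemma kernD1 G i x y : kern G x y =
  G i (x ord0 i - y ord0 i) * \prod_(j | j != i) G j (x ord0 j - y ord0 j).
Proof. by rewrite /kern (bigD1 i). Qed.

Lemma bumps_bounded e G (P : pred 'I_d) : bumps e G -> exists2 M, 0 <= M &
  forall x y, `|\prod_(j | P j) G j (x ord0 j - y ord0 j)| <= M.
Proof.
move=> bG.
have /choice[M HM] : forall i, exists M, forall t, `|G i t| <= M.
  by move=> i; exact: bump_bounded (bG i).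
exists (\prod_(j | P j) M j).
  by apply: prodr_ge0 => i _; apply: le_trans (HM i 0).
move=> x y; rewrite normr_prod; apply: ler_prod => i _.
by rewrite normr_ge0 HM.
Qed.

(** Telescope the product one factor at a time. *)
Lemma kern_lipschitz e G : bumps e G ->
  exists C, forall y x x', `|kern G x y - kern G x' y| <= C * `|x - x'|.
Proof.
move=> bG; rewrite /kern.
have /choice[M HM] : forall i, exists M, forall t, `|G i t| <= M.
  by move=> i; exact: bump_bounded (bG i).
have /choice[L HL] : forall i, exists L, forall s t, `|G i t - G i s| <= L * `|t - s|.
  by move=> i; exact: bump_lipschitz (bG i).
have L0 i : 0 <= L i.
  by have := HL i 0 1; rewrite subr0 normr1 mulr1; exact: le_trans.
have M0 i : 0 <= M i by apply: le_trans (HM i 0).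
suff H : forall r : seq 'I_d, exists2 C, 0 <= C & forall y x x',
    `|\prod_(i <- r) G i (x ord0 i - y ord0 i)| <= \prod_(i <- r) M i /\
    `|\prod_(i <- r) G i (x ord0 i - y ord0 i) - \prod_(i <- r) G i (x' ord0 i - y ord0 i)| <= C * `|x - x'|.
  by have [C _ HC] := H (index_enum 'I_d); exists C => y x x'; case: (HC y x x').
elim => [|i r [C C0 IH]].
  by exists 0 => // y x x'; rewrite !big_nil subrr normr0 normr1 mul0r.
exists (M i * C + L i * \prod_(j <- r) M j).
  by rewrite addr_ge0 ?mulr_ge0 ?prodr_ge0.
move=> y x x'; rewrite !big_cons; have [H1 H2] := IH y x x'; have [H1' _] := IH y x' x.
split; first by rewrite normrM ler_pM.
set a := G i _; set b := G i _; set A := \prod_(_ <- _) G _ _; set B := \prod_(_ <- _) G _ (x' _ _ - _).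
(* One step of the telescoping. *)
have -> : a * A - b * B = a * (A - B) + (a - b) * B by ring.
apply: le_trans (ler_normD _ _) _; rewrite !normrM mulrDl lerD// -mulrA.
  by apply: ler_pM => //; exact: HM.
rewrite [X in L i * X]mulrC mulrA; apply: ler_pM => //.
apply: le_trans (HL i _ _) _; rewrite ler_wpM2l//.
have -> : x ord0 i - y ord0 i - (x' ord0 i - y ord0 i) = (x - x') ord0 i.
  by rewrite !mxE; ring.
exact: normr_rV_coord.
Qed.

Lemma kern_shift_other (i j : 'I_d) (h : R) x : j != i ->
  (h *: e_ i + x) ord0 j = x ord0 j.
Proof. by move=> ji; rewrite !mxE eqxx (negPf ji) mulr0 add0r. Qed.

Lemma kern_shift_same (i : 'I_d) (h : R) x : (h *: e_ i + x) ord0 i = h + x ord0 i.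
Proof. by rewrite !mxE !eqxx mulr1. Qed.

(** Only the [i]-th factor changes along the [i]-th axis, so this is
    [bump_taylor] times bounded factors. *)
Lemma kern_taylor e G i g : bumps e G -> (forall t : R, is_derive t 1 (G i) (g t)) ->
  exists C, forall x y h,
    `|kern G (h *: e_ i + x) y - kern G x y - h * kern (upd G i g) x y| <= C * h ^+ 2.
Proof.
move=> bG dg.
have [M M0 HM] := bumps_bounded (fun j => j != i) bG.
have [C HC] := bump_taylor (bG i) dg.
exists (C * M) => x y h; rewrite updD1 !(kernD1 _ i) kern_shift_same.
rewrite (eq_bigr (fun j => G j (x ord0 j - y ord0 j))); last first.
  by move=> j ji; rewrite kern_shift_other.
rewrite mulrA -mulrBl -mulrBl normrM mulrAC; apply: ler_pM => //.
have -> : h + x ord0 i - y ord0 i = x ord0 i - y ord0 i + h by ring.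
exact: HC.
Qed.

Lemma kern_continuous e G y : bumps e G -> continuous (kern G ^~ y).
Proof.
move=> bG; apply: lipschitz_cont; have [C HC] := kern_lipschitz bG.
by exists C => x x'; exact: HC.
Qed.

Lemma kern_is_derive e G i g y x : bumps e G ->
  (forall t : R, is_derive t 1 (G i) (g t)) ->
  is_derive x (e_ i) (kern G ^~ y) (kern (upd G i g) x y).
Proof.
move=> bG dg; apply: is_derive_quad; have [C HC] := kern_taylor bG dg.
by exists C => h; exact: HC.
Qed.

Lemma kern_supp e G x y i : bumps e G -> e <= `|x ord0 i - y ord0 i| -> kern G x y = 0.
Proof. by move=> bG xy; rewrite (kernD1 _ i) (bump_supp (bG i) xy) mul0r. Qed.

Lemma kern_Ck e G y k U : bumps e G -> Ck k U (kern G ^~ y).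
Proof.
move=> bG; pose S f := exists2 G, bumps e G & f = kern G ^~ y.
apply: (@Ck_class _ _ S); last by exists G.
move=> _ [H bH ->]; split; first exact: kern_continuous bH.
move=> i; have [g bg dg] := bump_derivable (bH i).
exists (kern (upd H i g) ^~ y); first by exists (upd H i g) => //; exact: bumps_upd.
by move=> x; exact: kern_is_derive bH dg.
Qed.

Lemma kern_bounded e G : bumps e G -> exists2 M, 0 <= M & forall x y, `|kern G x y| <= M.
Proof. exact: bumps_bounded. Qed.

End kernels.

Section convolution.
Context {R : realType} {d : nat}.
Local Notation e_ i := (delta_mx 0 i).
Local Notation mu := (@lebesgue_rV R d).
Implicit Types (G : 'I_d -> R -> R) (x y : 'rV[R]_d) (f : 'rV[R]_d -> R).

Definition conv f G x : R := \int[mu]_y (f y * kern G x y).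

Lemma kern_measurable e G x : bumps e G -> measurable_fun setT (kern G x).
Proof.
move=> bG; rewrite /kern.
apply: (@measurable_prod _ _ _ setT _ (index_enum 'I_d) (fun i y => G i (x ord0 i - y ord0 i))).
move=> i _; apply: measurableT_comp.
  apply: continuous_measurable_fun; exact: bump_continuous (bG i).
by apply: measurable_funB => //; exact: measurable_rV_coord.
Qed.

Lemma integrable_mul_bdd f (g : 'rV[R]_d -> R) M :
  mu.-integrable setT (EFin \o f) -> measurable_fun setT g ->
  (forall y, `|g y| <= M) -> mu.-integrable setT (EFin \o (fun y => f y * g y)).
Proof.
move=> fi mg gM.
have M0 : 0 <= M by apply: le_trans (gM 0).
have fi' : mu.-integrable setT (fun y => M%:E * (EFin \o f) y)%E by exact: integrableZl.
apply: le_integrable fi' => //.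
  apply/measurable_EFinP; apply: measurable_funM => //.
  by apply/measurable_EFinP; exact: measurable_int fi.
move=> y _ /=; rewrite lee_fin !normrM (ger0_norm M0) mulrC.
by rewrite ler_wpM2r.
Qed.

Lemma conv_integrable e f G x : mu.-integrable setT (EFin \o f) -> bumps e G ->
  mu.-integrable setT (EFin \o (fun y => f y * kern G x y)).
Proof.
move=> fi bG; have [M _ HM] := kern_bounded bG.
by apply: integrable_mul_bdd (HM x) => //; exact: kern_measurable bG.
Qed.

Lemma Rintegral_mul_le f (g : 'rV[R]_d -> R) M :
  mu.-integrable setT (EFin \o f) -> measurable_fun setT g ->
  (forall y, `|g y| <= M) ->
  `|\int[mu]_y (f y * g y)| <= M * \int[mu]_y `|f y|.
Proof.
move=> fi mg gM; have fgi := integrable_mul_bdd fi mg gM.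
have nfi : mu.-integrable setT (EFin \o (fun y => `|f y|)) by exact: integrable_norm.
apply: le_trans (le_normr_Rintegral _ fgi) _ => //.
rewrite -RintegralZl//; apply: le_Rintegral => //.
- exact: integrable_norm.
- exact: (integrableZl measurableT M nfi).
- by move=> y _; rewrite normrM mulrC ler_wpM2r.
Qed.

Lemma conv_continuous e f G : mu.-integrable setT (EFin \o f) -> bumps e G ->
  continuous (conv f G).
Proof.
move=> fi bG; apply: lipschitz_cont; have [C HC] := kern_lipschitz bG.
exists (C * \int[mu]_y `|f y|) => x x'.
rewrite /conv -RintegralB//; [|exact: conv_integrable fi bG..].
under eq_Rintegral do rewrite -mulrBr.
rewrite mulrAC; apply: Rintegral_mul_le => //.
by apply: measurable_funB; exact: kern_measurable bG.
Qed.

(** The quadratic remainder of the kernel is uniform in [y]; integrating it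
    against [|f|] gives a quadratic remainder for the convolution. *)
Lemma conv_is_derive e f G i g x : mu.-integrable setT (EFin \o f) -> bumps e G ->
  bump e g -> (forall t : R, is_derive t 1 (G i) (g t)) ->
  is_derive x (e_ i) (conv f G) (conv f (upd G i g) x).
Proof.
move=> fi bG bg dg; apply: is_derive_quad; have [C HC] := kern_taylor bG dg.
have bG' := bumps_upd i bG bg.
exists (C * \int[mu]_y `|f y|) => h.
have I1 := conv_integrable (h *: e_ i + x) fi bG.
have I2 := conv_integrable x fi bG.
have I3 := conv_integrable x fi bG'.
have I3' : mu.-integrable setT (EFin \o (fun y => h * (f y * kern (upd G i g) x y))).
  exact: (integrableZl measurableT h I3).
have I12 : mu.-integrable setT (EFin \o (fun y => f y * kern G (h *: e_ i + x) y - f y * kern G x y)).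
  exact: (integrableB measurableT I1 I2).
rewrite /conv -RintegralZl// -RintegralB// -RintegralB//.
under eq_Rintegral do rewrite mulrCA -!mulrBr.
rewrite mulrAC; apply: Rintegral_mul_le => //.
apply: measurable_funB; last by apply: measurable_funM => //; exact: kern_measurable bG'.
by apply: measurable_funB; exact: kern_measurable bG.
Qed.

Lemma conv_Ck e f G k U : mu.-integrable setT (EFin \o f) -> bumps e G ->
  Ck k U (conv f G).
Proof.
move=> fi bG; pose S h := exists2 G, bumps e G & h = conv f G.
apply: (@Ck_class _ _ S); last by exists G.
move=> _ [H bH ->]; split; first exact: conv_continuous bH.
move=> i; have [g bg dg] := bump_derivable (bH i).
exists (conv f (upd H i g)); first by exists (upd H i g) => //; exact: bumps_upd.
by move=> x; exact: conv_is_derive bH bg dg.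
Qed.

Lemma conv_supp e f G x : bumps e G ->
  (forall y, (forall i, `|x ord0 i - y ord0 i| < e) -> f y = 0) -> conv f G x = 0.
Proof.
move=> bG H; rewrite /conv.
rewrite (@eq_Rintegral _ _ _ _ _ (cst 0)) ?Rintegral_cst ?mul0r//.
move=> y _; have [/forallP xy|/forallPn[i]] := boolP [forall i, `|x ord0 i - y ord0 i| < e].
  by rewrite H// mul0r.
by rewrite -leNgt => /(kern_supp bG) ->; rewrite mulr0.
Qed.

End convolution.

(** * Mollifiers *)

Section mollifiers.
Context {R : realType}.
Local Notation e_ i := (delta_mx 0 i).

Definition mollifier (e : R) (k : R -> R) :=
  [/\ bump e k, forall t, k (- t) = k t, forall t, 0 <= k t &
      (\int[lebesgue_measure]_t (k t)%:E = 1)%E].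

Definition J d (k : R -> R) : 'rV[R]_d -> 'rV[R]_d -> R := kern (fun=> k).

Section fixed_kernel.
Variables (e : R) (k : R -> R).
Hypothesis mk : mollifier e k.

Lemma bumps_J d : @bumps R d e (fun=> k).
Proof. by move=> i; case: mk. Qed.

Lemma J_ge0 d (x y : 'rV[R]_d) : 0 <= J k x y.
Proof. by apply: prodr_ge0 => i _; case: mk. Qed.

Lemma J_sym d (x y : 'rV[R]_d) : J k x y = J k y x.
Proof.
by apply: eq_bigr => i _; case: mk => _ kN _ _; rewrite -kN opprB.
Qed.

(** By Tonelli the integral of a product of functions of separate variables is
    the product of the integrals; each factor is a translate of a function of
    integral [1]. *)
Lemma J_int d (x : 'rV[R]_d) : (\int[lebesgue_rV]_y (J k x y)%:E = 1)%E.
Proof.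
have [bk kN k0 k1] := mk.
have mkk : measurable_fun setT k.
  by apply: continuous_measurable_fun; exact: bump_continuous bk.
elim: d x => [|d IH] x.
  under eq_integral do rewrite /J /kern big_ord0.
  by rewrite integral_cst//= mul1e diracT.
rewrite ge0_integral_rV_cons; last 2 first.
- by apply/measurable_EFinP; exact: (kern_measurable x (bumps_J (d := d.+1))).
- by move=> y; rewrite lee_fin J_ge0.
pose x' : 'rV[R]_d := \row_j x ord0 (lift ord0 j).
transitivity (\int[lebesgue_measure]_t (k (x ord0 ord0 - t))%:E)%E.
  apply: eq_integral => t _.
  transitivity (\int[lebesgue_rV]_y ((k (x ord0 ord0 - t))%:E * (J k x' y)%:E))%E.
    apply: eq_integral => y _; rewrite -EFinM; congr EFin.
    rewrite /J /kern big_ord_recl rV_cons_coord0/=; congr (_ * _).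
    by apply: eq_bigr => j _; rewrite rV_cons_lift/= mxE.
  rewrite ge0_integralZl_EFin ?IH ?mule1//.
  - by move=> y _; rewrite lee_fin J_ge0.
  - by apply/measurable_EFinP; exact: (kern_measurable x' (bumps_J (d := d))).
transitivity (\int[lebesgue_measure]_t (k (t + - x ord0 ord0))%:E)%E.
  by apply: eq_integral => t _; rewrite -kN opprB.
by rewrite (integral_shift _ (f := fun t => (k t)%:E))//; apply/measurable_EFinP.
Qed.

Lemma J_integrable d (x : 'rV[R]_d) : lebesgue_rV.-integrable setT (EFin \o J k x).
Proof.
apply/integrableP; split.
  by apply/measurable_EFinP; exact: (kern_measurable x (bumps_J (d := d))).
rewrite (eq_integral (fun y => (J k x y)%:E)) ?J_int ?ltry// => y _ /=.
by rewrite ger0_norm// J_ge0.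
Qed.

Lemma J_Rint d (x : 'rV[R]_d) : \int[lebesgue_rV]_y J k x y = 1.
Proof. by rewrite /Rintegral J_int. Qed.

(** A mollification is an average of [f] over a small cube, so it is as close
    to [c] as [f] is there. *)
Lemma conv_J_dist d (f : 'rV[R]_d -> R) (x : 'rV[R]_d) (c delta : R) :
  lebesgue_rV.-integrable setT (EFin \o f) ->
  (forall y : 'rV[R]_d, (forall i, `|x ord0 i - y ord0 i| < e) -> `|f y - c| <= delta) ->
  `|conv f (fun=> k) x - c| <= delta.
Proof.
move=> fi H.
have I1 := conv_integrable x fi (bumps_J (d := d)).
have I2 : lebesgue_rV.-integrable setT (EFin \o (fun y => c * J k x y)).
  exact: (integrableZl measurableT c (J_integrable x)).
have -> : conv f (fun=> k) x - c = \int[lebesgue_rV]_y (f y * J k x y - c * J k x y).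
  by rewrite RintegralB// RintegralZl ?J_Rint ?mulr1//; exact: J_integrable.
have I3 : lebesgue_rV.-integrable setT (EFin \o (fun y => f y * J k x y - c * J k x y)).
  exact: (integrableB measurableT I1 I2).
apply: le_trans (le_normr_Rintegral _ I3) _ => //.
rewrite -[leRHS]mulr1 -(J_Rint x) -RintegralZl//; last exact: J_integrable.
apply: le_Rintegral => //.
- exact: (integrable_norm I3).
- exact: (integrableZl measurableT delta (J_integrable x)).
move=> y _; rewrite -mulrBl normrM (ger0_norm (J_ge0 _ _)).
have [/forallP xy|/forallPn[i]] := boolP [forall i, `|x ord0 i - y ord0 i| < e].
  by rewrite ler_wpM2r ?J_ge0// H.
by rewrite -leNgt => xy; rewrite /J (kern_supp (bumps_J (d := d)) xy) !mulr0.
Qed.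

Lemma conv_J_bound d (f : 'rV[R]_d -> R) (x : 'rV[R]_d) (M : R) :
  lebesgue_rV.-integrable setT (EFin \o f) ->
  (forall y, `|f y| <= M) -> `|conv f (fun=> k) x| <= M.
Proof.
move=> fi fM; rewrite -[conv _ _ _]subr0; apply: conv_J_dist => // y _.
by rewrite subr0.
Qed.

Lemma mollifier_derivative : exists2 k', bump e k' &
  (forall t : R, is_derive t 1 k (k' t)) /\ forall t, k' (- t) = - k' t.
Proof.
have [bk kN _ _] := mk; have [k' bk' dk] := bump_derivable bk.
exists k' => //; split => // t.
by rewrite (derive_parity t dk (s := 1)) => [|y]; rewrite mul1r.
Qed.

(** Integration by parts: the derivative in [y_i] of [f(y) J(x - y)]
    integrates to zero, and differentiating the kernel in [x_i] or in [y_i]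
    differs by a sign. *)
Lemma conv_J_partial d (f f' : 'rV[R]_d -> R) i (k' : R -> R) x :
  (forall t : R, is_derive t 1 k (k' t)) ->  bump e k' ->
  (forall t, k' (- t) = - k' t) ->
  Cc f -> continuous f' -> (forall y, is_derive y (e_ i) f (f' y)) ->
  conv f (upd (fun=> k) i k') x = conv f' (fun=> k) x.
Proof.
move=> dk bk' kN fC cf' df.
have f'C : Cc f' by split => //; case: fC => _ [L fL]; exists L; exact: partial_bdd_supp df fL.
have bJ := bumps_J (d := d).
have I1 := conv_integrable x (integrable_Cc fC) (bumps_upd i bJ bk').
have I2 := conv_integrable x (integrable_Cc f'C) bJ.
apply/eqP; rewrite eq_sym -subr_eq0 /conv -RintegralB//; apply/eqP.
have dg y : is_derive y (e_ i) (fun y => f y * J k y x)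
    (f' y * kern (fun=> k) x y - f y * kern (upd (fun=> k) i k') x y).
  have H := @kern_is_derive _ _ e (fun=> k) i k' x y bJ dk.
  apply: is_derive_extT (is_derive_mul (df y) H) => //.
  rewrite -/(J k y x) J_sym; congr (_ + _); rewrite -mulrN; congr (_ * _).
  rewrite !updD1 -mulNr -kN opprB; congr (_ * _).
  by apply: eq_bigr => j _; case: mk => _ kE _ _; rewrite -kE opprB.
rewrite /Rintegral (integral_partial_eq0 dg)//.
- have E y : f' y * kern (fun=> k) x y - f y * kern (upd (fun=> k) i k') x y =
    f' y * J k y x + f y * kern (upd (fun=> k) i k') y x.
    rewrite -/(J k x y) J_sym; congr (_ + _); rewrite -mulrN; congr (_ * _).
    rewrite !updD1 -mulNr -kN opprB; congr (_ * _).
    by apply: eq_bigr => j _; case: mk => _ kE _ _; rewrite -kE opprB.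
  rewrite (_ : (fun _ => _) = fun y => f' y * J k y x + f y * kern (upd (fun=> k) i k') y x); last exact/funext.
  move=> y; exact: (cont_add (cont_mul (cf' y) (kern_continuous bJ (x := y)))
    (cont_mul (fC.1 y) (kern_continuous (bumps_upd i bJ bk') (x := y)))).
- by apply: bdd_suppMl; case: fC.
Qed.

End fixed_kernel.

End mollifiers.

(** * Convergence of mollifications in L^1 *)

Section L1_seminorm.
Context {R : realType} {d : nat}.
Local Notation mu := (@lebesgue_rV R d).
Implicit Types (f g h k : 'rV[R]_d -> R) (D : set 'rV[R]_d).

Definition L1 D h : \bar R := (\int[mu]_(x in D) `|h x|%:E)%E.

Let mabs D h : measurable_fun setT h -> measurable_fun D (fun x => `|h x|%:E).
Proof.
by move=> mh; apply/measurable_EFinP; apply: measurable_funTS; exact: measurableT_comp.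
Qed.

Lemma L1_triangle D h k : measurable D -> measurable_fun setT h -> measurable_fun setT k ->
  (L1 D (fun x => (h x + k x)%R) <= L1 D h + L1 D k)%E.
Proof.
move=> mD mh mk; rewrite /L1 -ge0_integralD//; try exact: mabs.
apply: ge0_le_integral => //.
- by apply: mabs; exact: measurable_funD.
- by apply: emeasurable_funD; exact: mabs.
- by move=> x _; rewrite -EFinD lee_fin; exact: ler_normD.
Qed.

Lemma L1_mul D h k M : measurable D -> measurable_fun setT h -> measurable_fun setT k ->
  (forall x, `|k x| <= M) -> (L1 D (fun x => (h x * k x)%R) <= M%:E * L1 D h)%E.
Proof.
move=> mD mh mk kM; have M0 : 0 <= M by apply: le_trans (kM 0).
rewrite /L1 -ge0_integralZl_EFin//; try exact: mabs.
apply: ge0_le_integral => //.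
- by apply: mabs; exact: measurable_funM.
- by apply: measurable_funeM; exact: mabs.
- by move=> x _; rewrite -EFinM lee_fin normrM mulrC ler_wpM2r.
Qed.

Lemma L1_ge0 D h : (0 <= L1 D h)%E.
Proof. by apply: integral_ge0 => x _; rewrite lee_fin. Qed.

(** Bounded convergence on a box, which has finite measure. *)
Lemma L1_bounded_cvg0 L (h : nat -> 'rV[R]_d -> R) M :
  (forall n, measurable_fun setT (h n)) -> (forall n x, `|h n x| <= M) ->
  (forall x, h n x @[n --> \oo] --> 0) ->
  L1 (box L) (h n) @[n --> \oo] --> 0%E.
Proof.
move=> mh hM h0.
have [] := @dominated_convergence _ _ _ mu _ (measurable_box L)
   (fun n x => (h n x)%:E) (cst 0%E) (cst M%:E).
- by move=> n; apply/measurable_EFinP; exact: measurable_funTS.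
- exact: measurable_cst.
- by apply: aeW => x _; apply: cvg_EFin; [exact: nearW|exact: h0].
- apply: (@measurable_bounded_integrable _ _ _ mu (cst M)).
  + exact: measurable_box.
  + exact: lebesgue_rV_box_lty.
  + exact: measurable_cst.
  + exists `|M|; split; first exact: num_real.
    by move=> N MN x _; exact: ltW.
- by apply: aeW => x n _; rewrite /= lee_fin.
move=> _ + _; rewrite /L1.
by under eq_fun do under eq_integral do rewrite sube0.
Qed.

End L1_seminorm.

Section density.
Context {R : realType} {d : nat} (L : R).
Local Notation mu := (@lebesgue_rV R d).
Implicit Types (f g h k : 'rV[R]_d -> R).

Definition bounded_fun h := exists2 M, 0 <= M & forall x, `|h x| <= M.

(** Functions that bounded continuous functions approximate in [L^1] of a box.
    The class is an algebra and is closed under bounded pointwise limits,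
    which is enough to climb from half-spaces to all Borel sets. *)
Definition approx h := [/\ measurable_fun setT h, bounded_fun h &
  forall delta, 0 < delta -> exists g,
    [/\ continuous g, bounded_fun g & (L1 (box L) (fun x => (h x - g x)%R) < delta%:E)%E]].

Lemma L1_box_lty h : measurable_fun setT h -> bounded_fun h ->
  (L1 (box L) h < +oo)%E.
Proof.
move=> mh [M M0 hM].
have : mu.-integrable (box L) (EFin \o h).
  apply: measurable_bounded_integrable.
  - exact: measurable_box.
  - exact: lebesgue_rV_box_lty.
  - exact: measurable_funTS.
  - exists M; split; first exact: num_real.
    by move=> N MN x _; exact: le_trans (hM x) (ltW MN).
by move=> /integrableP[_].
Qed.

Lemma approx_continuous g : continuous g -> bounded_fun g -> approx g.
Proof.
move=> cg bg; split => //; first exact: continuous_measurable_rV.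
move=> delta d0; exists g; split => //.
rewrite /L1; under eq_integral do rewrite subrr normr0.
by rewrite integral0 lte_fin.
Qed.

Lemma approx_cst c : approx (cst c).
Proof.
apply: approx_continuous; first by move=> x; exact: cst_continuous.
by exists `|c|.
Qed.

Lemma bounded_funD g h : bounded_fun g -> bounded_fun h -> bounded_fun (fun x => g x + h x).
Proof.
move=> [M M0 gM] [N N0 hN]; exists (M + N); first exact: addr_ge0.
by move=> x; apply: le_trans (ler_normD _ _) _; exact: lerD.
Qed.

Lemma bounded_funM g h : bounded_fun g -> bounded_fun h -> bounded_fun (fun x => g x * h x).
Proof.
move=> [M M0 gM] [N N0 hN]; exists (M * N); first exact: mulr_ge0.
by move=> x; rewrite normrM; exact: ler_pM.
Qed.

Lemma approxD f h : approx f -> approx h -> approx (fun x => f x + h x).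
Proof.
move=> [mf bf Af] [mh bh Ah]; split; first exact: measurable_funD.
  exact: bounded_funD.
move=> e e0; have e20 : 0 < e / 2 by rewrite divr_gt0.
have [g1 [cg1 bg1 H1]] := Af _ e20; have [g2 [cg2 bg2 H2]] := Ah _ e20.
exists (fun x => g1 x + g2 x); split.
- move=> x; exact: (cont_add (cg1 x) (cg2 x)).
- exact: bounded_funD.
have mg1 := continuous_measurable_rV cg1.
have mg2 := continuous_measurable_rV cg2.
apply: (@le_lt_trans _ _ (L1 (box L) (fun x => (f x - g1 x)%R) + L1 (box L) (fun x => (h x - g2 x)%R))%E).
  have -> : (fun x => f x + h x - (g1 x + g2 x)) = (fun x => (f x - g1 x) + (h x - g2 x)).
    by apply/funext => x; ring.
  by apply: L1_triangle; [exact: measurable_box|exact: measurable_funB..].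
by rewrite (splitr e) EFinD; apply: lteD.
Qed.

(** The two errors are weighted by the bounds of the opposite factors, hence
    the order of the choices: [g2] first, then [g1] with a precision depending
    on [g2]. *)
Lemma approxM f h : approx f -> approx h -> approx (fun x => f x * h x).
Proof.
move=> [mf bf Af] [mh bh Ah]; split; first exact: measurable_funM.
  exact: bounded_funM.
move=> e e0; have e20 : 0 < e / 2 by rewrite divr_gt0.
have [M M0 fM] := bf.
have [|g2 [cg2 bg2 H2]] := Ah (e / 2 / (M + 1)); first by rewrite divr_gt0// ltr_wpDl.
have [N N0 gN] := bg2.
have [|g1 [cg1 bg1 H1]] := Af (e / 2 / (N + 1)); first by rewrite divr_gt0// ltr_wpDl.
have mg1 := continuous_measurable_rV cg1.
have mg2 := continuous_measurable_rV cg2.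
exists (fun x => g1 x * g2 x); split.
- move=> x; exact: (cont_mul (cg1 x) (cg2 x)).
- exact: bounded_funM.
apply: (@le_lt_trans _ _ (L1 (box L) (fun x => ((h x - g2 x) * f x)%R) + L1 (box L) (fun x => ((f x - g1 x) * g2 x)%R))%E).
  have -> : (fun x => f x * h x - (g1 x * g2 x)) = (fun x => (h x - g2 x) * f x + (f x - g1 x) * g2 x).
    by apply/funext => x; ring.
  by apply: L1_triangle; [exact: measurable_box|apply: measurable_funM => //; exact: measurable_funB..].
have K (a : \bar R) (C : R) : 0 <= C -> (0 <= a)%E -> (a < (e / 2 / (C + 1))%:E)%E -> (C%:E * a < (e / 2)%:E)%E.
  case: a => // a C0; rewrite !lte_fin lee_fin => a0.
  rewrite ltr_pdivlMr ?ltr_wpDl// => /(le_lt_trans _); apply.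
  by rewrite mulrC ler_wpM2l// lerDl.
rewrite (splitr e) EFinD; apply: lteD.
- apply: le_lt_trans (K _ M M0 (L1_ge0 _ _) H2).
  by apply: L1_mul => //; [exact: measurable_box|exact: measurable_funB].
- apply: le_lt_trans (K _ N N0 (L1_ge0 _ _) H1).
  by apply: L1_mul => //; [exact: measurable_box|exact: measurable_funB].
Qed.

Lemma approx_lim (h : nat -> 'rV[R]_d -> R) f M : 0 <= M ->
  (forall n, approx (h n)) -> (forall n x, `|h n x| <= M) ->
  (forall x, h n x @[n --> \oo] --> f x) -> approx f.
Proof.
move=> M0 Ah hM hf.
have mh n : measurable_fun setT (h n) by case: (Ah n).
have mf : measurable_fun setT f.
  by apply: measurable_fun_cvg mh _ => x _; exact: hf.
have fM x : `|f x| <= M.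
  apply/ler_addgt0Pr => e e0.
  have /cvgrPdist_lt/(_ _ e0)[N _ /(_ N (leqnn N)) /= H] := hf x.
  rewrite -(subrK (h N x) (f x)) addrC; apply: le_trans (ler_normD _ _) _.
  by rewrite lerD ?hM// ltW.
split => //; first by exists M.
move=> e e0; have e20 : 0 < e / 2 by rewrite divr_gt0.
have : L1 (box L) (fun x => (h n x - f x)%R) @[n --> \oo] --> 0%E.
  apply: (@L1_bounded_cvg0 _ _ _ _ (M + M)).
  - by move=> n; exact: measurable_funB.
  - by move=> n x; apply: le_trans (ler_normB _ _) _; exact: lerD.
  - move=> x; rewrite -(subrr (f x)); apply: cvgB; [exact: hf|exact: cvg_cst].
move=> /fine_cvgP[_ /cvgrPdist_lt/(_ _ e20)].
move=> [N _ /(_ N (leqnn N))/=]; rewrite sub0r normrN.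
have HN : (L1 (box L) (fun x => ((h N x - f x))%R) < +oo)%E.
  apply: L1_box_lty; first exact: measurable_funB.
  exists (M + M); first exact: addr_ge0.
  by move=> x; apply: le_trans (ler_normB _ _) _; exact: lerD.
rewrite ger0_norm ?fine_ge0 ?L1_ge0// => H1.
have {}H1 : (L1 (box L) (fun x => ((h N x - f x))%R) < (e / 2)%:E)%E.
  by rewrite -[ltLHS]fineK ?lte_fin// ge0_fin_numE// L1_ge0.
have [_ _ /(_ _ e20)[g [cg bg H2]]] := Ah N.
exists g; split => //.
have mg := continuous_measurable_rV cg.
apply: (@le_lt_trans _ _ (L1 (box L) (fun x => ((h N x - f x)%R * (-1))%R) + L1 (box L) (fun x => (h N x - g x)%R))%E).
  have -> : (fun x => f x - g x) = (fun x => (h N x - f x) * (-1) + (h N x - g x)).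
    by apply/funext => x; ring.
  apply: L1_triangle; [exact: measurable_box| |exact: measurable_funB].
  by apply: measurable_funM => //; exact: measurable_funB.
rewrite (splitr e) EFinD; apply: lteD => //.
apply: le_lt_trans H1; rewrite -[leRHS]mul1e.
apply: L1_mul => //; first exact: measurable_box.
  exact: measurable_funB.
by move=> x; rewrite normrN1.
Qed.

(** The indicator of a half-space is the increasing limit of the ramps [min(1,
    max(0, n (x_i - a)))]. *)
Lemma approx_ray i a : approx (\1_[set x : 'rV[R]_d | a < x ord0 i]).
Proof.
pose g (n : nat) (x : 'rV[R]_d) := Num.min 1 (Num.max 0 (n%:R * (x ord0 i - a))).
have g0 n x : 0 <= g n x by rewrite /g le_min ler01 le_max lexx.
have g1 n x : `|g n x| <= 1 by rewrite ger0_norm// /g ge_min lexx.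
apply: (@approx_lim g _ 1) => //.
- move=> n; apply: approx_continuous; last by exists 1.
  move=> x; rewrite /g.
  apply: (@continuous_min _ _ (cst 1) (fun x : 'rV[R]_d => Num.max 0 (n%:R * (x ord0 i - a)))).
    exact: cst_continuous.
  apply: (@continuous_max _ _ (cst 0) (fun x : 'rV[R]_d => n%:R * (x ord0 i - a))).
    exact: cst_continuous.
  have H := @coord_continuous R 1 d ord0 i x.
  exact: (cont_mul (cont_cst n%:R x) (cont_add H (cont_cst (- a) x))).
move=> x; rewrite indicE; have [xa|xa] := boolP (x \in _); last first.
  apply: cvg_near_cst; apply: nearW => n; rewrite /g.
  rewrite max_l ?min_r//; rewrite mulr_ge0_le0// subr_le0 leNgt; apply/negP => ax.
  by move/negP: xa; apply; rewrite inE.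
move: xa; rewrite inE/= => xa.
apply: cvg_near_cst; near=> n.
rewrite /g min_l// le_max; apply/orP; right.
rewrite -ler_pdivrMr ?subr_gt0//; near: n; exact: nbhs_infty_ger.
Unshelve. all: by end_near. Qed.

(** Complements correspond to [1 - 1_A], finite unions to [1_A + 1_B - 1_A
    1_B], countable unions to bounded limits. The map [phi] makes the argument
    apply both to Borel sets of [R^d] and, through preimages under a
    coordinate, to Borel sets of the line. *)
Lemma approx_sigma_algebra (B : Type) (phi : set B -> set 'rV[R]_d) :
  phi set0 = set0 -> (forall A, phi (~` A) = ~` phi A) ->
  (forall F : (set B)^nat, phi (\bigcup_i F i) = \bigcup_i phi (F i)) ->
  sigma_algebra setT [set A | approx (\1_(phi A))].
Proof.
  move=> p0 pC pU; split => /=.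
  - rewrite p0 (_ : \1_ _ = cst 0); first exact: approx_cst.
    by apply/funext => x; rewrite indic0.
  - move=> B0 HB; rewrite setTD pC.
    rewrite (_ : \1_ _ = fun x => 1 + -1 * \1_(phi B0) x); last first.
      by apply/funext => x; rewrite !indicE in_setC; case: (_ \in _) => /=; ring.
    by apply: approxD; [exact: approx_cst|apply: approxM => //; exact: approx_cst].
  - move=> F HF; rewrite pU.
    have C1 (A0 B0 : set 'rV[R]_d) : approx \1_A0 -> approx \1_B0 -> approx \1_(A0 `|` B0).
      move=> HA HB; rewrite (_ : \1_ _ = fun x => \1_A0 x + (\1_B0 x + -1 * (\1_A0 x * \1_B0 x))).
        apply: approxD => //; apply: approxD => //; apply: approxM; first exact: approx_cst.
        exact: approxM.
      apply/funext => x; rewrite !indicE in_setU.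
      by case: (x \in A0); case: (x \in B0) => /=; ring.
    apply: (@approx_lim (fun n => \1_(\big[setU/set0]_(i < n) phi (F i))) _ 1) => //.
    + elim => [|n IH].
        rewrite big_ord0 (_ : \1_ _ = cst 0); first exact: approx_cst.
        by apply/funext => x; rewrite indic0.
      by rewrite big_ord_recr; apply: C1 => //; exact: HF.
    + by move=> n x; rewrite indicE; case: (_ \in _); rewrite ?normr1 ?normr0.
    + move=> x; apply: cvg_near_cst.
      have [[k _ Fk]|nF] := pselect ((\bigcup_i phi (F i)) x).
        near=> n.
        have H1 : (\bigcup_i phi (F i)) x by exists k.
        have H2 : (\big[setU/set0]_(i < n) phi (F i)) x.
          by rewrite -(bigcup_mkord n (fun i => phi (F i))); exists k => //=; near: n; exact: nbhs_infty_gt.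
        by rewrite !indicE !mem_set.
      apply: nearW => n; rewrite !indicE !memNset//.
      by move=> /(@bigsetU_bigcup _ (fun i => phi (F i))).
Unshelve. all: by end_near. Qed.

Lemma approx_indic A : measurable A -> approx (\1_A).
Proof.
move=> mA.
have : [set A | approx (\1_(id A))] A.
  move: A mA; apply: smallest_sub; first exact: approx_sigma_algebra.
  rewrite -bigcup_seq/= => _ [i _ [B mB <-]] /=; rewrite setTI.
  have : [set B | approx (\1_((fun v : 'rV[R]_d => v ord0 i) @^-1` B))] B.
    have : (@ocitv R).-sigma.-measurable B by [].
    rewrite (RGenOInfty.measurableE R); move: B {mB}; apply: smallest_sub.
      apply: approx_sigma_algebra => //.
    move=> _ [a ->] /=.
    rewrite (_ : _ @^-1` _ = [set x : 'rV[R]_d | a < x ord0 i]); first exact: approx_ray.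
    by apply/seteqP; split => x /=; rewrite in_itv/= andbT.
  by [].
by [].
Qed.

End density.

Import HBSimple.

Section L1_approximation.
Context {R : realType} {d : nat}.
Local Notation mu := (@lebesgue_rV R d).
Implicit Types (f g h : 'rV[R]_d -> R) (x y : 'rV[R]_d).

(** A continuous cut-off for the box of half-width [L]; it turns approximants
    on a box into approximants of bounded support. *)
Definition plateau (L : R) x : R := Num.min 1 (Num.max 0 (L + 1 - `|x|)).

Lemma plateau_continuous L : continuous (plateau L).
Proof.
move=> x; apply: (@continuous_min _ _ (cst 1) (fun x : 'rV[R]_d => Num.max 0 (L + 1 - `|x|))).
  exact: cst_continuous.
apply: (@continuous_max _ _ (cst 0) (fun x : 'rV[R]_d => L + 1 - `|x|)).
  exact: cst_continuous.
have H := @norm_continuous R 'rV[R]_d x.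
exact: (cont_add (cont_cst (L + 1) x) (cont_opp H)).
Qed.

Lemma plateau_itv L x : 0 <= plateau L x <= 1.
Proof. by rewrite /plateau le_min ler01 le_max lexx ge_min lexx. Qed.

Lemma plateau1 L x : `|x| <= L -> plateau L x = 1.
Proof.
move=> xL; rewrite /plateau min_l// le_max; apply/orP; right; lra.
Qed.

Lemma plateau0 L x : ~ (`|x| <= L + 1) -> plateau L x = 0.
Proof.
move=> /negP; rewrite -ltNge => xL; rewrite /plateau max_l ?min_r//; lra.
Qed.

Lemma box_norm L x : 0 <= L -> box L x <-> `|x| <= L.
Proof. by move=> L0; symmetry; exact: normr_rV_le. Qed.

Lemma sfun_approx (L : R) (h : {sfun 'rV[R]_d >-> R}) : approx L (h : 'rV[R]_d -> R).
Proof.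
rewrite (funext (fimfunEord h)).
elim: (index_enum _) => [|i s IH].
  under eq_fun do rewrite big_nil; exact: approx_cst.
under eq_fun do rewrite big_cons; apply: approxD => //.
by apply: approxM; [exact: approx_cst|exact: approx_indic].
Qed.

(** Approximate by a simple function, then by a continuous function on a
    slightly larger box, and cut off with [plateau]; where the cut-off acts,
    [f] vanishes, so multiplying by it only decreases the error. *)
Lemma dense_Cc f L delta : 0 <= L -> mu.-integrable setT (EFin \o f) ->
  (forall x, ~ box L x -> f x = 0) -> 0 < delta ->
  exists g, [/\ continuous g, forall x, ~ box (L + 1) x -> g x = 0 &
    (L1 setT (fun x => (f x - g x)%R) < delta%:E)%E].
Proof.
move=> L0 fi fL d0.
have d20 : 0 < delta / 2 by rewrite divr_gt0.
have mf : measurable_fun setT f by apply/measurable_EFinP; exact: measurable_int fi.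
have [s_ [si _ s0]] := approximation_sfun_integrable measurableT fi.
have [N Ns] : exists N, (L1 setT (fun x => (f x - s_ N x)%R) < (delta / 2)%:E)%E.
  move/fine_cvgP : s0 => [[N1 _ H1] /cvgrPdist_lt/(_ _ d20)[N2 _ H2]].
  exists (maxn N1 N2).
  have := H2 (maxn N1 N2) (leq_maxr _ _); rewrite /= sub0r normrN => H.
  have F := H1 (maxn N1 N2) (leq_maxl _ _).
  rewrite /L1 -[ltLHS]fineK//.
  rewrite lte_fin; apply: le_lt_trans H; exact: ler_norm.
have [ms bs /(_ _ d20)[g [cg bg Hg]]] := sfun_approx (L + 1) (s_ N).
exists (fun x => g x * plateau L x).
have cgp : continuous (fun x => g x * plateau L x).
  by move=> x; exact: (cont_mul (cg x) (plateau_continuous (L := L) (x := x))).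
split => //.
  move=> x nx; rewrite plateau0 ?mulr0// => H; apply: nx; apply/box_norm => //.
  by rewrite addr_ge0.
have mg := continuous_measurable_rV cg.
have mp := continuous_measurable_rV (plateau_continuous (L := L)).
have mB := @measurable_box R d (L + 1).
apply: (@le_lt_trans _ _ (L1 (box (L + 1)) (fun x => (f x - g x)%R))).
  rewrite {2}/L1 integral_mkcond /L1; apply: ge0_le_integral => //.
  - apply/measurable_EFinP; apply: measurableT_comp => //.
    by apply: measurable_funB => //; exact: measurable_funM.
  - apply: (proj1 (@measurable_restrictT _ _ _ _ (box (L + 1)) _ mB)).
    apply/measurable_EFinP; apply: measurable_funTS; apply: measurableT_comp => //.
    exact: measurable_funB.
  - move=> x _; rewrite patchE; case: ifPn => [|/negP xB].
      rewrite inE => xB; rewrite lee_fin.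
      have [/(box_norm _ L0) xL|xL] := pselect (box L x); first by rewrite plateau1// mulr1.
      rewrite fL// !sub0r !normrN normrM; have /andP[p0 p1] := plateau_itv L x.
      by rewrite (ger0_norm p0) ler_piMr.
    have nx : ~ box (L + 1) x by move=> H; apply: xB; rewrite inE.
    rewrite fL; last first.
      by move=> H; apply: nx => i; apply: le_trans (H i) _; rewrite lerDl.
    rewrite plateau0 ?mulr0 ?subrr ?normr0// => H; apply: nx; apply/box_norm => //.
    by rewrite addr_ge0.
apply: (@le_lt_trans _ _ (L1 (box (L + 1)) (fun x => (f x - s_ N x)%R) + L1 (box (L + 1)) (fun x => (s_ N x - g x)%R))%E).
  have -> : (fun x => f x - g x) = (fun x => (f x - s_ N x) + (s_ N x - g x)).
    by apply/funext => x; ring.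
  by apply: L1_triangle => //; exact: measurable_funB.
rewrite (splitr delta) EFinD; apply: lteD => //.
apply: le_lt_trans Ns; apply: ge0_subset_integral => //.
apply/measurable_EFinP; apply: measurableT_comp => //; exact: measurable_funB.
Qed.

(** Tonelli's theorem and the symmetry of the kernel: its integral in either
    variable is [1]. *)
Lemma conv_L1_le e k h : mollifier e k -> mu.-integrable setT (EFin \o h) ->
  (L1 setT (conv h (fun=> k)) <= L1 setT h)%E.
Proof.
move=> mk hi.
have mh : measurable_fun setT h by apply/measurable_EFinP; exact: measurable_int hi.
have bJ := bumps_J mk (d := d).
pose F (z : 'rV[R]_d * 'rV[R]_d) := (`|h z.2| * J k z.1 z.2)%:E.
have F0 z : (0 <= F z)%E by rewrite lee_fin mulr_ge0// (J_ge0 mk).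
have mF : measurable_fun setT F.
  apply/measurable_EFinP; apply: measurable_funM.
    apply: measurableT_comp => //; exact: (measurableT_comp mh measurable_snd).
  rewrite /J /kern.
  apply: (@measurable_prod _ _ _ setT _ (index_enum 'I_d)
    (fun i (z : 'rV[R]_d * 'rV[R]_d) => k (z.1 ord0 i - z.2 ord0 i))) => i _.
  apply: measurableT_comp.
    by apply: continuous_measurable_fun; case: mk => bk _ _ _; exact: bump_continuous bk.
  apply: measurable_funB.
    exact: (measurableT_comp (measurable_rV_coord i) measurable_fst).
  exact: (measurableT_comp (measurable_rV_coord i) measurable_snd).
apply: (@le_trans _ _ (\int[mu]_x \int[mu]_y F (x, y))%E).
  apply: ge0_le_integral => //.
  - apply/measurable_EFinP; apply: measurableT_comp => //.
    by apply: continuous_measurable_rV; exact: conv_continuous hi bJ.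
  - exact: (@measurable_fun_fubini_tonelli_F _ _ _ _ _ mu F mF F0).
  - move=> x _; have I1 := conv_integrable x hi bJ.
    rewrite (EFin_normr_Rintegral _ I1)//.
    apply: le_trans (le_abse_integral _ _ _) _ => //; first exact: measurable_int I1.
    rewrite le_eqVlt; apply/orP; left; apply/eqP; apply: eq_integral => y _ /=.
    by rewrite /F/= normrM (ger0_norm (J_ge0 mk _ _)).
rewrite (@fubini_tonelli _ _ _ _ _ mu mu F mF F0).
rewrite le_eqVlt; apply/orP; left; apply/eqP; apply: eq_integral => y _.
transitivity (\int[mu]_x (`|h y|%:E * (J k y x)%:E))%E.
  by apply: eq_integral => x _; rewrite /F/= EFinM (J_sym mk).
rewrite ge0_integralZl_EFin ?(J_int mk) ?mule1//.
- by move=> x _; rewrite lee_fin (J_ge0 mk).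
- by apply/measurable_EFinP; exact: (kern_measurable y bJ).
Qed.

Lemma conv_box_supp e k f L x : mollifier e k ->
  (forall x, ~ box L x -> f x = 0) -> ~ box (L + e) x -> conv f (fun=> k) x = 0.
Proof.
move=> mk fL nx; apply: (conv_supp (bumps_J mk (d := d))) => y xy; apply: fL => By.
apply: nx => i; rewrite -(subrK (y ord0 i) (x ord0 i)) addrC.
apply: le_trans (ler_normD _ _) _; rewrite lerD ?By//; exact: ltW.
Qed.

Lemma conv_cvg (e : nat -> R) (k : nat -> R -> R) g x :
  (forall n, mollifier (e n) (k n)) -> e n @[n --> \oo] --> 0 ->
  mu.-integrable setT (EFin \o g) -> continuous g ->
  conv g (fun=> k n) x @[n --> \oo] --> g x.
Proof.
move=> mk e0 gi cg; apply/cvgrPdist_le => eps eps0.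
have /cvgrPdist_le/(_ _ eps0)/nbhs_ballP[r /= r0 Hr] := cg x.
near=> n; rewrite distrC; apply: (conv_J_dist (mk n)) => // y xy.
rewrite distrC; apply: Hr; apply/ball_rVP; split => // i.
apply: lt_trans (xy i) _; apply: le_lt_trans (ler_norm _) _.
near: n; have /cvgrPdist_lt/(_ _ r0) := e0; apply: filterS => n.
by rewrite sub0r normrN.
Unshelve. all: by end_near. Qed.

(** Mollification does not increase the [L^1] norm, so it suffices to prove
    convergence for a continuous function close to [f], for which it is
    uniformly bounded and pointwise. *)
Lemma conv_L1_cvg (e : nat -> R) (k : nat -> R -> R) f L :
  0 <= L -> (forall n, e n <= 1) ->
  (forall n, mollifier (e n) (k n)) -> e n @[n --> \oo] --> 0 ->
  mu.-integrable setT (EFin \o f) -> (forall x, ~ box L x -> f x = 0) ->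
  L1 setT (fun x => conv f (fun=> k n) x - f x) @[n --> \oo] --> 0%E.
Proof.
move=> L0 e1 mk e0 fi fL.
have mf : measurable_fun setT f by apply/measurable_EFinP; exact: measurable_int fi.
have mconv n h : mu.-integrable setT (EFin \o h) -> measurable_fun setT (conv h (fun=> k n)).
  move=> hi; apply: continuous_measurable_rV; exact: conv_continuous hi (bumps_J (mk n) (d := d)).
suff H (delta : R) : 0 < delta -> \forall n \near \oo,
    (L1 setT (fun x => (conv f (fun=> k n) x - f x)%R) < delta%:E)%E.
  apply/fine_cvgP; split.
    apply: filterS (H 1 ltr01) => n Hn; rewrite ge0_fin_numE ?L1_ge0//.
    by apply: lt_trans Hn _; rewrite ltry.
  apply/cvgrPdist_lt => delta d0; apply: filterS (H _ d0) => n Hn.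
  rewrite /= sub0r normrN ger0_norm ?fine_ge0 ?L1_ge0//.
  rewrite -lte_fin fineK// ge0_fin_numE ?L1_ge0//.
  by apply: lt_trans Hn _; rewrite ltry.
move=> d0; have d30 : 0 < delta / 3 by rewrite divr_gt0.
have [g [cg gL Hg]] := dense_Cc L0 fi fL d30.
have gC : Cc g by split => //; exists (L + 1).
have gi := integrable_Cc gC.
have mg := continuous_measurable_rV cg.
have fgi : mu.-integrable setT (EFin \o (fun x => f x - g x)) by exact: (integrableB measurableT fi gi).
have [M M0 gM] := Cc_bounded gC.
have C : L1 (box (L + 2)) (fun x => conv g (fun=> k n) x - g x) @[n --> \oo] --> 0%E.
  apply: (@L1_bounded_cvg0 _ _ _ _ (M + M)).
  - by move=> n; apply: measurable_funB => //; exact: mconv.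
  - move=> n x; apply: le_trans (ler_normB _ _) _; rewrite lerD//.
    exact: (conv_J_bound (mk n) x gi gM).
  - move=> x; rewrite -(subrr (g x)); apply: cvgB; last exact: cvg_cst.
    exact: conv_cvg.
have {}C : \forall n \near \oo, (L1 (box (L + 2)) (fun x => (conv g (fun=> k n) x - g x)%R) < (delta / 3)%:E)%E.
  move/fine_cvgP : C => [F /cvgrPdist_lt/(_ _ d30) C].
  near=> n; rewrite -[ltLHS]fineK; last by near: n.
  rewrite lte_fin; apply: le_lt_trans (ler_norm _) _.
  by rewrite -normrN -sub0r; near: n.
apply: filterS C => n C.
have {}C : (L1 setT (fun x => (conv g (fun=> k n) x - g x)%R) < (delta / 3)%:E)%E.
  apply: le_lt_trans C; rewrite {2}/L1 integral_mkcond.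
  rewrite le_eqVlt; apply/orP; left; apply/eqP; apply: eq_integral => x _.
  rewrite patchE; case: ifPn => // /negP nx.
  have nx' : ~ box (L + 2) x by move=> H; apply: nx; rewrite inE.
  rewrite gL ?(conv_box_supp (mk n) gL) ?subrr ?normr0//.
    by move=> H; apply: nx' => i; apply: le_trans (H i) _; have := e1 n; lra.
  by move=> H; apply: nx' => i; apply: le_trans (H i) _; lra.
have E : (fun x => conv f (fun=> k n) x - f x) = (fun x => conv (fun x => f x - g x) (fun=> k n) x +
   ((conv g (fun=> k n) x - g x) + (f x - g x) * (-1))).
  apply/funext => x.
  have -> : conv (fun x => f x - g x) (fun=> k n) x = conv f (fun=> k n) x - conv g (fun=> k n) x.
    rewrite /conv -RintegralB//; last 2 first.
      exact: conv_integrable fi (bumps_J (mk n) (d := d)).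
      exact: conv_integrable gi (bumps_J (mk n) (d := d)).
    by apply: eq_Rintegral => y _; rewrite mulrBl.
  ring.
rewrite E.
apply: le_lt_trans (L1_triangle _ _ _) _ => //.
- exact: mconv.
- apply: measurable_funD; first by apply: measurable_funB => //; exact: mconv.
  by apply: measurable_funM => //; exact: measurable_funB.
have -> : delta = delta / 3 + (delta / 3 + delta / 3) by field.
rewrite EFinD; apply: lteD.
  exact: le_lt_trans (conv_L1_le (mk n) fgi) Hg.
apply: le_lt_trans (L1_triangle _ _ _) _ => //.
- by apply: measurable_funB => //; exact: mconv.
- by apply: measurable_funM => //; exact: measurable_funB.
rewrite EFinD; apply: lteD => //.
apply: le_lt_trans Hg; rewrite -[leRHS]mul1e; apply: L1_mul => //.
- exact: measurable_funB.
- by move=> x; rewrite normrN1.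
Unshelve. all: by end_near. Qed.

End L1_approximation.

(** * Integrals of nonmeasurable functions, thickenings, distance to the boundary *)

Section integral_lemmas.
Local Open Scope ereal_scope.
Context d (T : measurableType d) (R : realType) (mu : {measure set T -> \bar R}).

Import HBNNSimple.

(** The integral of a nonnegative function is a supremum over simple
    functions. A simple function below [f] becomes one below [g] when it is
    set to zero on the exceptional null set, and its integral does not change.
    The comparison is meant for superharmonic functions, which agree only
    almost everywhere with a Borel function. *)
Lemma ge0_ae_le_integral_nonmeasurable (D : set T) (f g : T -> \bar R) :
  (forall x, D x -> 0 <= f x) -> (forall x, D x -> 0 <= g x) ->
  {ae mu, forall x, D x -> f x <= g x} ->
  \int[mu]_(x in D) f x <= \int[mu]_(x in D) g x.
Proof.
move=> f0 g0 [N [mN N0 subN]]; rewrite !ge0_integralE//.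
apply: ge_ereal_sup => _ [h hf <-].
have mNC : measurable (~` N) by exact: measurableC.
pose h2 := proj_nnsfun h mNC.
have -> : sintegral mu h = sintegral mu h2.
  rewrite -!integralT_nnsfun; apply: ge0_ae_eq_integral => //.
  - by apply/measurable_EFinP; exact: measurable_funP.
  - by apply/measurable_EFinP; exact: measurable_funP.
  - by move=> x _; rewrite lee_fin.
  - by move=> x _; rewrite lee_fin.
  exists N; split => //; apply: subsetCl => x /= nx _; congr EFin.
  by rewrite mindicE mem_set// mulr1.
apply: ereal_sup_ubound; exists h2 => // x.
rewrite /h2 /= mindicE; have [xN|xN] := boolP (x \in ~` N); last first.
  rewrite mulr0 patchE; case: ifPn => // xD; apply: g0; exact: set_mem.
rewrite mulr1; apply: le_trans (hf x) _; rewrite !patchE; case: ifPn => // xD.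
move: xN; rewrite inE => xN; apply: contrapT => H; apply: xN; apply: subN => /= /(_ (set_mem xD)).
exact: H.
Qed.

Lemma fatou_le (D : set T) (h : nat -> T -> \bar R) (k : T -> \bar R) (c : nat -> R) (l : R) :
  measurable D -> (forall n, measurable_fun D (h n)) ->
  (forall n x, D x -> 0 <= h n x) ->
  (forall x, D x -> h n x @[n --> \oo] --> k x) ->
  (\forall n \near \oo, \int[mu]_(x in D) h n x <= (c n)%:E) ->
  c n @[n --> \oo] --> l ->
  \int[mu]_(x in D) k x <= l%:E.
Proof.
move=> mD mh h0 hk hc cl.
have -> : \int[mu]_(x in D) k x = \int[mu]_(x in D) limn_einf (h^~ x).
  apply: eq_integral => x /set_mem Dx.
  by have [-> _] := cvg_limn_einf_sup (hk _ Dx).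
apply: (le_trans (fatou mu mD mh h0)); rewrite limn_einf_lim.
apply/lee_addgt0Pr => e e0.
have H : \forall n \near \oo, \int[mu]_(x in D) h n x <= l%:E + e%:E.
  have /cvgrPdist_lt/(_ _ e0) H := cl.
  near=> n; have n1 : \int[mu]_(x in D) h n x <= (c n)%:E by near: n.
  apply: le_trans n1 _; rewrite -EFinD lee_fin -lerBlDl.
  apply: le_trans (ler_norm _) _; rewrite distrC; apply: ltW; near: n; exact: H.
apply: lime_le; first exact: is_cvg_einfs.
apply: nearW => n; case: H => N _ H.
have H2 := H (maxn n N) (leq_maxr _ _).
apply: (le_trans _ H2).
by apply: ereal_inf_lbound; exists (maxn n N) => //=; exact: leq_maxl.
Unshelve. all: by end_near. Qed.

End integral_lemmas.

Section thickening.
Context {R : realType} {d : nat}.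
Implicit Types (K Omega : set 'rV[R]_d) (x y : 'rV[R]_d).

Definition thick (r : R) K : set 'rV[R]_d :=
  [set y | exists2 x, K x & forall i, `|x ord0 i - y ord0 i| <= r].

(** Compactness: each point has a radius that works near it, and finitely many
    points suffice. *)
Lemma thick_sub K Omega : compact K -> open Omega -> K `<=` Omega ->
  exists r, [/\ 0 < r, r <= 1 & thick r K `<=` Omega].
Proof.
move=> cK oO KO.
have /compact_near_coveringP cov := cK.
have := cov R (0 : R)^'+ (fun r x => ball x r `<=` Omega) _.
have H x : K x -> \forall x' \near x & r \near (0 : R)^'+, ball x' r `<=` Omega.
  move=> Kx; have /nbhs_ballP[e /= e0 eO] : nbhs x Omega.
    by apply: open_nbhs_nbhs; split => //; exact: KO.
  have e20 : 0 < e / 2 by rewrite divr_gt0.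
  exists (ball x (e / 2), [set r : R | r < e / 2]) => /=.
    by split; [exact: nbhsx_ballx|exact: nbhs_right_lt].
  move=> [x' r] /= [xx' re] y x'y; apply: eO; rewrite (splitr e).
  exact: ball_triangle xx' (le_ball (ltW re) x'y).
move=> /(_ _ H) => {}H.
have : \forall r \near (0 : R)^'+, [/\ 0 < r, r <= 1 & K `<=` (fun x => ball x r `<=` Omega)].
  near=> r; split; [near: r; exact: nbhs_right_gt|near: r; exact: nbhs_right_le|].
  near: r; exact: H.
move=> /filter_ex[r [r0 r1 KrO]]; exists (r / 2); split.
- by rewrite divr_gt0.
- lra.
move=> y [x Kx xy]; apply: (KrO _ Kx); apply/ball_rVP; split => // i.
by apply: le_lt_trans (xy i) _; lra.
Unshelve. all: by end_near. Qed.

(** The thickening is the image of a product of compact sets under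
    subtraction. *)
Lemma thick_compact K r : compact K -> compact (thick r K).
Proof.
move=> cK.
rewrite (_ : thick r K = (fun p : 'rV[R]_d * 'rV[R]_d => p.1 - p.2) @` (K `*` box r)).
  apply: continuous_compact; last by apply: compact_setX => //; exact: box_compact.
  apply: continuous_subspaceT => p; apply: cvgB; [exact: cvg_fst|exact: cvg_snd].
apply/seteqP; split => [y [x Kx xy]|y [[x z] [/= Kx Bz] <-]].
  exists (x, x - y); last by rewrite /= opprB addrC subrK.
  by split => //= i; rewrite !mxE; exact: xy.
exists x => // i; rewrite !mxE opprB addrC subrK; exact: Bz.
Qed.

Lemma sub_thick K r : 0 <= r -> K `<=` thick r K.
Proof. by move=> r0 x Kx; exists x => // i; rewrite subrr normr0. Qed.

End thickening.

Section distance_to_boundary.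
Context {R : realType} {d : nat} (Omega : set 'rV[R]_d).
Hypothesis oO : open Omega.
Hypothesis bO : boundary Omega !=set0.
Implicit Types (K : set 'rV[R]_d) (x y : 'rV[R]_d).

Lemma enorm_ge0 x : 0 <= enorm x.
Proof. exact: sqrtr_ge0. Qed.

Lemma coord_le_enorm x i : `|x ord0 i| <= enorm x.
Proof.
rewrite -sqrtr_sqr /enorm ler_sqrt ?sumr_ge0// => [|j _]; last exact: sqr_ge0.
by rewrite (bigD1 i)//= lerDl sumr_ge0// => j _; exact: sqr_ge0.
Qed.

Lemma enorm_le x (M : R) : (forall i, `|x ord0 i| <= M) -> enorm x <= Num.sqrt (d%:R * M ^+ 2).
Proof.
move=> xM; rewrite /enorm ler_wsqrtr//.
rewrite (_ : d%:R * M ^+ 2 = \sum_(i < d) M ^+ 2); last first.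
  by rewrite sumr_const card_ord mulr_natl.
apply: ler_sum => i _; rewrite -real_normK ?num_real// ler_pXn2r// nnegrE.
exact: le_trans (normr_ge0 _) (xM i).
Qed.

Lemma enorm_continuous : continuous (@enorm R d).
Proof.
move=> x; rewrite /enorm.
apply: (@cont_comp _ _ (fun x : 'rV[R]_d => \sum_i x ord0 i ^+ 2) Num.sqrt).
  apply: (@cont_sum _ _ _ (fun i (x : 'rV[R]_d) => x ord0 i ^+ 2)) => i.
  have H := @coord_continuous R 1 d ord0 i x.
  exact: (cont_mul H H).
exact: sqrt_continuous.
Qed.

Lemma rho_has_inf x : has_inf [set enorm (x - y) | y in boundary Omega].
Proof.
split; first by case: bO => y By; exists (enorm (x - y)); exists y.
by exists 0 => _ [y _ <-]; exact: enorm_ge0.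
Qed.

Lemma rho_ge0 x : 0 <= rho Omega x.
Proof.
apply: lb_le_inf; first by case: (rho_has_inf x).
by move=> _ [y _ <-]; exact: enorm_ge0.
Qed.

(** Boundary points of an open set lie outside it, hence outside the
    thickening, and the Euclidean norm dominates the sup norm. *)
Lemma rho_lower K r x : thick r K `<=` Omega -> K x -> r <= rho Omega x.
Proof.
move=> KO Kx; apply: lb_le_inf; first by case: (rho_has_inf x).
move=> _ [y [_ nOy] <-]; rewrite leNgt; apply/negP => xyr; apply: nOy.
suff : Omega y by move=> Oy; apply: open_nbhs_nbhs.
apply: KO; exists x => // i; apply: le_trans (ltW xyr).
by have := coord_le_enorm (x - y) i; rewrite !mxE.
Qed.

Lemma rho_upper L : exists M, forall x, box L x -> rho Omega x <= M.
Proof.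
have [y By] := bO.
exists (Num.sqrt (d%:R * (L + `|y|) ^+ 2)) => x Bx.
apply: (@le_trans _ _ (enorm (x - y))).
  by apply: ge_inf; [case: (rho_has_inf x)|exists y].
apply: enorm_le => i; rewrite !mxE; apply: le_trans (ler_normB _ _) _.
by apply: lerD; [exact: Bx|exact: normr_rV_coord].
Qed.

(** An infimum of continuous functions has open sublevel sets. *)
Lemma measurable_rho : measurable_fun setT (rho Omega).
Proof.
apply: (measurability _ (RGenInftyO.measurableE R)) => // _ [_ [a ->] <-].
rewrite setTI; apply: open_measurable_rV.
(* A point is at distance less than [a] from the boundary when it is so from
   some boundary point. *)
rewrite (_ : _ @^-1` _ = \bigcup_(y in boundary Omega) [set x | enorm (x - y) < a]).
  apply: bigcup_open => y _.
  have sub_cont : continuous (fun x : 'rV[R]_d => x - y).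
    apply: continuous_rV_coords => i x.
    rewrite (_ : (fun t : 'rV[R]_d => (t - y) ord0 i) = fun t => t ord0 i + - y ord0 i); last first.
      by apply/funext => t; rewrite !mxE.
    have H := @coord_continuous R 1 d ord0 i x.
    exact: (cont_add H (cont_cst (- y ord0 i) x)).
  have H : continuous (fun x : 'rV[R]_d => enorm (x - y)).
    move=> x; apply: (@continuous_comp _ _ _ (fun x : 'rV[R]_d => x - y) (@enorm R d)).
      exact: sub_cont.
    exact: enorm_continuous.
  rewrite (_ : [set x | _] = (fun x : 'rV[R]_d => enorm (x - y)) @^-1` [set t | t < a])//.
  by apply: open_comp => [x _|]; [exact: H|exact: open_lt].
apply/seteqP; split => [x /=|x [y By /= xy]].
  rewrite in_itv/= => H; have [_ [y By <-] xy] := inf_lt (rho_has_inf x).1 H.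
  by exists y.
rewrite in_itv/=; apply: le_lt_trans xy.
by apply: ge_inf; [case: (rho_has_inf x)|exists y].
Qed.

End distance_to_boundary.

(** * The Hardy inequality for C^1 functions *)

Section bounded_convergence.
Context {R : realType} {d : nat}.
Local Notation mu := (@lebesgue_rV R d).

Lemma Rintegral_bounded_cvg (h : nat -> 'rV[R]_d -> R) (k : 'rV[R]_d -> R) (L M : R) :
  (forall n, measurable_fun setT (h n)) -> (forall n x, `|h n x| <= M) ->
  (forall n x, ~ box L x -> h n x = 0) ->
  (forall x, h n x @[n --> \oo] --> k x) ->
  \int[mu]_x h n x @[n --> \oo] --> \int[mu]_x k x.
Proof.
move=> mh hM hL hk.
have M0 : 0 <= M by apply: le_trans (hM 0%N 0).
have mk : measurable_fun setT k by apply: measurable_fun_cvg mh _ => x _; exact: hk.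
pose g (x : 'rV[R]_d) : R := M * \1_(box L) x.
have gi : mu.-integrable setT (EFin \o g).
  apply: integrable_Bc; split.
  - apply: measurable_funM => //; exact: measurable_indic (measurable_box L).
  - exists M => x; rewrite /g indicE ger0_norm ?mulr_ge0//.
    by case: (_ \in _); rewrite ?mulr1 ?mulr0.
  - by exists L => x nx; rewrite /g indicE memNset// mulr0.
have hg n x : `|h n x| <= g x.
  rewrite /g indicE; have [xL|xL] := pselect (box L x); first by rewrite mem_set// mulr1.
  by rewrite memNset// mulr0 hL// normr0.
have [] := @dominated_convergence _ _ _ mu setT measurableT
   (fun n x => (h n x)%:E) (EFin \o k) (EFin \o g).
- by move=> n; exact/measurable_EFinP.
- exact/measurable_EFinP.
- by apply: aeW => x _; apply: cvg_EFin; [exact: nearW|exact: hk].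
- exact: gi.
- by apply: aeW => x n _; rewrite /= lee_fin.
move=> ki _ H; apply: fine_cvg.
rewrite fineK; first exact: H.
exact: integrable_fin_num ki.
Qed.

End bounded_convergence.

Lemma cvg_sum_fin (R : realType) (I : finType) (u : I -> nat -> R) (l : I -> R) :
  (forall i, u i n @[n --> \oo] --> l i) ->
  \sum_i u i n @[n --> \oo] --> \sum_i l i.
Proof.
move=> H; elim: (index_enum I) => [|i s IH].
  by under eq_fun do rewrite big_nil; rewrite big_nil; exact: cvg_cst.
by under eq_fun do rewrite big_cons; rewrite big_cons; exact: cvgD.
Qed.

Section hardy_extension.
Context {R : realType} {d : nat} (Omega : set 'rV[R]_d) (C0 : R).
Local Notation mu := (@lebesgue_rV R d).
Local Notation e_ i := (delta_mx 0 i).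
Hypothesis oO : open Omega.
Hypothesis bO : boundary Omega !=set0.
Hypothesis C0_gt0 : 0 < C0.
Hypothesis hO : hardy Omega C0.

Lemma compact_supp_sub (K : set 'rV[R]_d) f : compact K -> K `<=` Omega ->
  (forall x, ~ K x -> f x = 0) -> compactly_supported Omega f.
Proof.
move=> cK KO fK.
have S : supp Omega f `<=` K.
  have KE := (closure_id K).1 (compact_closed_rV cK).
  apply: (@subset_trans _ (closure K)); last by rewrite -KE.
  by apply: closureS => x [_ /= /eqP fx]; apply: contrapT => /fK.
split; last exact: subset_trans S KO.
by apply: (subclosed_compact _ cK S); exact: closed_closure.
Qed.

Lemma mollifier_sequence (r : R) : 0 < r -> exists k : nat -> R -> R,
  forall n, mollifier (r / n.+1%:R) (k n).
Proof.
move=> r0; have /choice[k Hk] : forall n : nat, exists k : R -> R, mollifier (r / n.+1%:R) k.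
  by move=> n; apply: mollifier1; rewrite divr_gt0.
by exists k.
Qed.

Lemma cvg_divn (r : R) : r / n.+1%:R @[n --> \oo] --> 0.
Proof.
rewrite -(mulr0 r); apply: cvgM; first exact: cvg_cst.
exact: cvg_harmonic.
Qed.

Lemma conv_thick_supp e k f (K : set 'rV[R]_d) r x : mollifier e k -> e <= r ->
  (forall x, ~ K x -> f x = 0) -> ~ thick r K x -> conv f (fun=> k) x = 0.
Proof.
move=> mk er fK nx; apply: (conv_supp (bumps_J mk (d := d))) => y xy.
apply: fK => Ky; apply: nx; exists y => // i.
by rewrite distrC; apply: le_trans (ltW (xy i)) er.
Qed.

(** Mollify [f]: the gradient of the mollification is the mollification of the
    gradient, so the right sides converge by bounded convergence, and Fatou's
    lemma handles the left sides. *)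
Theorem hardy_C1 (f : 'rV[R]_d -> R) (f' : 'I_d -> 'rV[R]_d -> R) (K : set 'rV[R]_d) :
  compact K -> K `<=` Omega -> (forall x, ~ K x -> f x = 0) -> continuous f ->
  (forall i, continuous (f' i)) -> (forall i x, is_derive x (e_ i) f (f' i x)) ->
  (\int[mu]_(x in Omega) ((f x / rho Omega x) ^+ 2)%:E <=
   (C0 * \int[mu]_x (\sum_i f' i x ^+ 2))%:E)%E.
Proof.
move=> cK KO fK cf cf' df.
have [L KL] := compact_sub_box cK.
have fL x : ~ box L x -> f x = 0 by move=> nx; apply: fK => Kx; apply: nx; exact: KL.
have fC : Cc f by split => //; exists L.
have f'L i x : ~ box L x -> f' i x = 0 by exact: partial_bdd_supp (df i) fL x.
have f'C i : Cc (f' i) by split => //; exists L; exact: f'L.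
have fi := integrable_Cc fC.
have [r [r0 r1 rO]] := thick_sub cK oO KO.
have [k mk] := mollifier_sequence r0.
have er n : r / n.+1%:R <= r.
  by rewrite ler_pdivrMr// ler_peMr ?ler1n// ltW.
have e0 := cvg_divn r.
pose fn n := conv f (fun=> k n).
have fnC n : Cc_infty Omega (fn n).
  split; first by move=> j; exact: (conv_Ck _ _ fi (bumps_J (mk n) (d := d))).
  apply: (compact_supp_sub (@thick_compact _ _ _ r cK) rO) => x nx.
  exact: conv_thick_supp (mk n) (er n) fK nx.
have dfn n i x : is_derive x (e_ i) (fn n) (conv (f' i) (fun=> k n) x).
  have [k' bk' [dk k'N]] := mollifier_derivative (mk n).
  rewrite -(conv_J_partial (mk n) x dk bk' k'N fC (cf' i) (df i)).
  exact: (conv_is_derive x fi (bumps_J (mk n) (d := d)) bk' dk).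
have cconv n i : continuous (conv (f' i) (fun=> k n)).
  exact: conv_continuous (integrable_Cc (f'C i)) (bumps_J (mk n) (d := d)).
have gE n x : grad_norm (fn n) x ^+ 2 = \sum_i conv (f' i) (fun=> k n) x ^+ 2.
  rewrite /grad_norm sqr_sqrtr ?sumr_ge0// => [|i _]; last exact: sqr_ge0.
  by apply: eq_bigr => i _; rewrite /partial; case: (dfn n i x) => _ ->.
have cgn n : continuous (fun x => \sum_i conv (f' i) (fun=> k n) x ^+ 2).
  move=> x; apply: (@cont_sum _ _ _ (fun i x => conv (f' i) (fun=> k n) x ^+ 2)) => i.
  exact: (cont_mul (cconv n i x) (cconv n i x)).
have gnC n : Cc (fun x => \sum_i conv (f' i) (fun=> k n) x ^+ 2).
  split => //; exists (L + r) => x nx; apply: big1 => i _.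
  rewrite (conv_box_supp (mk n) (f'L i)) ?expr0n// => B; apply: nx => j.
  by apply: le_trans (B j) _; rewrite lerD2l.
have mrho := measurable_rho bO.
have mO := open_measurable_rV oO.
(* The supports stay in the thickening of radius [r], so all integrands are
   bounded and supported in one box. *)
apply: (@fatou_le _ _ _ mu _ (fun n x => ((fn n x / rho Omega x) ^+ 2)%:E) _
  (fun n => C0 * \int[mu]_x (\sum_i conv (f' i) (fun=> k n) x ^+ 2))) => //.
- move=> n; apply/measurable_EFinP; apply: measurable_funTS.
  apply: measurable_funX; apply: measurable_funM.
    by apply: continuous_measurable_rV; exact: conv_continuous fi (bumps_J (mk n) (d := d)).
  rewrite (_ : (fun _ => _) = fun x => powR (rho Omega x) (-1)); last first.
    by apply/funext => x; rewrite powR_inv1// rho_ge0.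
  exact: (measurableT_comp (@measurable_powR R (-1)) mrho).
- by move=> n x _; rewrite lee_fin sqr_ge0.
- move=> x _; apply: cvg_EFin; first exact: nearW.
  have H : fn n x / rho Omega x @[n --> \oo] --> f x / rho Omega x.
    apply: cvgM; last exact: cvg_cst.
    exact: (@conv_cvg R d _ k f x mk e0 fi cf).
  exact: (cvgM H H).
- apply: nearW => n; have Hn := hO (fnC n).
  rewrite (eq_integral (fun x => (`|fn n x / rho Omega x| ^+ 2)%:E)); last first.
    by move=> x _; rewrite real_normK ?num_real.
  apply: le_trans Hn _.
  rewrite EFinM lee_pmul2l ?lte_fin//.
  rewrite /Rintegral fineK; last exact: integrable_fin_num (integrable_Cc (gnC n)).
  rewrite [X in (X <= _)%E](eq_integral (fun x => (\sum_i conv (f' i) (fun=> k n) x ^+ 2)%:E)); last first.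
    by move=> x _; rewrite gE.
  apply: ge0_subset_integral => //.
    by apply/measurable_EFinP; exact: continuous_measurable_rV.
  by move=> x _; rewrite lee_fin sumr_ge0// => i _; exact: sqr_ge0.
- apply: cvgM; first exact: cvg_cst.
  have /choice[M HM] : forall i, exists M, forall x, `|f' i x| <= M.
    by move=> i; have [M _ HM] := Cc_bounded (f'C i); exists M.
  apply: (@Rintegral_bounded_cvg _ _ _ _ (L + r) (\sum_i M i ^+ 2)).
  + by move=> n; exact: continuous_measurable_rV.
  + move=> n x; rewrite ger0_norm ?sumr_ge0// => [|i _]; last exact: sqr_ge0.
    apply: ler_sum => i _; rewrite -real_normK ?num_real//.
    rewrite ler_pXn2r ?nnegrE//; last exact: le_trans (HM i 0).
    exact: (conv_J_bound (mk n) x (integrable_Cc (f'C i)) (HM i)).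
  + move=> n x nx; apply: big1 => i _.
    rewrite (conv_box_supp (mk n) (f'L i)) ?expr0n// => B; apply: nx => j.
    by apply: le_trans (B j) _; rewrite lerD2l.
  + move=> x; apply: (@cvg_sum_fin _ _ (fun i n => conv (f' i) (fun=> k n) x ^+ 2)) => i.
    have H := @conv_cvg R d _ k (f' i) x mk e0 (integrable_Cc (f'C i)) (cf' i).
    exact: (cvgM H H).
Qed.

End hardy_extension.

(** * The quadratic form and the truncated powers *)

Section quadratic_form.
Context {R : realType}.

(** A lower bound for the smaller eigenvalue of the form by its determinant
    over its trace. *)
Lemma quadratic_form_lower (a b g z y : R) : 0 < a + g ->
  (a * g - b ^+ 2 / 4) / (a + g) * (z ^+ 2 + y ^+ 2) <=
  a * z ^+ 2 + b * z * y + g * y ^+ 2.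
Proof.
move=> ag; rewrite mulrAC ler_pdivrMr// -subr_ge0.
rewrite (_ : _ - _ = (a * z + b / 2 * y) ^+ 2 + (g * y + b / 2 * z) ^+ 2); last by field.
by rewrite addr_ge0// sqr_ge0.
Qed.

(** With [z = X_i] and [y = Y_i], the bracket is the [i]-th term of the
    quadratic form produced by the two divergence identities once the powers
    [v^m] carry the factor [th^2], and [q = 1 - th]; the terms in [th q] come
    from differentiating [th^2]. The left side is the corresponding square of
    the derivative of [v^(p/2) th^2 psi^(c/2)]. The last term is an error that
    is allowed because it will tend to zero with the truncation level. *)
Definition coercive (p c t M : R) := forall th q z y : R, 0 <= th -> 0 <= q -> th + q = 1 ->
  ((p / 2 * th ^+ 2 + 2 * p * th * q) * z + c / 2 * th ^+ 2 * y) ^+ 2 <=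
  M * (((p - 1) * th ^+ 2 + 2 * p * th * q) * z ^+ 2 + c * th ^+ 2 * z * y
       - t * ((p * th ^+ 2 + 2 * p * th * q) * z * y + (c - 1) * th ^+ 2 * y ^+ 2)
       + p * t ^+ 2 * q * th * y ^+ 2).

(** The terms in [th^2] form the quadratic form with coefficients [p - 1], [c
    - t p], [t (1 - c)]. Its determinant at the chosen [t] is [(p - 1) (1 - c)
    (p - 1 + c) / p^2 > 0]. The terms in [th q] complete to [p th q (z - t
    y)^2 + p th q z^2] with the help of the error term, and the leftover [p th
    q z^2] controls the contribution of [2 p th q z] to the left side. *)
Lemma coercive_exists (p c : R) : 1 < p -> - p + 1 < c -> c < 1 ->
  exists t M, [/\ 0 < t, 0 < M & coercive p c t M].
Proof.
move=> p1 pc c1.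
have p0 : 0 < p by lra.
have p0' : 0 <= p by lra.
(* The maximizer of the determinant [(p-1) t (1-c) - (c - t p)^2 / 4] as a
   function of [t]. *)
pose t := (c * p + 2 * (p - 1) * (1 - c)) / p ^+ 2.
have pc0 : 0 < p - 1 + c by lra.
have pc1 : 0 < (p - 1) * (1 - c) by rewrite mulr_gt0; lra.
have t0 : 0 < t.
  have E : c * p + 2 * (p - 1) * (1 - c) = (p - 1 + c) + (p - 1) * (1 - c) by ring.
  by rewrite /t E divr_gt0 ?exprn_gt0// addr_gt0.
pose a := p - 1; pose g := t * (1 - c); pose b := c - t * p.
have a0 : 0 < a by rewrite /a; lra.
have g0 : 0 < g by rewrite /g mulr_gt0//; lra.
have ag0 : 0 < a + g by rewrite addr_gt0.
pose delta := (a * g - b ^+ 2 / 4) / (a + g).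
have d0 : 0 < delta.
  have E : a * g - b ^+ 2 / 4 = (p - 1) * (1 - c) * (p - 1 + c) / p ^+ 2.
    by rewrite /a /g /b /t; field; rewrite gt_eqF.
  by rewrite /delta E divr_gt0// divr_gt0 ?exprn_gt0// mulr_gt0.
have e0 : 0 <= (p ^+ 2 + c ^+ 2) / delta by rewrite divr_ge0 ?(ltW d0)// addr_ge0 ?sqr_ge0.
(* The first summand takes care of the terms in [th^2], the second one of
   those in [th q]. *)
exists t, ((p ^+ 2 + c ^+ 2) / delta + 8 * p); split => //.
  by rewrite ltr_wpDl// mulr_gt0.
move=> th q z y th0 q0 thq.
have th1 : th <= 1 by lra.
have q1 : q <= 1 by lra.
set F := (X in _ <= _ * X).
have HF : th ^+ 2 * (delta * (z ^+ 2 + y ^+ 2)) + p * th * q * z ^+ 2 <= F.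
  rewrite -subr_ge0.
  have -> : F - (th ^+ 2 * (delta * (z ^+ 2 + y ^+ 2)) + p * th * q * z ^+ 2) =
     th ^+ 2 * (a * z ^+ 2 + b * z * y + g * y ^+ 2 - delta * (z ^+ 2 + y ^+ 2)) +
     p * th * q * (z - t * y) ^+ 2.
    by rewrite /F /a /b /g; ring.
  rewrite addr_ge0// mulr_ge0 ?sqr_ge0//.
    by rewrite subr_ge0; exact: quadratic_form_lower.
  by rewrite !mulr_ge0.
have zy0 : 0 <= z ^+ 2 + y ^+ 2 by rewrite addr_ge0 ?sqr_ge0.
have pq : 0 <= p * th * q * z ^+ 2 by rewrite mulr_ge0 ?sqr_ge0// !mulr_ge0.
have th2 : th ^+ 2 <= 1 by rewrite exprn_ile1.
have tq : th * q <= 1 by rewrite mulr_ile1.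
apply: (@le_trans _ _ ((p ^+ 2 + c ^+ 2) * th ^+ 2 * (z ^+ 2 + y ^+ 2) + 8 * p * (p * th * q * z ^+ 2))).
  (* The inequality [(a + b)^2 <= 2 a^2 + 2 b^2]. *)
  apply: (@le_trans _ _ (2 * (th ^+ 2 * (p * z + c * y) / 2) ^+ 2 + 2 * (2 * p * th * q * z) ^+ 2)).
    rewrite -subr_ge0.
    rewrite (_ : _ - _ = (th ^+ 2 * (p * z + c * y) / 2 - 2 * p * th * q * z) ^+ 2); last by field.
    exact: sqr_ge0.
  apply: lerD.
    apply: (@le_trans _ _ (th ^+ 2 * (th ^+ 2 * ((p ^+ 2 + c ^+ 2) * (z ^+ 2 + y ^+ 2))))).
      rewrite (_ : 2 * _ ^+ 2 = th ^+ 2 * (th ^+ 2 * ((p * z + c * y) ^+ 2 / 2))); last by field.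
      do 2 (apply: ler_wpM2l; first exact: sqr_ge0).
      rewrite ler_pdivrMr// -subr_ge0.
      rewrite (_ : _ - _ = (p * z - c * y) ^+ 2 + 2 * (p * y) ^+ 2 + 2 * (c * z) ^+ 2); last by ring.
      by rewrite !addr_ge0 ?sqr_ge0// mulr_ge0 ?sqr_ge0.
    have -> : (p ^+ 2 + c ^+ 2) * th ^+ 2 * (z ^+ 2 + y ^+ 2) = th ^+ 2 * ((p ^+ 2 + c ^+ 2) * (z ^+ 2 + y ^+ 2)) by ring.
    by rewrite ler_piMl// mulr_ge0 ?sqr_ge0// mulr_ge0// addr_ge0 ?sqr_ge0.
  rewrite (_ : 2 * _ ^+ 2 = 8 * p * (th * q * (p * th * q * z ^+ 2))); last by ring.
  by rewrite ler_wpM2l ?mulr_ge0// ler_piMl.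
apply: le_trans (ler_wpM2l _ HF); last by rewrite addr_ge0// mulr_ge0.
set X := z ^+ 2 + y ^+ 2 in zy0 *; set Y := p * th * q * z ^+ 2 in pq *.
rewrite -subr_ge0.
rewrite (_ : _ - _ = (p ^+ 2 + c ^+ 2) / delta * Y + 8 * p * (th ^+ 2 * (delta * X))); last first.
  by field; rewrite gt_eqF.
have d0' := ltW d0.
apply: addr_ge0; first exact: mulr_ge0.
apply: mulr_ge0; first exact: mulr_ge0.
by apply: mulr_ge0; [exact: sqr_ge0|exact: mulr_ge0].
Qed.

End quadratic_form.

Section truncated_powers.
Context {R : realType}.

(** The square of the positive part: the square makes it [C^1]. *)
Definition possq (s : R) : R := if 0 < s then s ^+ 2 else 0.

Lemma is_derive_possq (s : R) : is_derive s 1 possq (2 * Num.max s 0).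
Proof.
apply: is_derive_quad; exists 1 => h; rewrite mul1r [h *: 1]mulr1 /possq.
have [s0|s0] := leP s 0; have [hs|hs] := ltP 0 (h + s).
- rewrite subr0 mulr0 mulr0 subr0 ger0_norm ?sqr_ge0// ler_pXn2r ?nnegrE//; lra.
- by rewrite mulr0 mulr0 !subr0 normr0 sqr_ge0.
- rewrite (_ : _ - _ = h ^+ 2); last by ring.
  by rewrite ger0_norm ?sqr_ge0.
- rewrite (_ : _ - _ = s * (- (2 * h) - s)); last by ring.
  rewrite ger0_norm; last by apply: mulr_ge0; lra.
  have -> : h ^+ 2 = s * (- (2 * h) - s) + (h + s) ^+ 2 by ring.
  by rewrite lerDl sqr_ge0.
Qed.

Lemma is_derive_powR (a s : R) : 0 < s -> is_derive s 1 (fun x => x `^ a) (a * s `^ (a - 1)).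
Proof.
move=> s0; have s0' : s \in `]0, +oo[%R by rewrite in_itv/= s0.
apply: DeriveDef; first exact: derivable_powR.
by rewrite -derive1E (powR_derive1 a s0').
Qed.

Lemma derive_continuous (f : R -> R) (s df : R) : is_derive s 1 f df -> continuous_at s f.
Proof. by move=> [df1 _]; apply/differentiable_continuous/derivable1_diffP. Qed.

Lemma continuous_powR (a s : R) : 0 < s -> continuous_at s (fun x => x `^ a).
Proof. by move=> s0; exact: derive_continuous (is_derive_powR a s0). Qed.

Section truncation.
Variables (p e : R).
Hypothesis p1 : 1 < p.
Hypothesis e0 : 0 < e.

(** For [s >= e] this is [th = 1 - q] with [q = e^p s^-p], so that [s th' = p
    q]. Every derivative thus stays polynomial in [th] and [q], and [q s^p =
    e^p] makes the error term independent of [s]. *)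
Definition trunc (s : R) : R := 1 - e `^ p * s `^ (- p).

(** The truncated power [s^m th^2], with [th] the positive part of [trunc s];
    it is [C^1] on the line and vanishes for [s <= e]. *)
Definition tpow (m s : R) : R := if 0 < s then s `^ m * possq (trunc s) else 0.

Definition tpow' (m s : R) : R :=
  if 0 < s then m * s `^ (m - 1) * possq (trunc s) +
    s `^ m * (2 * Num.max (trunc s) 0 * (p * e `^ p * s `^ (- p - 1))) else 0.

Lemma trunc_le0 (s : R) : 0 < s -> s <= e -> trunc s <= 0.
Proof.
move=> s0 se; rewrite /trunc subr_le0 powRN ler_pdivlMr ?powR_gt0// mul1r.
by apply: ge0_ler_powR => //; [exact: le_trans ler01 (ltW p1)|exact: ltW|exact: ltW].
Qed.

Lemma tpow_small (m s : R) : s <= e -> tpow m s = 0.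
Proof.
move=> se; rewrite /tpow; case: ifPn => // s0.
by rewrite /possq ltNge trunc_le0// mulr0.
Qed.

Lemma tpow'_small (m s : R) : s <= e -> tpow' m s = 0.
Proof.
move=> se; rewrite /tpow'; case: ifPn => // s0.
by rewrite /possq ltNge trunc_le0//= max_r ?trunc_le0// !(mulr0, mul0r) addr0.
Qed.

Lemma is_derive_trunc (s : R) : 0 < s -> is_derive s 1 trunc (p * e `^ p * s `^ (- p - 1)).
Proof.
move=> s0; apply: is_derive_extT (is_derive_add (is_derive_const 1 s 1)
  (is_derive_scale (- e `^ p) (is_derive_powR (- p) s0))).
  by move=> x; rewrite /trunc mulNr.
ring.
Qed.

Lemma is_derive_tpow m (s : R) : is_derive s 1 (tpow m) (tpow' m s).
Proof.
have [s0|s0] := ltP 0 s; last first.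
  apply: (is_derive_ext _ _ (is_derive_const 0 s 1)).
    near=> x; rewrite tpow_small//; apply: ltW; near: x; apply: lt_nbhsl; exact: le_lt_trans s0 e0.
  by rewrite tpow'_small//; exact: le_trans s0 (ltW e0).
apply: (is_derive_ext _ _ (is_derive_mul (is_derive_powR m s0)
  (is_derive_comp (is_derive_trunc s0) (is_derive_possq (trunc s))))).
  by near=> x; rewrite /tpow ifT//; near: x; exact: lt_nbhsr.
by rewrite /tpow' s0.
Unshelve. all: by end_near. Qed.

Lemma continuous_tpow m : continuous (tpow m).
Proof. by move=> s; exact: derive_continuous (is_derive_tpow m s). Qed.

Lemma continuous_trunc (s : R) : 0 < s -> continuous_at s trunc.
Proof. by move=> s0; exact: derive_continuous (is_derive_trunc s0). Qed.

Lemma continuous_tpow' m : continuous (tpow' m).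
Proof.
move=> s; have [s0|s0] := ltP 0 s; last first.
  apply: (@cont_ext _ _ (cst 0)); last exact: cst_continuous.
  by near=> x; rewrite tpow'_small//; apply: ltW; near: x; apply: lt_nbhsl; exact: le_lt_trans s0 e0.
have ct := continuous_trunc s0.
apply: (@cont_ext _ _ (fun s => m * s `^ (m - 1) * possq (trunc s) +
    s `^ m * (2 * Num.max (trunc s) 0 * (p * e `^ p * s `^ (- p - 1))))).
  by near=> x; rewrite /tpow' ifT//; near: x; exact: lt_nbhsr.
have c1 := cont_comp ct (derive_continuous (is_derive_possq (trunc s))).
have c2 : continuous_at s (fun s => Num.max (trunc s) 0).
  by apply: (@continuous_max _ _ trunc (cst 0)) => //; exact: cst_continuous.
have c3 a := @continuous_powR a s s0.
exact: (cont_add (cont_mul (cont_mul (cont_cst m s) (c3 (m - 1))) c1)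
 (cont_mul (c3 m) (cont_mul (cont_mul (cont_cst 2 s) c2) (cont_mul (cont_cst (p * e `^ p) s) (c3 (- p - 1)))))).
Unshelve. all: by end_near. Qed.

End truncation.
End truncated_powers.

(** * The pointwise energy inequality *)

Section Bc_closure.
Context {R : realType} {d : nat}.
Implicit Types f g : 'rV[R]_d -> R.

(** A continuous function need only be bounded on the box that supports the
    other factor. *)
Lemma BcM_continuous f g : Bc f -> continuous g -> Bc (fun x => f x * g x).
Proof.
move=> [mf [M fM] [L fL]] cg; split.
- by apply: measurable_funM => //; exact: continuous_measurable_rV.
- have : compact (g @` box L).
    apply: continuous_compact; last exact: box_compact.
    exact: continuous_subspaceT.
  move=> /compact_bounded[N [_ HN]]; exists (M * (`|N| + 1)) => x.
  have M0 : 0 <= M by apply: le_trans (fM 0).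
  have [Lx|nLx] := pselect (box L x); last first.
    by rewrite fL// mul0r normr0 mulr_ge0// addr_ge0.
  rewrite normrM; apply: ler_pM => //.
  by apply: (HN (`|N| + 1)); [rewrite ltr_pwDr// ler_norm|exists x].
- by exists L => x nx; rewrite fL// mul0r.
Qed.

Lemma BcZ (k : R) f : Bc f -> Bc (fun x => k * f x).
Proof.
move=> [mf [M fM] [L fL]]; split.
- exact: measurable_funM.
- by exists (`|k| * M) => x; rewrite normrM ler_wpM2l.
- by exists L => x nx; rewrite fL// mulr0.
Qed.

Lemma BcD f g : Bc f -> Bc g -> Bc (fun x => f x + g x).
Proof.
move=> [mf [M fM] sf] [mg [N gN] sg]; split.
- exact: measurable_funD.
- by exists (M + N) => x; apply: le_trans (ler_normD _ _) _; exact: lerD.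
- exact: bdd_suppD.
Qed.

End Bc_closure.

Section cutoff_calculus.
Context {R : realType} {d : nat}.
Local Notation e_ i := (delta_mx 0 i).
Variables (v : 'rV[R]_d -> R) (dv : 'I_d -> 'rV[R]_d -> R) (e : R).
Hypothesis cv : continuous v.
Hypothesis e0 : 0 < e.
Hypothesis dvE : forall i x, 0 < v x -> is_derive x (e_ i) v (dv i x).

Lemma cut_near0 (k : R -> R) (m : 'rV[R]_d -> R) x : (forall s, s <= e -> k s = 0) ->
  v x <= 0 -> \forall y \near x, k (v y) * m y = 0.
Proof.
move=> k0 vx.
have : \forall y \near x, v y < e.
  by have /cvgr_lt/(_ _ (le_lt_trans vx e0)) := cv (x := x).
by apply: filterS => y vy; rewrite k0 ?mul0r// ltW.
Qed.

(** Where [v <= 0], the factor [k (v x)] vanishes in a whole neighbourhood;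
    elsewhere [m] is continuous. *)
Lemma cut_continuous (k : R -> R) (m : 'rV[R]_d -> R) : continuous k ->
  (forall s, s <= e -> k s = 0) -> (forall x, 0 < v x -> continuous_at x m) ->
  continuous (fun x => k (v x) * m x).
Proof.
move=> ck k0 cm x; have [vx|vx] := ltP 0 (v x).
  exact: (cont_mul (cont_comp (cv (x := x)) (ck (v x))) (cm x vx)).
apply: (@cont_ext _ _ (cst 0)); last exact: cst_continuous.
by apply: filterS (cut_near0 m k0 vx) => y ->.
Qed.

(** Same dichotomy as for continuity: near a point where [v <= 0] the product
    is identically zero. *)
Lemma cut_derive (k k' : R -> R) (m m' : 'rV[R]_d -> R) i :
  (forall s : R, is_derive s 1 k (k' s)) ->
  (forall s, s <= e -> k s = 0) -> (forall s, s <= e -> k' s = 0) ->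
  (forall x, 0 < v x -> is_derive x (e_ i) m (m' x)) ->
  forall x, is_derive x (e_ i) (fun x => k (v x) * m x)
    (k' (v x) * (dv i x * m x) + k (v x) * m' x).
Proof.
move=> dk k0 k0' dm x; have [vx|vx] := ltP 0 (v x).
  apply: is_derive_extT (is_derive_mul (is_derive_comp (dvE i vx) (dk (v x))) (dm x vx)) => //.
  by rewrite -mulrA.
have ve : v x <= e := le_trans vx (ltW e0).
apply: (is_derive_ext _ _ (is_derive_const 0 x _)).
  by apply: filterS (cut_near0 m k0 vx) => y ->.
by rewrite k0// k0'// !mul0r addr0.
Qed.

End cutoff_calculus.

Section powR_identities.
Context {R : realType}.

Lemma powRB1 (s a : R) : 0 < s -> s `^ (a - 1) = s `^ a / s.
Proof.
by move=> s0; rewrite powRB ?powRr1 ?(ltW s0)// (gt_eqF s0) implybT.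
Qed.

Lemma powR_half (s a : R) : 0 < s -> s `^ (a / 2) ^+ 2 = s `^ a.
Proof.
move=> s0; rewrite expr2 -powRD ?(gt_eqF s0) ?implybT//.
by congr (_ `^ _); rewrite -splitr.
Qed.

End powR_identities.

Section core_pointwise.
Context {R : realType}.
Variables (p c t M e : R).
Hypothesis p1 : 1 < p.
Hypothesis M0 : 0 < M.
Hypothesis e0 : 0 < e.
Hypothesis form : coercive p c t M.

(** Here [s], [w] stand for [v], [psi], the letters [X], [Y] for their first
    derivatives and [X2], [Y2] for their second derivatives in one direction;
    [chi] is the indicator of a box containing the support of [v]. Second
    derivatives cancel, and after division by [s^p w^c] what remains is the
    inequality [coercive] at [z = X/s], [y = Y/w]. The error is bounded using
    [q s^p = e^p]. *)
Lemma core_pointwise (s w X Y X2 Y2 chi : R) : 0 < w -> 0 <= chi -> (0 < s -> chi = 1) ->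
  (tpow' p e (p / 2) s * (X * w `^ (c / 2)) + tpow p e (p / 2) s * (c / 2 * w `^ (c / 2 - 1) * Y)) ^+ 2 <=
  M * ((tpow' p e (p - 1) s * (X * (w `^ c * X)) +
        tpow p e (p - 1) s * (c * w `^ (c - 1) * Y * X + w `^ c * X2)) -
       t * (tpow' p e p s * (X * (w `^ (c - 1) * Y)) +
        tpow p e p s * ((c - 1) * w `^ (c - 1 - 1) * Y * Y + w `^ (c - 1) * Y2))
       - tpow p e (p - 1) s * w `^ c * X2 + t * (tpow p e p s * w `^ (c - 1) * Y2)
       + p * t ^+ 2 * e `^ p * (chi * (w `^ (c - 1 - 1) * Y ^+ 2))).
Proof.
move=> w0 chi0 chi1.
have p0 : 0 <= p by have := p1; lra.
have wE : w `^ (c - 1 - 1) = w `^ c / w / w by rewrite !powRB1.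
have E0 : 0 <= p * t ^+ 2 * e `^ p * (chi * (w `^ (c - 1 - 1) * Y ^+ 2)).
  apply: mulr_ge0.
    by apply: mulr_ge0; [apply: mulr_ge0 => //; exact: sqr_ge0|exact: powR_ge0].
  by apply: mulr_ge0 => //; apply: mulr_ge0; [exact: powR_ge0|exact: sqr_ge0].
have [s0|s0] := ltP 0 s; last first.
  have se := le_trans s0 (ltW e0).
  rewrite !tpow_small// !tpow'_small// !(mul0r, mulr0, addr0, subr0) expr0n/= add0r.
  by rewrite mulr_ge0// ltW.
(* If [s > 0] but [s <= e], everything but the error vanishes. *)
have [th0|th0] := leP (trunc p e s) 0.
  have tp m : tpow p e m s = 0.
    by rewrite /tpow s0 /possq ltNge th0/= mulr0.
  have tp' m : tpow' p e m s = 0.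
    by rewrite /tpow' s0 /possq ltNge th0/= max_r// !(mulr0, mul0r) addr0.
  rewrite !tp !tp' !(mul0r, mulr0, addr0, subr0) expr0n/= add0r.
  by rewrite mulr_ge0// ltW.
rewrite chi1// mul1r.
set th := trunc p e s in th0.
pose q := e `^ p * s `^ (- p).
have thq : th + q = 1 by rewrite /th /trunc /q subrK.
have q0 : 0 <= q by rewrite /q mulr_ge0 ?powR_ge0.
pose S := s `^ p; pose W := w `^ c; pose G := s `^ (p / 2); pose H := w `^ (c / 2).
have S0 : 0 < S by exact: powR_gt0.
have W0 : 0 < W by exact: powR_gt0.
have GS : G ^+ 2 = S by exact: powR_half.
have HW : H ^+ 2 = W by exact: powR_half.
have qS : e `^ p = q * S.
  by rewrite /q /S powRN divfK// gt_eqF.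
have sN : s `^ (- p - 1) = (S * s)^-1.
  by rewrite powRB1// powRN -/S invfM.
have tE m : tpow p e m s = s `^ m * th ^+ 2 by rewrite /tpow s0 /possq -/th th0.
have tE' m : tpow' p e m s = s `^ m / s * (m * th ^+ 2 + 2 * p * th * q).
  rewrite /tpow' s0 /possq -/th th0 max_l ?(ltW th0)// powRB1// sN qS.
  by field; rewrite !gt_eqF.
have := form (X / s) (Y / w) (ltW th0) q0 thq.
set A := (X in X ^+ 2 <= _); set B := (X in _ <= _ * X) => AB.
rewrite !tE !tE' wE !powRB1// -/S -/W -/G -/H.
rewrite (_ : (G / s * (p / 2 * th ^+ 2 + 2 * p * th * q) * (X * H) + G * th ^+ 2 * (c / 2 * (H / w) * Y)) ^+ 2
    = S * W * A ^+ 2); last first.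
  rewrite -GS -HW /A; field; rewrite !gt_eqF//.
apply: (@le_trans _ _ (S * W * (M * B))).
  by rewrite ler_wpM2l// mulr_ge0// ltW.
rewrite mulrCA ler_wpM2l ?(ltW M0)//.
rewrite -subr_ge0.
(* The error required by [coercive] carries an extra factor [th <= 1]. *)
rewrite (_ : _ - _ = p * t ^+ 2 * S * (q * (1 - th)) * W * (Y / w) ^+ 2); last first.
  rewrite /B qS; field; rewrite !gt_eqF//.
have th1 : 0 <= 1 - th by rewrite -thq addrAC subrr add0r.
apply: mulr_ge0; last exact: sqr_ge0.
apply: mulr_ge0; last exact: ltW.
apply: mulr_ge0; last exact: mulr_ge0.
by apply: mulr_ge0; [apply: mulr_ge0 => //; exact: sqr_ge0|exact: ltW].
Qed.

End core_pointwise.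

(** * The estimate for smooth superharmonic weights *)

Section young.
Context {R : realType}.

(** Either [a <= delta b], and the first term wins, or [b < a / delta], and
    the second does; no optimal constant is needed. *)
Lemma young_split (p delta a b : R) : 1 < p -> 0 < delta -> 0 <= a -> 0 <= b ->
  a * b `^ (p - 1) <= delta * b `^ p + delta `^ (1 - p) * a `^ p.
Proof.
move=> p1 d0 a0 b0; have p0 : 0 < p by lra.
have [ab|ab] := leP a (delta * b).
  apply: (@le_trans _ _ (delta * b `^ p)); last by rewrite lerDl mulr_ge0 ?powR_ge0.
  by rewrite -(mulr_powRB1 b0 p0) mulrA ler_wpM2r ?powR_ge0.
apply: (@le_trans _ _ (delta `^ (1 - p) * a `^ p)); last first.
  by rewrite lerDr mulr_ge0 ?powR_ge0// ltW.
have ba : b <= a / delta by rewrite ler_pdivlMr// mulrC ltW.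
rewrite -(mulr_powRB1 a0 p0) mulrCA ler_wpM2l//.
apply: (@le_trans _ _ ((a / delta) `^ (p - 1))).
  by apply: ge0_ler_powR; rewrite ?nnegrE ?divr_ge0 ?(ltW d0)//; lra.
rewrite powRM ?invr_ge0 ?(ltW d0)// mulrC -(powR_inv1 (ltW d0)) -powRrM.
by rewrite (_ : -1 * (p - 1) = 1 - p)//; ring.
Qed.

(** Young's inequality for [g r^(2(p-1)/p)] and [v r^(-2/p)], whose powers
    have been distributed so that the product [g v^(p-1)] carries no weight. *)
Lemma young_weight (p delta v g r w : R) : 1 < p -> 0 < delta -> 0 <= v -> 0 <= g ->
  0 < r -> 0 <= w ->
  v `^ (p - 1) * g * w <= delta * (v `^ p * w * r `^ (- 2))
    + delta `^ (1 - p) * (g `^ p * w * r `^ (2 * p - 2)).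
Proof.
move=> p1 d0 v0 g0 r0 w0; have p0 : p != 0 by rewrite gt_eqF//; lra.
have rn : r != 0 by rewrite gt_eqF.
pose a := g * r `^ (2 * (p - 1) / p); pose b := v * r `^ (- (2 / p)).
have a0 : 0 <= a by rewrite mulr_ge0 ?powR_ge0.
have b0 : 0 <= b by rewrite mulr_ge0 ?powR_ge0.
have := young_split p1 d0 a0 b0.
have -> : a * b `^ (p - 1) = v `^ (p - 1) * g.
  rewrite /a /b powRM ?powR_ge0// -powRrM mulrACA -powRD ?rn ?implybT//.
  rewrite (_ : 2 * (p - 1) / p + - (2 / p) * (p - 1) = 0); last by field.
  by rewrite powRr0 mulr1 mulrC.
have -> : b `^ p = v `^ p * r `^ (- 2).
  by rewrite /b powRM ?powR_ge0// -powRrM (_ : - (2 / p) * p = - 2)//; field.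
have -> : a `^ p = g `^ p * r `^ (2 * p - 2).
  by rewrite /a powRM ?powR_ge0// -powRrM (_ : 2 * (p - 1) / p * p = 2 * p - 2)//; field.
move=> H; apply: le_trans (ler_wpM2r w0 H) _.
by rewrite le_eqVlt; apply/orP; left; apply/eqP; ring.
Qed.

End young.

Lemma half_absorb (R : realType) (a b : R) : a <= 2^-1 * a + b -> a <= 2 * b.
Proof. lra. Qed.

Section energy.
Context {R : realType} {d : nat}.
Local Notation mu := (@lebesgue_rV R d).
Local Notation e_ i := (delta_mx 0 i).
Variables (p c t M : R).
Hypothesis p1 : 1 < p.
Hypothesis t0 : 0 < t.
Hypothesis M0 : 0 < M.
Hypothesis form : coercive p c t M.
Variable K : set 'rV[R]_d.
Hypothesis cK : compact K.
Variables (v : 'rV[R]_d -> R) (dv ddv : 'I_d -> 'rV[R]_d -> R).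
Hypothesis cv : continuous v.
Hypothesis v0 : forall x, 0 <= v x.
Hypothesis vK : forall x, ~ K x -> v x = 0.
Hypothesis dvE : forall i x, 0 < v x -> is_derive x (e_ i) v (dv i x).
Hypothesis ddvE : forall i x, 0 < v x -> is_derive x (e_ i) (dv i) (ddv i x).
Hypothesis cdv : forall i x, 0 < v x -> continuous_at x (dv i).
Hypothesis cddv : forall i x, 0 < v x -> continuous_at x (ddv i).
Variables (psi : 'rV[R]_d -> R) (dpsi ddpsi : 'I_d -> 'rV[R]_d -> R).
Hypothesis psi0 : forall x, 0 < psi x.
Hypothesis cpsi : continuous psi.
Hypothesis dpsiE : forall i x, is_derive x (e_ i) psi (dpsi i x).
Hypothesis ddpsiE : forall i x, is_derive x (e_ i) (dpsi i) (ddpsi i x).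
Hypothesis cdpsi : forall i, continuous (dpsi i).
Hypothesis cddpsi : forall i, continuous (ddpsi i).
Hypothesis psi_super : forall x, K x -> \sum_i ddpsi i x <= 0.
Variable g : 'rV[R]_d -> R.
Hypothesis mg : measurable_fun setT g.
Hypothesis g0 : forall x, 0 <= g x.
Hypothesis gB : exists B : R, forall x, `|g x| <= B.
Hypothesis gv : forall x, 0 < v x -> - \sum_i ddv i x <= g x.

Local Notation psiX a := (fun x => psi x `^ a).

Lemma continuous_psiX (a : R) : continuous (psiX a).
Proof. by move=> x; exact: (cont_comp (cpsi (x := x)) (@continuous_powR R a _ (psi0 x))). Qed.

Lemma is_derive_psiX (a : R) i x :
  is_derive x (e_ i) (psiX a) (a * psi x `^ (a - 1) * dpsi i x).
Proof. exact: (is_derive_comp (dpsiE i x) (is_derive_powR a (psi0 x))). Qed.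

Lemma v_Cc : Cc v.
Proof.
split => //; have [L KL] := compact_sub_box cK; exists L => x nL.
by apply: vK => /KL.
Qed.

(** Dominates [- v^(p-1) psi^c Delta v], the right side of the first
    divergence identity. *)
Definition source x := v x `^ (p - 1) * g x * psi x `^ c.

Lemma source_Bc : Bc source.
Proof.
have [B gB'] := gB; have [N N0 vN] := Cc_bounded v_Cc.
apply: BcM_continuous; last exact: continuous_psiX.
split.
- apply: measurable_funM => //.
  exact: (measurableT_comp (@measurable_powR R (p - 1)) (continuous_measurable_rV cv)).
- exists (N `^ (p - 1) * B) => x; rewrite normrM; apply: ler_pM => //.
  rewrite ger0_norm ?powR_ge0//; apply: ge0_ler_powR; rewrite ?nnegrE ?(ltW N0)//.
    by have := p1; lra.
  by apply: le_trans (ler_norm _) _.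
- have [_ [L vL]] := v_Cc; exists L => x nL.
  by rewrite vL// powR0 ?mul0r//; have := p1; move=> ?; rewrite subr_eq0 gt_eqF.
Qed.

Lemma source_ge0 x : 0 <= source x.
Proof. by rewrite /source !mulr_ge0 ?powR_ge0. Qed.

Section fixed_truncation.
Variable e : R.
Hypothesis e0 : 0 < e.

Let cut_c := fun k m ck k0 => @cut_continuous R d v e cv e0 k m ck k0.
Let tpow_k0 m : forall s : R, s <= e -> tpow p e m s = 0.
Proof. by move=> s; exact: tpow_small. Qed.
Let tpow'_k0 m : forall s : R, s <= e -> tpow' p e m s = 0.
Proof. by move=> s; exact: tpow'_small. Qed.
Let tpow_c m := @continuous_tpow R p e p1 e0 m.
Let tpow'_c m := @continuous_tpow' R p e p1 e0 m.
Let tpow_d m := @is_derive_tpow R p e p1 e0 m.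

(** The test function for the Hardy inequality, [v^(p/2) psi^(c/2)] truncated.
    *)
Definition testf x := tpow p e (p / 2) (v x) * psi x `^ (c / 2).

Definition testf' i x := tpow' p e (p / 2) (v x) * (dv i x * psi x `^ (c / 2)) +
  tpow p e (p / 2) (v x) * (c / 2 * psi x `^ (c / 2 - 1) * dpsi i x).

(** The truncated field [v^(p-1) psi^c grad v], component by component;
    [flux_v'] is its divergence before summation. *)
Definition flux_v i x := tpow p e (p - 1) (v x) * (psi x `^ c * dv i x).
Definition flux_v' i x := tpow' p e (p - 1) (v x) * (dv i x * (psi x `^ c * dv i x)) +
  tpow p e (p - 1) (v x) * (c * psi x `^ (c - 1) * dpsi i x * dv i x + psi x `^ c * ddv i x).

(** The truncated field [v^p psi^(c-1) grad psi]. *)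
Definition flux_psi i x := tpow p e p (v x) * (psi x `^ (c - 1) * dpsi i x).
Definition flux_psi' i x := tpow' p e p (v x) * (dv i x * (psi x `^ (c - 1) * dpsi i x)) +
  tpow p e p (v x) * ((c - 1) * psi x `^ (c - 1 - 1) * dpsi i x * dpsi i x + psi x `^ (c - 1) * ddpsi i x).

Lemma testf_derive i x : is_derive x (e_ i) testf (testf' i x).
Proof.
exact: (@cut_derive R d v dv e cv e0 dvE _ _ (psiX (c / 2)) _ i (tpow_d (p / 2)) (@tpow_k0 _) (@tpow'_k0 _)
  (fun y _ => is_derive_psiX (c / 2) i y)).
Qed.

Lemma testf_continuous : continuous testf.
Proof.
apply: cut_c; [exact: tpow_c|exact: tpow_k0|].
by move=> x _; exact: continuous_psiX.
Qed.

Lemma continuousD_fun (f h : 'rV[R]_d -> R) : continuous f -> continuous h ->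
  continuous (fun x => f x + h x).
Proof. by move=> cf ch x; exact: (cont_add (cf x) (ch x)). Qed.

Lemma testf'_continuous i : continuous (testf' i).
Proof.
apply: continuousD_fun; (apply: cut_c; [first [exact: tpow_c|exact: tpow'_c]|first [exact: tpow_k0|exact: tpow'_k0]|]).
- move=> x vx; exact: (cont_mul (@cdv i x vx) (@continuous_psiX _ x)).
- move=> x _; exact: (cont_mul (cont_mul (cont_cst (c / 2) x) (@continuous_psiX _ x)) (@cdpsi i x)).
Qed.

Lemma flux_v_derive i x : is_derive x (e_ i) (flux_v i) (flux_v' i x).
Proof.
exact: (@cut_derive R d v dv e cv e0 dvE _ _ (fun x => psi x `^ c * dv i x) _ i (tpow_d (p - 1)) (@tpow_k0 _) (@tpow'_k0 _)
  (fun y vy => is_derive_mul (is_derive_psiX c i y) (ddvE i vy))).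
Qed.

Lemma flux_psi_derive i x : is_derive x (e_ i) (flux_psi i) (flux_psi' i x).
Proof.
exact: (@cut_derive R d v dv e cv e0 dvE _ _ (fun x => psi x `^ (c - 1) * dpsi i x) _ i (tpow_d p) (@tpow_k0 _) (@tpow'_k0 _)
  (fun y vy => is_derive_mul (is_derive_psiX (c - 1) i y) (ddpsiE i y))).
Qed.

Lemma flux_v'_continuous i : continuous (flux_v' i).
Proof.
apply: continuousD_fun; (apply: cut_c; [first [exact: tpow_c|exact: tpow'_c]|first [exact: tpow_k0|exact: tpow'_k0]|]).
- move=> x vx; exact: (cont_mul (@cdv i x vx) (cont_mul (@continuous_psiX _ x) (@cdv i x vx))).
- move=> x vx; exact: (cont_add (cont_mul (cont_mul (cont_mul (cont_cst c x) (@continuous_psiX _ x)) (@cdpsi i x)) (@cdv i x vx))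
    (cont_mul (@continuous_psiX _ x) (@cddv i x vx))).
Qed.

Lemma flux_psi'_continuous i : continuous (flux_psi' i).
Proof.
apply: continuousD_fun; (apply: cut_c; [first [exact: tpow_c|exact: tpow'_c]|first [exact: tpow_k0|exact: tpow'_k0]|]).
- move=> x vx; exact: (cont_mul (@cdv i x vx) (cont_mul (@continuous_psiX _ x) (@cdpsi i x))).
- move=> x vx; exact: (cont_add (cont_mul (cont_mul (cont_mul (cont_cst (c - 1) x) (@continuous_psiX _ x)) (@cdpsi i x)) (@cdpsi i x))
    (cont_mul (@continuous_psiX _ x) (@cddpsi i x))).
Qed.

Lemma cut_supp (k : R -> R) (m : 'rV[R]_d -> R) : (forall s, s <= e -> k s = 0) ->
  bdd_supp (fun x => k (v x) * m x).
Proof.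
move=> k0; have [_ [L vL]] := v_Cc; exists L => x nL.
by rewrite vL// k0 ?mul0r// ltW.
Qed.

Lemma flux_v'_Cc i : Cc (flux_v' i).
Proof.
split; first exact: flux_v'_continuous.
by apply: bdd_suppD; apply: cut_supp; first [exact: tpow_k0|exact: tpow'_k0].
Qed.

Lemma flux_psi'_Cc i : Cc (flux_psi' i).
Proof.
split; first exact: flux_psi'_continuous.
by apply: bdd_suppD; apply: cut_supp; first [exact: tpow_k0|exact: tpow'_k0].
Qed.

Lemma flux_v'_int i : \int[mu]_x flux_v' i x = 0.
Proof.
rewrite /Rintegral (integral_partial_eq0 (flux_v_derive i))//.
  exact: flux_v'_continuous.
by apply: cut_supp; exact: tpow_k0.
Qed.

Lemma flux_psi'_int i : \int[mu]_x flux_psi' i x = 0.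
Proof.
rewrite /Rintegral (integral_partial_eq0 (flux_psi_derive i))//.
  exact: flux_psi'_continuous.
by apply: cut_supp; exact: tpow_k0.
Qed.

End fixed_truncation.

Definition errL : R := sval (cid (compact_sub_box cK)).
Definition err x := \1_(box errL) x * \sum_i (psi x `^ (c - 1 - 1) * dpsi i x ^+ 2).

Lemma err_Bc : Bc err.
Proof.
apply: BcM_continuous.
  split.
  - exact: measurable_indic (measurable_box _).
  - by exists 1 => x; rewrite indicE; case: (_ \in _); rewrite ?normr1 ?normr0.
  - by exists errL => x nx; rewrite indicE memNset.
move=> x; apply: (@cont_sum _ _ _ (fun i x => psi x `^ (c - 1 - 1) * dpsi i x ^+ 2)) => i.
exact: (cont_mul (@continuous_psiX _ x) (cont_mul (@cdpsi i x) (@cdpsi i x))).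
Qed.

(** Sum [core_pointwise] over the directions and integrate. The divergences
    integrate to zero, [- Delta v] is bounded by [g], and [Delta psi <= 0] on
    the support of [v]. *)
Lemma energy_estimate e : 0 < e ->
  \int[mu]_x (\sum_i testf' e i x ^+ 2) <=
  M * (\int[mu]_x source x + p * t ^+ 2 * e `^ p * \int[mu]_x err x).
Proof.
move=> e0.
pose D x := \sum_i (flux_v' e i x - t * flux_psi' e i x).
(* [D] is the divergence of [flux_v - t flux_psi]. *)
have DC : Cc D.
  by apply: Cc_sum => i; apply: CcB; [exact: flux_v'_Cc|apply: CcZ; exact: flux_psi'_Cc].
have D_int : \int[mu]_x D x = 0.
  rewrite /Rintegral (eq_integral (fun x => \sum_i (flux_v' e i x - t * flux_psi' e i x)%:E)%E); last first.
    by move=> x _; rewrite sumEFin.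
  have I1 i : mu.-integrable setT (EFin \o flux_v' e i) := integrable_Cc (flux_v'_Cc e0 i).
  have I2 i : mu.-integrable setT (EFin \o flux_psi' e i) := integrable_Cc (flux_psi'_Cc e0 i).
  have I2' i : mu.-integrable setT (EFin \o (fun x => t * flux_psi' e i x)).
    exact: integrable_Cc (CcZ t (flux_psi'_Cc e0 i)).
  rewrite integral_sum//; last first.
    by move=> i; exact: (integrableB measurableT (I1 i) (I2' i)).
  rewrite big1// => i _.
  have H : \int[mu]_x (flux_v' e i x - t * flux_psi' e i x) = 0.
    by rewrite RintegralB// RintegralZl// flux_v'_int// flux_psi'_int// mulr0 subr0.
  rewrite -[LHS]fineK ?[fine _]H//.
  exact: (integrable_fin_num measurableT (integrableB measurableT (I1 i) (I2' i))).
have Di := integrable_Cc DC.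
have Si := integrable_Bc source_Bc.
have Ei := integrable_Bc err_Bc.
pose k := p * t ^+ 2 * e `^ p.
have kEi : mu.-integrable setT (EFin \o (fun x => k * err x)).
  exact: integrable_Bc (BcZ k err_Bc).
have SEi : mu.-integrable setT (EFin \o (fun x => source x + k * err x)).
  exact: integrable_Bc (BcD source_Bc (BcZ k err_Bc)).
have DSEi : mu.-integrable setT (EFin \o (fun x => D x + (source x + k * err x))).
  exact: integrable_Bc (BcD (Cc_Bc DC) (BcD source_Bc (BcZ k err_Bc))).
have -> : \int[mu]_x source x + p * t ^+ 2 * e `^ p * \int[mu]_x err x =
    \int[mu]_x (D x + (source x + k * err x)).
  by rewrite RintegralD// D_int add0r RintegralD// RintegralZl.
rewrite -RintegralZl//.
apply: le_Rintegral => //.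
- apply: integrable_Cc; split.
    move=> x; apply: (@cont_sum _ _ _ (fun i x => testf' e i x ^+ 2)) => i.
    exact: (cont_mul (@testf'_continuous _ e0 i x) (@testf'_continuous _ e0 i x)).
  have [_ [L vL]] := v_Cc; exists L => x nx; apply: big1 => i _.
  rewrite /testf' vL// tpow_small ?tpow'_small ?(ltW e0)//.
  by rewrite !mul0r addr0 expr0n.
- exact: (integrableZl measurableT M DSEi).
move=> x _.
have chi1 : 0 < v x -> \1_(box errL) x = 1 :> R.
  move=> vx; rewrite indicE mem_set//; rewrite /errL; case: (cid _) => L /= KL.
  by apply: KL; apply: contrapT => /vK vx0; move: vx; rewrite vx0 ltxx.
have chi0 : 0 <= \1_(box errL) x :> R by rewrite indicE.
set a := tpow p e (p - 1) (v x) * psi x `^ c.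
set b := t * (tpow p e p (v x) * psi x `^ (c - 1)).
have Hi i : testf' e i x ^+ 2 <= M * (flux_v' e i x - t * flux_psi' e i x - a * ddv i x + b * ddpsi i x
    + k * (\1_(box errL) x * (psi x `^ (c - 1 - 1) * dpsi i x ^+ 2))).
  apply: le_trans (core_pointwise p1 M0 e0 form (dv i x) (dpsi i x) (ddv i x) (ddpsi i x) (psi0 x) chi0 chi1) _.
  rewrite ler_wpM2l ?(ltW M0)// le_eqVlt; apply/orP; left; apply/eqP.
  by rewrite /a /b /k /flux_v' /flux_psi'; ring.
apply: le_trans (ler_sum _ (fun i _ => Hi i)) _.
rewrite -mulr_sumr ler_wpM2l ?(ltW M0)//.
have -> : \sum_i (flux_v' e i x - t * flux_psi' e i x - a * ddv i x + b * ddpsi i x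
    + k * (\1_(box errL) x * (psi x `^ (c - 1 - 1) * dpsi i x ^+ 2))) =
  D x + a * (- \sum_i ddv i x) + b * \sum_i ddpsi i x + k * err x.
  rewrite /D /err mulrN !mulr_sumr -sumrN -!big_split/=.
  by apply: eq_bigr => i _; ring.
rewrite -2!addrA lerD2l addrA lerD2r.
have b0 : b * \sum_i ddpsi i x <= 0.
  have [vx|vx] := ltP 0 (v x); last first.
    by rewrite /b tpow_small ?(le_trans vx (ltW e0))// !(mul0r, mulr0).
  apply: mulr_ge0_le0.
    rewrite /b /tpow vx; apply: mulr_ge0; first exact: ltW.
    apply: mulr_ge0; last exact: powR_ge0.
    apply: mulr_ge0; first exact: powR_ge0.
    by rewrite /possq; case: ifP => // _; exact: sqr_ge0.
  by apply: psi_super; apply: contrapT => /vK vx0; move: vx; rewrite vx0 ltxx.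
rewrite -[leRHS]addr0; apply: lerD => //.
have [vx|vx] := ltP 0 (v x); last first.
  rewrite /a tpow_small ?(le_trans vx (ltW e0))// !mul0r; exact: source_ge0.
have a0 : 0 <= a.
  rewrite /a /tpow vx; apply: mulr_ge0; last exact: powR_ge0.
  apply: mulr_ge0; first exact: powR_ge0.
  by rewrite /possq; case: ifP => // _; exact: sqr_ge0.
apply: le_trans (ler_wpM2l a0 (gv vx)) _.
rewrite /source /a mulrAC ler_wpM2r ?powR_ge0// ler_wpM2r//.
rewrite /tpow vx ler_piMr ?powR_ge0// /possq; case: ifP => // th0.
apply: exprn_ile1; first exact: ltW.
by rewrite /trunc gerBl mulr_ge0 ?powR_ge0.
Qed.

Variables (Omega : set 'rV[R]_d) (C0 : R).
Hypothesis oO : open Omega.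
Hypothesis bO : boundary Omega !=set0.
Hypothesis C0_gt0 : 0 < C0.
Hypothesis hO : hardy Omega C0.
Hypothesis KO : K `<=` Omega.

Let rho0 x : 0 <= rho Omega x.
Proof. exact: rho_ge0. Qed.

Lemma cvg_powR0 : (n.+1%:R^-1 : R) `^ p @[n --> \oo] --> (0 : R).
Proof.
apply: (@squeeze_cvgr _ _ _ _ (cst 0) (fun n : nat => n.+1%:R^-1)).
- apply: nearW => n; rewrite powR_ge0/=; apply: ge1r_powR.
    by rewrite invr_gt0 ltr0n/= invf_le1 ?ltr0n// ler1n.
  exact: ltW.
- exact: cvg_cst.
- exact: cvg_harmonic.
Qed.

Lemma testf_cvg x : testf n.+1%:R^-1 x @[n --> \oo] --> v x `^ (p / 2) * psi x `^ (c / 2).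
Proof.
apply: cvgM; last exact: cvg_cst.
have := v0 x; rewrite le_eqVlt => /predU1P[<-|vx].
  rewrite powR0; last by rewrite gt_eqF// divr_gt0//; have := p1; lra.
  by apply: cvg_near_cst; apply: nearW => n; rewrite /tpow ltxx.
rewrite /tpow vx -[X in _ --> X]mulr1; apply: cvgM; first exact: cvg_cst.
have E1 : possq 1 = 1 :> R by rewrite /possq ltr01 expr1n.
have Ht : trunc p n.+1%:R^-1 (v x) @[n --> \oo] --> (1 : R).
  rewrite /trunc -[X in _ --> X]subr0; apply: cvgB; first exact: cvg_cst.
  rewrite -[X in _ --> X](mul0r (v x `^ (- p))); apply: cvgM; last exact: cvg_cst.
  exact: cvg_powR0.
have Hp : possq (trunc p n.+1%:R^-1 (v x)) @[n --> \oo] --> possq (1 : R).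
  apply: (@cvg_comp _ _ _ (fun n : nat => trunc p n.+1%:R^-1 (v x)) (@possq R) _ _ _ Ht).
  exact: derive_continuous (is_derive_possq 1).
by rewrite E1 in Hp.
Qed.

Lemma rho_pow_sq (a r : R) : 0 <= r -> (a / r) ^+ 2 = a ^+ 2 * r `^ (- 2).
Proof. by move=> r0; rewrite expr_div_n powR_invn. Qed.

(** Apply the Hardy inequality to the truncated test functions with [e =
    1/(n+1)] and let [n] grow: the error is of order [e^p], and Fatou's lemma
    applies on the left. *)
Theorem weighted_hardy :
  (\int[mu]_(x in Omega) (v x `^ p * psi x `^ c * rho Omega x `^ (- 2))%:E <=
   (C0 * M * \int[mu]_x source x)%:E)%E.
Proof.
have mrho := measurable_rho bO.
have mO := open_measurable_rV oO.
pose e (n : nat) : R := n.+1%:R^-1.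
have e0 n : 0 < e n by rewrite invr_gt0.
have ct n := testf_continuous (e0 n).
have ct' n := testf'_continuous (e0 n).
have dt n := testf_derive (e0 n).
have tK n x : ~ K x -> testf (e n) x = 0.
  by move=> nx; rewrite /testf vK// /tpow ltxx mul0r.
have En n := energy_estimate (e0 n).
apply: (@fatou_le _ _ _ mu Omega (fun n x => ((testf (e n) x / rho Omega x) ^+ 2)%:E) _
  (fun n => C0 * (M * (\int[mu]_x source x + p * t ^+ 2 * e n `^ p * \int[mu]_x err x)))) => //.
- move=> n; apply/measurable_EFinP; apply: measurable_funTS.
  apply: measurable_funX; apply: measurable_funM; first exact: continuous_measurable_rV.
  rewrite (_ : (fun _ => _) = fun x => powR (rho Omega x) (-1)); last first.
    by apply/funext => x; rewrite powR_inv1// rho_ge0.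
  exact: (measurableT_comp (@measurable_powR R (-1)) mrho).
- by move=> n x _; rewrite lee_fin sqr_ge0.
- move=> x _; apply: cvg_EFin; first exact: nearW.
  have -> : v x `^ p * psi x `^ c * rho Omega x `^ (- 2) =
    (v x `^ (p / 2) * psi x `^ (c / 2) / rho Omega x) ^+ 2.
    have Hc : psi x `^ (c / 2) ^+ 2 = psi x `^ c by exact: powR_half.
    rewrite rho_pow_sq// exprMn Hc; congr (_ * _ * _).
    have := v0 x; rewrite le_eqVlt => /predU1P[<-|vx]; last by rewrite powR_half.
    have p0 : 0 < p by have := p1; lra.
    by rewrite !powR0 ?expr0n// gt_eqF// divr_gt0.
  have H : testf (e n) x / rho Omega x @[n --> \oo] -->
     v x `^ (p / 2) * psi x `^ (c / 2) / rho Omega x.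
    by apply: cvgM; [exact: testf_cvg|exact: cvg_cst].
  exact: (cvgM H H).
- apply: nearW => n; apply: le_trans (hardy_C1 oO bO C0_gt0 hO cK KO (tK n) (ct n) (ct' n) (dt n)) _.
  by rewrite lee_fin ler_wpM2l// ltW.
- rewrite -mulrA; apply: cvgM; first exact: cvg_cst.
  apply: cvgM; first exact: cvg_cst.
  rewrite -[X in _ --> X]addr0; apply: cvgD; first exact: cvg_cst.
  rewrite -[X in _ --> X](mul0r (\int[mu]_x err x)); apply: cvgM; last exact: cvg_cst.
  rewrite -[X in _ --> X](mulr0 (p * t ^+ 2)); apply: cvgM; first exact: cvg_cst.
  exact: cvg_powR0.
Qed.

(** Young's inequality with [delta = 1 / (2 C0 M)] bounds the right side of
    [weighted_hardy] by half of its left side plus the claimed term. The left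
    side is finite because [source] is integrable, so it can be absorbed. *)
Theorem smooth_weight_bound :
  (\int[mu]_(x in Omega) (v x `^ p * psi x `^ c * rho Omega x `^ (- 2))%:E <=
   ((2 * (C0 * M)) `^ p)%:E * \int[mu]_(x in [set x | (0 < v x)%R])
     (g x `^ p * psi x `^ c * rho Omega x `^ (2 * p - 2))%:E)%E.
Proof.
have H := weighted_hardy.
have mrho := measurable_rho bO.
have mO := open_measurable_rV oO.
have mpsi := continuous_measurable_rV cpsi.
have mv := continuous_measurable_rV cv.
have mX (f : 'rV[R]_d -> R) (a : R) : measurable_fun setT f -> measurable_fun setT (fun x => f x `^ a).
  by move=> mf; exact: (measurableT_comp (@measurable_powR R a) mf).
set X := (X in (X <= _)%E) in H *.
set Y := (X in (_ <= _ * X)%E).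
pose C1 := C0 * M.
have C10 : 0 < C1 by exact: mulr_gt0.
(* The value of [delta] for which Young's inequality leaves exactly half of
   the left side. *)
pose dl := (2 * C1)^-1.
have dl0 : 0 < dl by rewrite invr_gt0 mulr_gt0.
have Xfin : X \is a fin_num.
  rewrite ge0_fin_numE; first by apply: le_lt_trans H _; rewrite ltry.
  by apply: integral_ge0 => x _; rewrite lee_fin !mulr_ge0 ?powR_ge0.
have mV : measurable [set x : 'rV[R]_d | 0 < v x].
  apply: open_measurable_rV.
  rewrite (_ : [set x | _] = v @^-1` [set s : R | 0 < s])//.
  by apply: open_comp => [x _|]; [exact: cv|exact: open_gt].
have VO : [set x | 0 < v x] `<=` Omega.
  move=> x /= vx; apply: KO; apply: contrapT => /vK vx0.
  by move: vx; rewrite vx0 ltxx.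
have Y0 : (0 <= Y)%E.
  by apply: integral_ge0 => x _; rewrite lee_fin !mulr_ge0 ?powR_ge0.
have mG1 : measurable_fun setT (fun x => v x `^ p * psi x `^ c * rho Omega x `^ (- 2)).
  by apply: measurable_funM; [apply: measurable_funM; exact: mX|exact: mX].
have mG2 : measurable_fun setT (fun x => g x `^ p * psi x `^ c * rho Omega x `^ (2 * p - 2)).
  by apply: measurable_funM; [apply: measurable_funM; exact: mX|exact: mX].
have srcB : Bc source by exact: source_Bc.
have src0 x : 0 <= source x by exact: source_ge0.
have SI : ((\int[mu]_x source x)%:E <= dl%:E * X + (dl `^ (1 - p))%:E * Y)%E.
  rewrite /Rintegral fineK; last exact: integrable_fin_num (integrable_Bc srcB).
  have msrc : measurable_fun setT source by case: srcB.
  have -> : (\int[mu]_x (source x)%:E = \int[mu]_(x in [set x | (0 < v x)%R]) (source x)%:E)%E.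
    rewrite [RHS]integral_mkcond; apply: eq_integral => x _.
    rewrite patchE; case: ifPn => // /negP nV.
    have -> : source x = 0; last by [].
    have vx : v x = 0.
      apply: le_anti; rewrite v0 andbT leNgt; apply/negP => vx; apply: nV; rewrite inE//.
    by rewrite /source /source vx powR0 ?mul0r// gt_eqF//; have := p1; lra.
  have X1 : (\int[mu]_(x in [set x | (0 < v x)%R]) (v x `^ p * psi x `^ c * rho Omega x `^ (- 2))%:E <= X)%E.
    apply: ge0_subset_integral => //.
    - by apply/measurable_EFinP; exact: measurable_funTS.
    - by move=> x _; rewrite lee_fin !mulr_ge0 ?powR_ge0.
  apply: (@le_trans _ _ (\int[mu]_(x in [set x | (0 < v x)%R])
      (dl%:E * (v x `^ p * psi x `^ c * rho Omega x `^ (- 2))%:E +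
       (dl `^ (1 - p))%:E * (g x `^ p * psi x `^ c * rho Omega x `^ (2 * p - 2))%:E))%E).
    apply: ge0_le_integral => //.
    - by move=> x _; rewrite lee_fin.
    - by apply/measurable_EFinP; exact: measurable_funTS.
    - apply: emeasurable_funD; apply: measurable_funeM; apply/measurable_EFinP; exact: measurable_funTS.
    - move=> x vx; rewrite -!EFinM -EFinD lee_fin /source /source.
      apply: young_weight; rewrite ?powR_ge0//.
      have [r [r0 _ rO]] := thick_sub cK oO KO.
      apply: lt_le_trans r0 _; apply: (rho_lower oO bO rO).
      by apply: contrapT => /vK vx0; move: vx; rewrite /= vx0 ltxx.
  rewrite ge0_integralD//; last 4 first.
  - by move=> x _; rewrite -EFinM lee_fin !mulr_ge0 ?powR_ge0// ltW.
  - by apply: measurable_funeM; apply/measurable_EFinP; exact: measurable_funTS.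
  - by move=> x _; rewrite -EFinM lee_fin !mulr_ge0 ?powR_ge0.
  - by apply: measurable_funeM; apply/measurable_EFinP; exact: measurable_funTS.
  rewrite !ge0_integralZl_EFin ?powR_ge0 ?(ltW dl0)//.
  - by rewrite leeD2r// lee_pmul2l ?lte_fin.
  - by move=> x _; rewrite lee_fin !mulr_ge0 ?powR_ge0.
  - by apply/measurable_EFinP; exact: measurable_funTS.
  - by move=> x _; rewrite lee_fin !mulr_ge0 ?powR_ge0.
  - by apply/measurable_EFinP; exact: measurable_funTS.
have [Yfin|] := boolP (Y \is a fin_num); last first.
  rewrite ge0_fin_numE// -leNgt leye_eq => /eqP ->.
  by rewrite gt0_muley ?leey// lte_fin powR_gt0// mulr_gt0.
move: H SI; rewrite -(fineK Xfin) -(fineK Yfin) -!EFinM -EFinD !lee_fin -/C1.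
move=> H SI.
have E : C1 * dl = 2^-1 by rewrite /dl invfM mulrCA mulfV ?mulr1// gt_eqF.
have H2 : fine X <= 2^-1 * fine X + C1 * dl `^ (1 - p) * fine Y.
  apply: le_trans H _; apply: le_trans (ler_wpM2l (ltW C10) SI) _.
  by rewrite mulrDr !mulrA E.
have -> : (2 * C1) `^ p = 2 * (C1 * dl `^ (1 - p)).
  rewrite /dl -(powR_inv1 (ltW (mulr_gt0 _ C10)))// -powRrM.
  rewrite (_ : -1 * (1 - p) = p - 1); last by ring.
  rewrite mulrA mulr_powRB1//; first by rewrite ltW// mulr_gt0.
  by have := p1; lra.
rewrite -mulrA -/X -(fineK Xfin) lee_fin; exact: half_absorb.
Qed.

End energy.

(** * Pointwise regularity from local regularity *)

Section local_regularity.
Context {R : realType} {d : nat}.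
Local Notation e_ i := (delta_mx 0 i).
Implicit Types (U : set 'rV[R]_d) (u : 'rV[R]_d -> R).

(** Mollify the indicator of a small cube at a scale smaller than the cube:
    the average of the indicator is [1] near the centre. *)
Lemma smooth_cutoff U x : open U -> U x ->
  exists zeta, Cc_infty U zeta /\ \forall y \near x, zeta y = 1.
Proof.
move=> oU Ux.
have [r [r0 r1 rU]] : exists r, [/\ 0 < r, r <= 1 & thick r [set x] `<=` U].
  apply: thick_sub => //; first exact: compact_set1.
  by move=> _ ->.
(* The cube of half-width [r/2] around [x], mollified at scale [r/4], is equal
   to [1] on the cube of half-width [r/4]. *)
pose Q := thick (r / 2) [set x].
have r20 : 0 < r / 2 by rewrite divr_gt0.
have r40 : 0 < r / 4 by rewrite divr_gt0.
have [k mk] := mollifier1 r40.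
have cQ : compact Q by apply: thick_compact; exact: compact_set1.
have [L QL] := compact_sub_box cQ.
pose f : 'rV[R]_d -> R := \1_Q.
have fi : lebesgue_rV.-integrable setT (EFin \o f).
  apply: integrable_Bc; split.
  - by apply: measurable_indic; exact: compact_measurable_rV.
  - by exists 1 => y; rewrite /f indicE; case: (_ \in _); rewrite ?normr1 ?normr0.
  - by exists L => y ny; rewrite /f indicE memNset// => /QL.
exists (conv f (fun=> k)); split.
  split; first by move=> j; exact: (conv_Ck _ _ fi (bumps_J mk (d := d))).
  have cT := thick_compact (r := r / 4) cQ.
  apply: (@compact_supp_sub _ _ _ (thick (r / 4) Q) _ cT).
    move=> z [y [_ -> xy] yz]; apply: rU; exists x => // i.
    apply: le_trans (_ : r / 2 + r / 4 <= r); last by lra.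
    rewrite -(subrKA (y ord0 i)); apply: le_trans (ler_normD _ _) _.
    exact: lerD.
  move=> z nz; apply: (conv_thick_supp mk (lexx _) _ nz) => y ny.
  by rewrite /f indicE memNset.
apply/nbhs_ballP; exists (r / 4) => //= y /ball_rVP[_ xy].
apply/eqP; rewrite -subr_eq0 -normr_le0.
apply: (conv_J_dist mk fi) => z yz; rewrite /f indicE mem_set ?subrr ?normr0//.
exists x => // i; rewrite -(subrKA (y ord0 i)); apply: le_trans (ler_normD _ _) _.
by rewrite (_ : r / 2 = r / 4 + r / 4); [apply: lerD; exact: ltW|field].
Qed.

Lemma within_open_continuous_at U f x : open U -> {within U, continuous f} -> U x ->
  continuous_at x (f : 'rV[R]_d -> R).
Proof.
move=> oU; rewrite continuous_open_subspace// => H Ux; apply: H.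
by rewrite inE.
Qed.

Lemma near_partial u h i (x : 'rV[R]_d) : (\forall y \near x, u y = h y) ->
  \forall y \near x, partial i u y = partial i h y.
Proof.
move=> uh; apply: (@filterS _ (nbhs x)) (nbhs_interior uh) => y H.
by apply: near_eq_derive => //; rewrite delta_mx_neq0.
Qed.

(** Near a point, [u] coincides with its product with a cut-off equal to [1]
    there, and this product is [C^2] by definition of [C2_loc]. *)
Lemma C2_loc_regular U u : open U -> C2_loc U u -> forall i x, U x ->
  [/\ is_derive x (e_ i) u (partial i u x),
      is_derive x (e_ i) (partial i u) (partial i (partial i u) x),
      continuous_at x (partial i u) &
      continuous_at x (partial i (partial i u))].
Proof.
move=> oU Cu i x Ux.
have [zeta [Cz z1]] := smooth_cutoff oU Ux.
have uz : \forall y \near x, u y * zeta y = u y.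
  by apply: filterS z1 => y ->; rewrite mulr1.
have [_ /(_ i)[D1 [C1 /(_ i)[D2 [C2 _]]]]] := Cu _ Cz.
have uz1 := near_partial i uz.
have uz2 := near_partial i uz1.
split.
- apply: derivableP; exact: near_eq_derivable uz (D1 _ Ux).
- apply: derivableP; exact: near_eq_derivable uz1 (D2 _ Ux).
- exact: cont_ext uz1 (within_open_continuous_at oU C1 Ux).
- exact: cont_ext uz2 (within_open_continuous_at oU C2 Ux).
Qed.

End local_regularity.

(** * Mollified superharmonic functions *)

Section nonmeasurable.
Local Open Scope ereal_scope.
Context d (T : measurableType d) (R : realType) (mu : {measure set T -> \bar R}).

(** Apply the comparison of nonnegative functions to the positive and negative
    parts, in both directions. *)
Lemma ae_eq_integral_nonmeasurable (D : set T) (f g : T -> \bar R) :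
  {ae mu, forall x, D x -> f x = g x} ->
  \int[mu]_(x in D) f x = \int[mu]_(x in D) g x.
Proof.
move=> fg.
have ge0 (f1 g1 : T -> \bar R) : (forall x, 0 <= f1 x) -> (forall x, 0 <= g1 x) ->
    {ae mu, forall x, D x -> f1 x = g1 x} ->
    \int[mu]_(x in D) f1 x = \int[mu]_(x in D) g1 x.
  move=> f0 g0 H; apply: le_anti; apply/andP; split;
    by apply: ge0_ae_le_integral_nonmeasurable => //; apply: filterS H => x H /H ->.
rewrite integralE [RHS]integralE; congr (_ - _); apply: ge0 => //;
  by apply: filterS fg => x H /H; rewrite ?funeposE ?funenegE => ->.
Qed.

Lemma Rintegral_sum (D : set T) (mD : measurable D) (I : finType) (f : I -> T -> R) :
  (forall i, mu.-integrable D (EFin \o f i)) ->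
  (\int[mu]_(x in D) (\sum_i f i x) = \sum_i \int[mu]_(x in D) f i x)%R.
Proof.
move=> fi; rewrite /Rintegral.
under eq_integral do rewrite -sumEFin.
by rewrite integral_sum// sum_fine// => i _; exact: integrable_fin_num (fi i).
Qed.

End nonmeasurable.

Section superharmonic.
Context {R : realType} {d : nat}.
Local Notation mu := (@lebesgue_rV R d).
Local Notation e_ i := (delta_mx 0 i).
Variables (Omega : set 'rV[R]_d) (phi : 'rV[R]_d -> R).
Hypothesis oO : open Omega.
Hypothesis phi_sh : superharmonic Omega phi.
Hypothesis phi_gt0 : {ae mu, forall x, Omega x -> 0 < phi x}.

(** Take the positive part of a Borel version of [phi] and cut it off outside
    [K']. *)
Lemma positive_version (K' : set 'rV[R]_d) : compact K' -> K' `<=` Omega ->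
  exists phit : 'rV[R]_d -> R, [/\ mu.-integrable setT (EFin \o phit),
    forall x, 0 <= phit x, forall x, ~ K' x -> phit x = 0 &
    {ae mu, forall x, K' x -> phit x = phi x /\ 0 < phi x}].
Proof.
move=> cK KO; have [[[g mg phig] phiL] _] := phi_sh.
have mK := compact_measurable_rV cK.
pose f := (fun x => Num.max (g x) 0) \_ K'.
have f0 x : 0 <= f x by rewrite /f patchE; case: ifPn => // _; rewrite le_max lexx orbT.
have ae : {ae mu, forall x, K' x -> f x = phi x /\ 0 < phi x}.
  apply: filterS2 phig phi_gt0 => x H1 H2 Kx; have Ox := KO _ Kx.
  split; last exact: H2.
  by rewrite /f patchE mem_set// -H1// max_l// ltW// H2.
have mf : measurable_fun setT f.
  apply: (proj1 (@measurable_restrictT _ _ _ _ K' (g \max cst 0) mK)).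
  apply: measurable_maxr; last exact: measurable_cst.
  by apply: measurable_funS KO mg => //; exact: open_measurable_rV.
have fK x : ~ K' x -> f x = 0 by move=> nK; rewrite /f patchE memNset.
exists f; split => //; apply/integrableP; split; first exact/measurable_EFinP.
apply: le_lt_trans (phiL _ cK KO).
rewrite [X in (_ <= X)%E]integral_mkcond.
apply: ge0_ae_le_integral_nonmeasurable => //.
- by move=> x _; rewrite patchE; case: ifP.
- apply: filterS ae => x H _ /=; rewrite patchE; case: ifPn => [/set_mem/H[-> _]//|/negP nK].
  by rewrite fK ?normr0// => Kx; apply: nK; rewrite inE.
Qed.

(** When the Laplacian of the test function lives in [K'], the integrands with
    [phi] and with its version agree almost everywhere. *)
Lemma superharmonic_version (K' : set 'rV[R]_d) (phit zeta : 'rV[R]_d -> R) :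
  K' `<=` Omega -> mu.-integrable setT (EFin \o phit) ->
  (forall x, ~ K' x -> phit x = 0) -> {ae mu, forall x, K' x -> phit x = phi x /\ 0 < phi x} ->
  Cc_infty Omega zeta -> (forall x, 0 <= zeta x) ->
  (forall x, ~ K' x -> laplacian zeta x = 0) ->
  \int[mu]_x (phit x * laplacian zeta x) <= 0.
Proof.
move=> KO fi fK ae zC z0 zK.
rewrite /Rintegral fine_le0//.
apply: le_trans (phi_sh.2 zeta zC (fun x _ => z0 x)).
rewrite le_eqVlt; apply/orP; left; apply/eqP.
rewrite [RHS]integral_mkcond; apply: ae_eq_integral_nonmeasurable.
apply: filterS ae => x H _; rewrite patchE.
have [Kx|nK] := pselect (K' x); first by rewrite mem_set ?(H Kx).1//; exact: KO.
by rewrite zK// !mulr0; case: ifP.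
Qed.

(** For [x] in [K] the function [y -> J(y, x)] is a nonnegative test function
    supported in the thickening of [K]. Its Laplacian in [y] equals the
    Laplacian of the kernel in [x], the second derivative of an even function
    being even, so the Laplacian of the mollification at [x] is the integral
    of [phi] against the Laplacian of a test function. *)
Lemma mollified_superharmonic (K : set 'rV[R]_d) (phit : 'rV[R]_d -> R) r e k
    (k1 k2 : R -> R) x :
  thick r K `<=` Omega -> compact K -> mu.-integrable setT (EFin \o phit) ->
  (forall x, ~ thick r K x -> phit x = 0) ->
  {ae mu, forall x, thick r K x -> phit x = phi x /\ 0 < phi x} ->
  mollifier e k -> e <= r ->
  bump e k1 -> bump e k2 -> (forall t : R, is_derive t 1 k (k1 t)) ->
  (forall t : R, is_derive t 1 k1 (k2 t)) -> (forall t, k2 (- t) = k2 t) -> K x ->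
  \sum_i conv phit (upd (upd (fun=> k) i k1) i k2) x <= 0.
Proof.
move=> KO cK fi fK ae mk er b1 b2 d1 d2 k2N Kx.
have bJ := bumps_J mk (d := d).
pose G i := upd (upd (fun=> k) i k1) i k2 : 'I_d -> R -> R.
have bG1 (i : 'I_d) : bumps e (upd (fun=> k) i k1) := bumps_upd i bJ b1.
have bG i : bumps e (G i) := bumps_upd i (bG1 i) b2.
pose zeta y := J k y x.
have dz i y : is_derive y (e_ i) zeta (kern (upd (fun=> k) i k1) y x).
  exact: kern_is_derive bJ d1.
have dzE i : partial i zeta = fun y => kern (upd (fun=> k) i k1) y x.
  by apply/funext => y; rewrite /partial; case: (dz i y).
have ddz i y : is_derive y (e_ i) (partial i zeta) (kern (G i) y x).
  rewrite dzE; apply: kern_is_derive (bG1 i) _ => t.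
  by rewrite {1}/upd eqxx.
(* Each factor of [kern (G i)] is even, so the arguments can be exchanged. *)
have lapE y : laplacian zeta y = \sum_i kern (G i) x y.
  apply: eq_bigr => i _; rewrite {1}/partial; case: (ddz i y) => _ ->.
  apply: eq_bigr => j _; rewrite /G /upd; case: eqP => _.
    by rewrite -k2N opprB.
  by case: mk => _ kN _ _; rewrite -kN opprB.
have far y : ~ thick r K y -> exists j, e <= `|x ord0 j - y ord0 j|.
  move=> nT; apply: contrapT => H; apply: nT; exists x => // j.
  apply: le_trans er; by rewrite leNgt; apply/negP => /ltW xy; apply: H; exists j.
have -> : \sum_i conv phit (G i) x = \int[mu]_y (phit y * laplacian zeta y).
  rewrite -Rintegral_sum//; last by move=> i; exact: conv_integrable x fi (bG i).
  by apply: eq_Rintegral => y _; rewrite lapE mulr_sumr.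
apply: (superharmonic_version KO fi fK ae).
- split; first by move=> j; exact: kern_Ck x j Omega bJ.
  apply: (compact_supp_sub (thick_compact cK) KO) => y /far[j xy].
  by rewrite /zeta (J_sym mk); exact: kern_supp bJ xy.
- by move=> y; rewrite /zeta (J_ge0 mk).
- move=> y /far[j xy]; rewrite lapE big1// => i _; exact: kern_supp (bG i) xy.
Qed.

End superharmonic.

(** * Removing the regularization of the weight *)

Section singular_weight.
Context {R : realType} {d : nat}.
Local Notation mu := (@lebesgue_rV R d).
Implicit Types (A B h k : 'rV[R]_d -> R).

Lemma powR_nonincreasing (a s t : R) : a <= 0 -> 0 < s -> s <= t -> t `^ a <= s `^ a.
Proof.
move=> a0 s0 st; have t0 := lt_le_trans s0 st.
rewrite -(opprK a) powRN [leRHS]powRN lef_pV2 ?posrE ?powR_gt0//.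
by apply: ge0_ler_powR; rewrite ?nnegrE ?oppr_ge0 ?(ltW s0) ?(ltW t0).
Qed.

(** Mean value theorem: as [c < 1], the derivative of [s^c] is largest at the
    left end [eta]. *)
Lemma powR_lipschitz (c eta s t : R) : c < 1 -> 0 < eta -> eta <= s -> eta <= t ->
  `|s `^ c - t `^ c| <= `|c| * eta `^ (c - 1) * `|s - t|.
Proof.
move=> c1 e0; wlog: s t / s < t => [H es et|st es et].
  have [st|ts|->] := ltgtP s t; first exact: H.
    by rewrite distrC [X in _ * X]distrC; exact: H.
  by rewrite !subrr normr0 mulr0.
have s0 := lt_le_trans e0 es.
have [z zst E] : exists2 z, z \in `]s, t[%R & t `^ c - s `^ c = c * z `^ (c - 1) * (t - s).
  apply: (@MVT _ (fun x => x `^ c) (fun x => c * x `^ (c - 1))) => //.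
  - move=> x; rewrite in_itv/= => /andP[sx _]; apply: is_derive_powR; exact: lt_trans sx.
  - apply: derivable_within_continuous => x; rewrite in_itv/= => /andP[sx _].
    by case: (@is_derive_powR R c x (lt_le_trans s0 sx)).
move: zst; rewrite in_itv/= => /andP[sz _].
rewrite distrC E (distrC s) 2!normrM ler_wpM2r// ler_wpM2l//.
rewrite ger0_norm ?powR_ge0//; apply: powR_nonincreasing => //; first by lra.
exact: le_trans es (ltW sz).
Qed.

Lemma measurable_powR_shift h (c eta : R) : measurable_fun setT h ->
  measurable_fun setT (fun x => (h x + eta) `^ c).
Proof.
move=> mh; apply: (measurableT_comp (@measurable_powR R c)).
by apply: measurable_funD => //; exact: measurable_cst.
Qed.

Lemma weighted_pow_le A h k (c eta M : R) : c < 1 -> 0 < eta ->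
  measurable_fun setT A -> (forall x, 0 <= A x) -> (forall x, `|A x| <= M) ->
  measurable_fun setT h -> measurable_fun setT k ->
  (forall x, 0 <= h x) -> (forall x, 0 <= k x) ->
  (\int[mu]_x (A x * (h x + eta) `^ c)%:E <=
   \int[mu]_x (A x * (k x + eta) `^ c)%:E +
   (M * (`|c| * eta `^ (c - 1)))%:E * L1 setT (fun x => (h x - k x)%R))%E.
Proof.
move=> c1 e0 mA A0 AM mh mk h0 k0.
have M0 : 0 <= M by apply: le_trans (AM 0).
have C0 : 0 <= `|c| * eta `^ (c - 1) by exact: mulr_ge0 (normr_ge0 c) (powR_ge0 _ _).
have m1 : measurable_fun setT (fun x => `|h x - k x|%:E).
  by apply/measurable_EFinP; apply: measurableT_comp => //; exact: measurable_funB.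
have mp (f : 'rV[R]_d -> R) : measurable_fun setT f -> measurable_fun setT (fun x => (A x * (f x + eta) `^ c)%:E).
  by move=> mf; apply/measurable_EFinP; apply: measurable_funM => //; exact: measurable_powR_shift.
have pos (f : 'rV[R]_d -> R) x : (0 <= (A x * (f x + eta) `^ c)%:E)%E by rewrite lee_fin mulr_ge0 ?powR_ge0.
rewrite /L1 -ge0_integralZl_EFin//; last exact: (mulr_ge0 M0 C0).
rewrite -ge0_integralD//; last 3 first.
- exact: mp.
- by move=> x _; rewrite -EFinM lee_fin mulr_ge0 ?normr_ge0// mulr_ge0.
- exact: measurable_funeM.
apply: ge0_le_integral => //.
- exact: mp.
- by apply: emeasurable_funD; [exact: mp|exact: measurable_funeM].
move=> x _; rewrite -EFinM -EFinD lee_fin -lerBlDl -mulrBr.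
apply: le_trans (ler_norm _) _; rewrite normrM -mulrA; apply: ler_pM => //.
have -> : h x - k x = h x + eta - (k x + eta) by ring.
by apply: powR_lipschitz => //; rewrite lerDr.
Qed.

(** Replace [h_n] by [h] on both sides; by the Lipschitz bound each
    replacement costs a multiple of the [L^1] distance. *)
Lemma weighted_pow_limit A B h (hn : nat -> 'rV[R]_d -> R) (c eta N : R) :
  c < 1 -> 0 < eta -> 0 < N -> Bc A -> Bc B -> (forall x, 0 <= A x) -> (forall x, 0 <= B x) ->
  measurable_fun setT h -> (forall n, measurable_fun setT (hn n)) ->
  (forall x, 0 <= h x) -> (forall n x, 0 <= hn n x) ->
  L1 setT (fun x => hn n x - h x) @[n --> \oo] --> 0%E ->
  (forall n, \int[mu]_x (A x * (hn n x + eta) `^ c)%:E <=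
     N%:E * \int[mu]_x (B x * (hn n x + eta) `^ c)%:E)%E ->
  (\int[mu]_x (A x * (h x + eta) `^ c)%:E <= N%:E * \int[mu]_x (B x * (h x + eta) `^ c)%:E)%E.
Proof.
move=> c1 e0 N0 [mA [MA AM] _] [mB [MB BM] _] A0 B0 mh mhn h0 hn0 hL H.
set C := `|c| * eta `^ (c - 1).
have C0 : 0 <= C by exact: mulr_ge0 (normr_ge0 c) (powR_ge0 _ _).
have MA0 : 0 <= MA by apply: le_trans (AM 0).
have MB0 : 0 <= MB by apply: le_trans (BM 0).
(* The total cost of the two replacements, per unit of [L^1] distance. *)
pose D := MA * C + N * (MB * C).
have D0 : 0 <= D.
  apply: addr_ge0; first exact: (mulr_ge0 MA0 C0).
  exact: (mulr_ge0 (ltW N0) (mulr_ge0 MB0 C0)).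
have L1E n : L1 setT (fun x => h x - hn n x) = L1 setT (fun x => hn n x - h x).
  by apply: eq_integral => x _; rewrite distrC.
have step n : (\int[mu]_x (A x * (h x + eta) `^ c)%:E <=
    N%:E * \int[mu]_x (B x * (h x + eta) `^ c)%:E + D%:E * L1 setT (fun x => (hn n x - h x)%R))%E.
  apply: le_trans (weighted_pow_le c1 e0 mA A0 AM mh (mhn n) h0 (hn0 n)) _.
  have H2 := weighted_pow_le c1 e0 mB B0 BM (mhn n) mh (hn0 n) h0.
  rewrite L1E -/C in H2 *.
  apply: le_trans (leeD2r _ (H n)) _.
  apply: le_trans (leeD2r _ (lee_wpmul2l _ H2)) _; first by rewrite lee_fin ltW.
  have I0 : (0 <= \int[mu]_x (B x * (h x + eta) `^ c)%:E)%E.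
    by apply: integral_ge0 => x _; rewrite lee_fin; apply: mulr_ge0 (B0 x) (powR_ge0 _ _).
  have P0 : (0 <= (MB * C)%:E * L1 setT (fun x => (hn n x - h x)%R))%E.
    by apply: mule_ge0 (L1_ge0 _ _); rewrite lee_fin; apply: mulr_ge0.
  have Q1 : (0 <= (MA * C)%:E)%E by rewrite lee_fin; apply: mulr_ge0.
  have Q2 : (0 <= (N * (MB * C))%:E)%E.
    by rewrite lee_fin; apply: mulr_ge0 (ltW N0) _; apply: mulr_ge0.
  rewrite (ge0_muleDr _ I0 P0) /D EFinD (ge0_muleDl _ Q1 Q2).
  by rewrite -addeA muleA -EFinM [X in (_ + X)%E]addeC.
apply/lee_addgt0Pr => e ee0.
have [n Hn] : exists n, (L1 setT (fun x => (hn n x - h x)%R) <= (e / (D + 1))%:E)%E.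
  have d0 : 0 < e / (D + 1) by rewrite divr_gt0// ltr_wpDl.
  have /fine_cvgP[fin /cvgrPdist_lt/(_ _ d0) H1] := hL.
  near \oo => n; exists n.
  have fn : L1 setT (fun x => hn n x - h x) \is a fin_num by near: n.
  have : `|0 - fine (L1 setT (fun x => hn n x - h x))| < e / (D + 1) by near: n.
  rewrite sub0r normrN => /ltW; rewrite -(fineK fn) lee_fin; apply: le_trans; exact: ler_norm.
apply: le_trans (step n) _; apply: leeD2l.
apply: le_trans (lee_wpmul2l _ Hn) _; first by rewrite lee_fin.
rewrite -EFinM lee_fin mulrCA ger_pMr// ler_pdivrMr ?ltr_wpDl// mul1r lerDl ler01//.
Unshelve. all: by end_near. Qed.

(** For [c < 0] the limit of [(s + eta)^c] at [s = 0] is infinite; the value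
    zero chosen here restricts integrals to the points where [s > 0]. *)
Definition pos_powR (c s : R) : R := if 0 < s then s `^ c else 0.

(** Restrict to the points where [h > 0], which loses nothing on the right
    because [h > 0] almost everywhere where [B] is nonzero. On the left use
    Fatou's lemma. On the right, [(h + eta)^c <= h^c] if [c <= 0], and [(h +
    eta)^c <= h + 1] for [eta <= 1] if [c > 0], so that dominated convergence
    applies. *)
Lemma positive_weight_limit A B h (c N : R) :
  c < 1 -> 0 < N -> Bc A -> Bc B -> (forall x, 0 <= A x) -> (forall x, 0 <= B x) ->
  mu.-integrable setT (EFin \o h) -> (forall x, 0 <= h x) ->
  {ae mu, forall x, B x != 0 -> 0 < h x} ->
  (forall eta : R, (0 < eta)%R -> \int[mu]_x (A x * (h x + eta) `^ c)%:E <=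
     N%:E * \int[mu]_x (B x * (h x + eta) `^ c)%:E)%E ->
  (\int[mu]_x (A x * pos_powR c (h x))%:E <= N%:E * \int[mu]_x (B x * pos_powR c (h x))%:E)%E.
Proof.
move=> c1 N0 BA BB A0 B0 hi h0 hB H; pose w x := pos_powR c (h x).
rewrite -!/(w _).
have mh : measurable_fun setT h by apply/measurable_EFinP; exact: measurable_int hi.
have [mA _ _] := BA; have [mB [MB BM] _] := BB.
pose we (eta : R) x := if 0 < h x then (h x + eta) `^ c else 0.
pose e (n : nat) : R := n.+1%:R^-1.
have e0 n : 0 < e n by rewrite invr_gt0.
have e1 n : e n <= 1 by rewrite invf_le1// ler1n.
have we0 eta x : 0 <= we eta x by rewrite /we; case: ifP => _; rewrite ?powR_ge0.
have mif (F : 'rV[R]_d -> R) : measurable_fun setT F ->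
    measurable_fun setT (fun x => if 0 < h x then F x else 0).
  move=> mF; apply: measurable_fun_ifT => //.
  by apply: measurable_fun_ltr => //; exact: measurable_cst.
have mwe eta : measurable_fun setT (we eta).
  by apply: mif; exact: measurable_powR_shift.
have wE : w = we 0 by apply/funext => x; rewrite /w /pos_powR /we addr0.
have w0 x : 0 <= w x by rewrite wE.
have mw : measurable_fun setT w by rewrite wE.
have Hn n : (\int[mu]_x (A x * we (e n) x)%:E <= N%:E * \int[mu]_x (B x * we (e n) x)%:E)%E.
  apply: (@le_trans _ _ (\int[mu]_x (A x * (h x + e n) `^ c)%:E)%E).
    apply: ge0_le_integral => //.
    - by move=> x _; rewrite lee_fin mulr_ge0.
    - by apply/measurable_EFinP; exact: measurable_funM.
    - by apply/measurable_EFinP; apply: measurable_funM => //; exact: measurable_powR_shift.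
    - by move=> x _; rewrite lee_fin ler_wpM2l// /we; case: ifP => // _; rewrite powR_ge0.
  apply: le_trans (H _ (e0 n)) _.
  rewrite le_eqVlt; apply/orP; left; apply/eqP; congr (_ * _)%E.
  apply: ae_eq_integral_nonmeasurable; apply: filterS hB => x hx _.
  by have [->|/hx h1] := eqVneq (B x) 0; rewrite ?mul0r// /we h1.
have cw x : we (e n) x @[n --> \oo] --> w x.
  rewrite wE /we; case: ifPn => hx; last exact: cvg_cst.
  have E : h x + e n @[n --> \oo] --> h x + 0.
    by apply: cvgD; [exact: cvg_cst|exact: cvg_harmonic].
  have hx' : 0 < h x + 0 by rewrite addr0.
  apply: (@continuous_cvg _ _ _ _ _ (fun n => h x + e n) (fun s : R => s `^ c) _ _ E); exact: continuous_powR.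
have [fin|] := boolP ((\int[mu]_x (B x * w x)%:E)%E \is a fin_num); last first.
  rewrite ge0_fin_numE; last by apply: integral_ge0 => x _; rewrite lee_fin mulr_ge0.
  by rewrite -leNgt leye_eq => /eqP ->; rewrite gt0_muley ?leey ?lte_fin.
rewrite -(fineK fin) -EFinM.
suff [cn [Hc Hcn]] : exists cn : nat -> R,
    (\forall n \near \oo, (\int[mu]_x (B x * we (e n) x)%:E <= (cn n)%:E)%E) /\
    cn n @[n --> \oo] --> fine (\int[mu]_x (B x * w x)%:E)%E.
  apply: (@fatou_le _ _ _ mu setT (fun n x => (A x * we (e n) x)%:E) _ (fun n => N * cn n)) => //.
  - by move=> n; apply/measurable_EFinP; exact: measurable_funM.
  - by move=> n x _; rewrite lee_fin mulr_ge0.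
  - move=> x _; apply: cvg_EFin; first exact: nearW.
    by apply: cvgM; [exact: cvg_cst|exact: cw].
  - apply: filterS Hc => n Hc; apply: le_trans (Hn n) _.
    by rewrite EFinM; apply: lee_wpmul2l => //; rewrite lee_fin ltW.
  - by apply: cvgM => //; exact: cvg_cst.
have [c0|c0] := leP c 0.
  exists (fun=> fine (\int[mu]_x (B x * w x)%:E)%E); split; last exact: cvg_cst.
  apply: nearW => n; rewrite fineK//; apply: ge0_le_integral => //.
  - by move=> x _; rewrite lee_fin mulr_ge0.
  - by apply/measurable_EFinP; exact: measurable_funM.
  - by apply/measurable_EFinP; exact: measurable_funM.
  - move=> x _; rewrite lee_fin ler_wpM2l// /w /pos_powR /we; case: ifP => // hx.
    by apply: powR_nonincreasing => //; rewrite lerDl ltW.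
have gi : mu.-integrable setT (fun x => (h x * B x + B x)%:E).
  exact: (integrableD measurableT (integrable_mul_bdd hi mB BM) (integrable_Bc BB)).
have dom n x : B x * we (e n) x <= h x * B x + B x.
  rewrite (_ : h x * B x + B x = B x * (h x + 1)); last by ring.
  rewrite ler_wpM2l// /we; case: ifPn => hx; last first.
    by rewrite addr_ge0.
  apply: (@le_trans _ _ ((h x + 1) `^ c)).
    by apply: ge0_ler_powR; rewrite ?nnegrE ?addr_ge0 ?(ltW c0) ?(ltW (e0 n))// lerD2l.
  rewrite -[leRHS]powRr1 ?addr_ge0//; apply: ler_powR; last exact: ltW.
  by rewrite lerDr.
exists (fun n => fine (\int[mu]_x (B x * we (e n) x)%:E)%E).
have I n : mu.-integrable setT (fun x => (B x * we (e n) x)%:E).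
  apply: le_integrable gi => //; first by apply/measurable_EFinP; exact: measurable_funM.
  move=> x _; rewrite lee_fin ger0_norm; last exact: mulr_ge0.
  by apply: le_trans (dom n x) _; exact: ler_norm.
split; first by apply: nearW => n; rewrite fineK//; exact: integrable_fin_num (I n).
apply: fine_cvg; rewrite fineK//.
apply: (@dominated_cvg _ _ _ mu setT measurableT (fun n x => (B x * we (e n) x)%:E) (fun x => (B x * w x)%:E) (fun x => (h x * B x + B x)%:E)) => //.
- by move=> n; apply/measurable_EFinP; exact: measurable_funM.
- move=> x _; apply: cvg_EFin; first exact: nearW.
  by apply: cvgM; [exact: cvg_cst|exact: cw].
- by move=> n x _ /=; rewrite lee_fin ger0_norm ?mulr_ge0.
Qed.

End singular_weight.

(** * The estimate for superharmonic weights *)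

Lemma integral_support d (T : measurableType d) (R : realType) (mu : {measure set T -> \bar R})
    (D : set T) (f : T -> \bar R) : (forall x, ~ D x -> f x = 0%E) ->
  (\int[mu]_(x in D) f x = \int[mu]_x f x)%E.
Proof.
move=> f0; rewrite integral_mkcond; congr integral; apply/funext => x.
by rewrite patchE; case: ifPn => // /negP nD; rewrite f0// => Dx; apply: nD; rewrite inE.
Qed.

Section weak_bound.
Context {R : realType} {d : nat}.
Local Notation mu := (@lebesgue_rV R d).
Local Notation e_ i := (delta_mx 0 i).
Variables (Omega : set 'rV[R]_d) (C0 : R).
Hypothesis oO : open Omega.
Hypothesis bO : boundary Omega !=set0.
Hypothesis C0_gt0 : 0 < C0.
Hypothesis hO : hardy Omega C0.
Variables (p c t M : R).
Hypothesis p1 : 1 < p.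
Hypothesis c1 : c < 1.
Hypothesis t0 : 0 < t.
Hypothesis M0 : 0 < M.
Hypothesis form : coercive p c t M.
Variables (K : set 'rV[R]_d) (r : R) (phi phit : 'rV[R]_d -> R).
Hypothesis cK : compact K.
Hypothesis r0 : 0 < r.
Hypothesis r1 : r <= 1.
Hypothesis rO : thick r K `<=` Omega.
Hypothesis phi_sh : superharmonic Omega phi.
Hypothesis fi : mu.-integrable setT (EFin \o phit).
Hypothesis f0 : forall x, 0 <= phit x.
Hypothesis fK : forall x, ~ thick r K x -> phit x = 0.
Hypothesis phitE : {ae mu, forall x, thick r K x -> phit x = phi x /\ 0 < phi x}.

Variables (v : 'rV[R]_d -> R) (dv ddv : 'I_d -> 'rV[R]_d -> R) (g : 'rV[R]_d -> R).
Hypothesis cv : continuous v.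
Hypothesis v0 : forall x, 0 <= v x.
Hypothesis vK : forall x, ~ K x -> v x = 0.
Hypothesis dvE : forall i x, 0 < v x -> is_derive x (e_ i) v (dv i x).
Hypothesis ddvE : forall i x, 0 < v x -> is_derive x (e_ i) (dv i) (ddv i x).
Hypothesis cdv : forall i x, 0 < v x -> continuous_at x (dv i).
Hypothesis cddv : forall i x, 0 < v x -> continuous_at x (ddv i).
Hypothesis mg : measurable_fun setT g.
Hypothesis g0 : forall x, 0 <= g x.
Hypothesis gB : exists B, forall x, `|g x| <= B.
Hypothesis gv : forall x, 0 < v x -> - \sum_i ddv i x <= g x.
Hypothesis gv0 : forall x, v x = 0 -> g x = 0.

Let mX (f : 'rV[R]_d -> R) (a : R) : measurable_fun setT f ->
  measurable_fun setT (fun x => f x `^ a).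
Proof. by move=> mf; exact: (measurableT_comp (@measurable_powR R a) mf). Qed.

Let KO : K `<=` Omega.
Proof. by apply: subset_trans rO; apply: sub_thick; have := r0; lra. Qed.

Let p0 : 0 < p. Proof. by have := p1; lra. Qed.

(** On the support of [v] the distance to the boundary is at least [r]. *)
Lemma mass_weight_Bc : Bc (fun x => v x `^ p * rho Omega x `^ (- 2)).
Proof.
have [L KL] := compact_sub_box cK.
have vC : Cc v by split => //; exists L => x nx; apply: vK => /KL.
have [V V0 vV] := Cc_bounded vC.
split.
- apply: measurable_funM; apply: mX; first exact: continuous_measurable_rV.
  exact: measurable_rho.
- exists (V `^ p * r `^ (- 2)) => x; rewrite ger0_norm ?mulr_ge0 ?powR_ge0//.
  have [Kx|/vK ->] := pselect (K x); last first.
    by rewrite powR0 ?gt_eqF// mul0r mulr_ge0 ?powR_ge0.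
  apply: ler_pM; rewrite ?powR_ge0//.
    apply: ge0_ler_powR; rewrite ?nnegrE ?(ltW p0) ?(ltW V0)//.
    exact: le_trans (ler_norm _) (vV x).
  by apply: powR_nonincreasing => //; exact: (rho_lower oO bO rO).
- by exists L => x nx; rewrite vK ?powR0 ?mul0r ?gt_eqF// => /KL.
Qed.

Lemma source_weight_Bc : Bc (fun x => g x `^ p * rho Omega x `^ (2 * p - 2)).
Proof.
have [L KL] := compact_sub_box cK.
have gL x : ~ box L x -> g x = 0 by move=> nx; apply: gv0; apply: vK => /KL.
have [B gB'] := gB; have [P rP] := rho_upper bO L.
have B0 : 0 <= B by apply: le_trans (gB' 0).
have p2 : 0 <= 2 * p - 2 by have := p1; lra.
split.
- by apply: measurable_funM; apply: mX => //; exact: measurable_rho.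
- exists (B `^ p * `|P| `^ (2 * p - 2)) => x; rewrite ger0_norm ?mulr_ge0 ?powR_ge0//.
  have [Lx|/gL ->] := pselect (box L x); last first.
    by rewrite powR0 ?gt_eqF// mul0r mulr_ge0 ?powR_ge0.
  apply: ler_pM; rewrite ?powR_ge0//.
    apply: ge0_ler_powR; rewrite ?nnegrE ?(ltW p0)//.
    exact: le_trans (ler_norm _) (gB' x).
  apply: ge0_ler_powR; rewrite ?nnegrE ?(rho_ge0 bO)//.
  exact: le_trans (rP x Lx) (ler_norm _).
- by exists L => x nx; rewrite gL ?powR0 ?mul0r ?gt_eqF.
Qed.

(** Apply [smooth_weight_bound] with [psi = J_n * phi + eta], let [n] tend to
    infinity, then let [eta] tend to zero. *)
Theorem weak_weight_bound :
  (\int[mu]_x (v x `^ p * rho Omega x `^ (- 2) * pos_powR c (phit x))%:E <=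
   ((2 * (C0 * M)) `^ p)%:E *
     \int[mu]_x (g x `^ p * rho Omega x `^ (2 * p - 2) * pos_powR c (phit x))%:E)%E.
Proof.
have mf : measurable_fun setT phit by apply/measurable_EFinP; exact: measurable_int fi.
have [k mk] := mollifier_sequence r0.
have er n : r / n.+1%:R <= r by rewrite ler_pdivrMr// ler_peMr ?(ltW r0)// ler1n.
have bJ n := bumps_J (mk n) (d := d).
have hn0 n x : 0 <= conv phit (fun=> k n) x.
  by apply: Rintegral_ge0 => // y _; rewrite mulr_ge0// (J_ge0 (mk n)).
have ch n : continuous (conv phit (fun=> k n)) by exact: conv_continuous fi (bJ n).
have N0 : 0 < (2 * (C0 * M)) `^ p by rewrite powR_gt0// !mulr_gt0.
have A0 x : 0 <= v x `^ p * rho Omega x `^ (- 2) by rewrite mulr_ge0 ?powR_ge0.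
have B0 x : 0 <= g x `^ p * rho Omega x `^ (2 * p - 2) by rewrite mulr_ge0 ?powR_ge0.
apply: (positive_weight_limit c1 N0 mass_weight_Bc source_weight_Bc A0 B0 fi f0).
  apply: filterS phitE => x H Bx.
  have Kx : K x.
    apply: contrapT => /vK/gv0 gx; move: Bx.
    by rewrite gx powR0 ?(gt_eqF p0)// mul0r eqxx.
  by have [->] := H (sub_thick (ltW r0) Kx).
move=> eta e0.
apply: (weighted_pow_limit c1 e0 N0 mass_weight_Bc source_weight_Bc A0 B0 mf
  (fun n => continuous_measurable_rV (ch n)) f0 hn0).
  have [L KL] := compact_sub_box (thick_compact (r := r) cK).
  apply: (@conv_L1_cvg R d (fun n => r / n.+1%:R) k phit `|L|) => //.
  - by move=> n; apply: le_trans (er n) r1.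
  - exact: cvg_divn.
  - move=> x nx; apply: fK => /KL Lx; apply: nx => i; exact: le_trans (Lx i) (ler_norm _).
move=> n; have [k1 b1 [d1 k1N]] := mollifier_derivative (mk n).
have [k2 b2 d2] := bump_derivable b1.
have k2N (s : R) : k2 (- s) = k2 s.
  by rewrite (derive_parity s d2 (s := -1)) => [|y]; rewrite ?k1N mulN1r ?opprK.
pose psi x := conv phit (fun=> k n) x + eta.
pose dpsi i := conv phit (upd (fun=> k n) i k1).
pose ddpsi i := conv phit (upd (upd (fun=> k n) i k1) i k2).
have bG1 (i : 'I_d) : bumps (r / n.+1%:R) (upd (fun=> k n) i k1) := bumps_upd i (bJ n) b1.
have bG2 (i : 'I_d) := bumps_upd i (bG1 i) b2.
have psi0 x : 0 < psi x by rewrite ltr_wpDl.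
have cpsi : continuous psi by move=> x; exact: (cont_add (ch n x) (cont_cst eta x)).
have dpsiE i x : is_derive x (e_ i) psi (dpsi i x).
  have := is_derive_add (conv_is_derive x fi (bJ n) b1 (d1 : forall t : R, is_derive t 1 ((fun=> k n) i) (k1 t))) (is_derive_const eta x (e_ i)).
  by rewrite addr0.
have ddpsiE i x : is_derive x (e_ i) (dpsi i) (ddpsi i x).
  by apply: (conv_is_derive x fi (bG1 i) b2) => s; rewrite /upd eqxx.
have cdpsi i : continuous (dpsi i) by exact: conv_continuous fi (bG1 i).
have cddpsi i : continuous (ddpsi i) by exact: conv_continuous fi (bG2 i).
have super x : K x -> \sum_i ddpsi i x <= 0.
  exact: (mollified_superharmonic phi_sh rO cK fi fK phitE (mk n) (er n) b1 b2 d1 d2 k2N).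
have := smooth_weight_bound p1 t0 M0 form cK cv v0 vK dvE ddvE cdv cddv psi0 cpsi
  dpsiE ddpsiE cdpsi cddpsi super mg g0 gB gv oO bO C0_gt0 hO KO.
rewrite integral_support; last first.
  move=> x nO; rewrite vK ?powR0 ?mul0r ?gt_eqF// => /KO; exact: nO.
rewrite [X in (_ * X)%E]integral_support; last first.
  move=> x /= /negP; rewrite -leNgt => vx; rewrite gv0 ?powR0 ?mul0r ?gt_eqF//.
  by apply: le_anti; rewrite vx v0.
under eq_integral do rewrite mulrAC.
by under [X in (_ * X)%E]eq_integral do rewrite mulrAC.
Qed.

End weak_bound.

(** * Positive and negative parts *)

Section signed_parts.
Context {R : realType} {d : nat}.
Local Notation e_ i := (delta_mx 0 i).
Variables (Omega : set 'rV[R]_d) (u : 'rV[R]_d -> R) (lambda : R).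
Hypothesis oO : open Omega.
Hypothesis cu : {within Omega, continuous u}.
Hypothesis su : compactly_supported Omega u.
Hypothesis uC2 : C2_loc (nonzero_set Omega u) u.
Hypothesis lap_bounded : [bounded laplacian u x | x in nonzero_set Omega u].
Hypothesis lambda0 : 0 <= lambda.

Let V := nonzero_set Omega u.
Let K := supp Omega u.

(** The values of [u] outside the open set carry no information; the arguments
    below need a function on the whole space. *)
Definition extend0 := u \_ Omega.
Local Notation w := extend0.

(** The positive part of [u] for [s = 1] and its negative part for [s = -1]. *)
Definition signed_part (s : R) x := Num.max (s * w x) 0.

Definition signed_source (s : R) x :=
  if 0 < signed_part s x then `|laplacian u x - lambda * u x| else 0.

Lemma extend0_in x : Omega x -> w x = u x.
Proof. by move=> Ox; rewrite /w patchE mem_set. Qed.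

Lemma extend0_out x : ~ Omega x -> w x = 0.
Proof. by move=> Ox; rewrite /w patchE memNset. Qed.

Lemma extend0_neq0 x : w x != 0 -> V x.
Proof.
have [Ox|nO] := pselect (Omega x); first by rewrite extend0_in.
by rewrite extend0_out ?eqxx.
Qed.

Lemma nonzero_supp x : V x -> K x.
Proof. exact: subset_closure. Qed.

Lemma extend0_supp x : ~ K x -> w x = 0.
Proof. by move=> nK; apply/eqP; apply: contrapT => /negP/extend0_neq0/nonzero_supp. Qed.

(** Points outside the open set have a neighbourhood disjoint from the closed
    support. *)
Lemma extend0_continuous : continuous w.
Proof.
move=> x; have [Ox|nO] := pselect (Omega x).
  apply: cont_ext (within_open_continuous_at oO cu Ox).
  by apply: filterS (open_nbhs_nbhs (conj oO Ox)) => y Oy; rewrite extend0_in.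
have nK : ~ K x by move=> /(su.2).
have oK : open (~` K) by apply: closed_openC; exact: closed_closure.
apply: cont_ext (cont_cst 0 x).
by apply: filterS (open_nbhs_nbhs (conj oK nK)) => y /extend0_supp ->.
Qed.

Lemma open_nonzero : open V.
Proof.
have -> : V = w @^-1` [set t : R | t != 0].
  apply/seteqP; split => x; last by move=> /extend0_neq0.
  by move=> [Ox ux]; rewrite /preimage/= extend0_in.
by apply: open_comp => [x _|]; [exact: extend0_continuous|exact: open_neq].
Qed.

Lemma signed_part_continuous s : continuous (signed_part s).
Proof.
move=> x; apply: (@continuous_max _ _ (fun x => s * w x) (cst 0)).
  have H := cont_mul (cont_cst s x) (extend0_continuous (x := x)).
  exact: H.
exact: cst_continuous.
Qed.

Lemma signed_part_ge0 s x : 0 <= signed_part s x.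
Proof. by rewrite le_max lexx orbT. Qed.

Lemma signed_part_supp s x : ~ K x -> signed_part s x = 0.
Proof. by move=> /extend0_supp wx; rewrite /signed_part wx mulr0 maxxx. Qed.

Lemma signed_part_gt0 s x : 0 < signed_part s x -> V x.
Proof.
rewrite lt_max ltxx orbF => swx; apply: extend0_neq0.
by apply: contraTneq swx => ->; rewrite mulr0 ltxx.
Qed.

Lemma signed_part_near s x : 0 < signed_part s x ->
  \forall y \near x, 0 < signed_part s y /\ s * u y = signed_part s y.
Proof.
move=> vx; have oP : open [set y | 0 < signed_part s y].
  rewrite (_ : [set y | _] = signed_part s @^-1` [set t : R | 0 < t])//.
  by apply: open_comp => [y _|]; [exact: signed_part_continuous|exact: open_gt].
apply: filterS (open_nbhs_nbhs (conj oP vx)) => y /= vy; split => //.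
have [Oy _] := signed_part_gt0 vy; move: vy.
rewrite /signed_part extend0_in// lt_max ltxx orbF => /ltW sy.
by rewrite max_l.
Qed.

Lemma signed_part_regular s i x : 0 < signed_part s x ->
  [/\ is_derive x (e_ i) (signed_part s) (s * partial i u x),
      is_derive x (e_ i) (fun y => s * partial i u y) (s * partial i (partial i u) x),
      continuous_at x (fun y => s * partial i u y) &
      continuous_at x (fun y => s * partial i (partial i u) y)].
Proof.
move=> vx; have [D1 D2 C1 C2] := C2_loc_regular open_nonzero uC2 i (signed_part_gt0 vx).
split.
- apply: is_derive_ext (is_derive_scale s D1) => //.
  by apply: filterS (signed_part_near vx) => y [].
- exact: is_derive_scale.
- exact: (cont_mul (cont_cst s x) C1).
- exact: (cont_mul (cont_cst s x) C2).
Qed.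

Lemma laplacian_continuous x : V x -> continuous_at x (laplacian u).
Proof.
move=> Vx; apply: (@cont_sum _ _ _ (fun i y => partial i (partial i u) y)) => i.
by have [] := C2_loc_regular open_nonzero uC2 i Vx.
Qed.

Lemma signed_source_measurable s : measurable_fun setT (signed_source s).
Proof.
pose P := [set x | 0 < signed_part s x].
have oP : open P.
  rewrite /P (_ : [set y | _] = signed_part s @^-1` [set t : R | 0 < t])//.
  by apply: open_comp => [y _|]; [exact: signed_part_continuous|exact: open_gt].
pose h x := `|laplacian u x - lambda * w x|.
have -> : signed_source s = h \_ P.
  apply/funext => x; rewrite patchE /signed_source; case: ifPn => vx.
    by rewrite mem_set// /h extend0_in//; case: (signed_part_gt0 vx).
  by rewrite memNset//; exact/negP.
apply: (proj1 (@measurable_restrictT _ _ _ _ P h (open_measurable_rV oP))).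
apply: within_continuous_measurable_rV => //.
rewrite continuous_open_subspace// => x /set_mem /signed_part_gt0 Vx.
have H : continuous_at x (fun y => laplacian u y - lambda * w y).
  have H := cont_opp (cont_mul (cont_cst lambda x) (extend0_continuous (x := x))).
  exact: (cont_add (laplacian_continuous Vx) H).
by apply: (cont_comp H); exact: norm_continuous.
Qed.

Lemma signed_source_ge0 s x : 0 <= signed_source s x.
Proof. by rewrite /signed_source; case: ifP. Qed.

Lemma signed_source_bounded s : exists B, forall x, `|signed_source s x| <= B.
Proof.
have [L KL] := compact_sub_box su.1.
have [W W0 wW] := Cc_bounded (conj extend0_continuous (ex_intro _ L (fun x nx => extend0_supp (fun Kx => nx (KL x Kx))))).
have [M [_ HM]] := lap_bounded.
exists (`|M| + 1 + lambda * W) => x; rewrite ger0_norm ?signed_source_ge0// /signed_source.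
have B0 : 0 <= `|M| + 1 + lambda * W by rewrite !addr_ge0// mulr_ge0// ltW.
case: ifPn => // /signed_part_gt0 Vx.
apply: le_trans (ler_normB _ _) _; apply: lerD.
  by apply: (HM (`|M| + 1)); rewrite // ltr_pwDr// ler_norm.
rewrite normrM (ger0_norm lambda0) ler_wpM2l// -extend0_in//; exact: Vx.1.
Qed.

(** Where [s u > 0], [s (Delta u - lambda u) = Delta (s u) - lambda (s u)],
    and the last term has a favourable sign because [lambda >= 0]. *)
Lemma signed_source_bound s x : `|s| = 1 -> 0 < signed_part s x ->
  - \sum_i s * partial i (partial i u) x <= signed_source s x.
Proof.
move=> s1 vx; rewrite /signed_source vx -mulr_sumr -/(laplacian u x).
have [_ vE] := nbhs_singleton (signed_part_near vx).
rewrite -[leRHS]mul1r -s1 -normrM -normrN; apply: le_trans (ler_norm _).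
rewrite mulrBr opprB lerDr mulrCA vE mulr_ge0// ltW//.
Qed.

Lemma signed_part_split (p : R) x : 0 < p -> Omega x ->
  `|u x| `^ p = signed_part 1 x `^ p + signed_part (-1) x `^ p.
Proof.
move=> p0 Ox; rewrite /signed_part extend0_in// mul1r mulN1r.
have [u0|u0] := leP 0 (u x).
  rewrite (max_r (_ : - u x <= 0)) ?oppr_le0//.
  by rewrite (powR0 (lt0r_neq0 p0)) addr0 ger0_norm.
rewrite max_l ?oppr_ge0 ?(ltW u0)//.
by rewrite (powR0 (lt0r_neq0 p0)) add0r ltr0_norm.
Qed.

Lemma signed_source_split (p : R) x : 0 < p -> V x ->
  `|laplacian u x - lambda * u x| `^ p =
    signed_source 1 x `^ p + signed_source (-1) x `^ p.
Proof.
move=> p0 [Ox ux]; rewrite /signed_source /signed_part extend0_in// mul1r mulN1r.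
rewrite !lt_max ltxx !orbF oppr_gt0.
case: ltgtP ux => /= [_ _|_ _|->]; rewrite ?eqxx// (powR0 (lt0r_neq0 p0)) ?addr0 ?add0r//.
Qed.

Lemma signed_part_out s x : ~ V x -> signed_part s x = 0.
Proof.
move=> nV; apply: le_anti; rewrite signed_part_ge0 andbT leNgt.
by apply/negP => /signed_part_gt0.
Qed.

Lemma signed_source_out s x : signed_part s x = 0 -> signed_source s x = 0.
Proof. by rewrite /signed_source => ->; rewrite ltxx. Qed.

End signed_parts.

(** * The inequality for the original function *)

Theorem theorem2p7 (R : realType) (p c C0 : R) :
  1 < p -> - p + 1 < c -> c < 1 -> 0 < C0 ->
  exists N : R, 0 < N /\
  forall (d : nat) (Omega : set 'rV[R]_d),
    open Omega -> Omega !=set0 -> Omega != setT -> hardy Omega C0 ->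
  forall phi : 'rV[R]_d -> R,
    superharmonic Omega phi ->
    {ae lebesgue_rV, forall x, Omega x -> 0 < phi x} ->
  forall u : 'rV[R]_d -> R,
    {within Omega, continuous u} ->
    compactly_supported Omega u ->
    C2_loc (nonzero_set Omega u) u ->
    (\int[lebesgue_rV]_(x in nonzero_set Omega u)
       (`|u x| `^ (p - 1) * hess_norm u x)%:E < +oo)%E ->
    [bounded laplacian u x | x in nonzero_set Omega u] ->
  forall lambda : R, 0 <= lambda ->
    (\int[lebesgue_rV]_(x in Omega)
       (`|u x| `^ p * phi x `^ c * rho Omega x `^ (- 2))%:E
     <= N%:E * \int[lebesgue_rV]_(x in nonzero_set Omega u)
       (`|laplacian u x - lambda * u x| `^ p * phi x `^ c
          * rho Omega x `^ (2 * p - 2))%:E)%E.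
Proof.
move=> p1 pc c1 C00; have p0 : 0 < p by lra.
have [t [M [t0 M0 form]]] := coercive_exists p1 pc c1.
set N := (2 * (C0 * M)) `^ p.
have N0 : 0 < N by rewrite powR_gt0// !mulr_gt0.
exists N; split=> // d Omega oO _ _ hO phi phi_sh phi_gt0 u cu su uC2 _ lap_bd lambda lambda0.
(* The infimum of the empty set is [0] and [0 `^ (- 2)] is [0]. *)
have [bO|nbO] := pselect (boundary Omega !=set0); last first.
  have rho0 x : rho Omega x = 0.
    rewrite /rho (_ : [set _ | _ in _] = set0) ?inf0//.
    by apply/seteqP; split => // z [y By _]; apply: nbO; exists y.
  rewrite integral0_eq; last by move=> x _; rewrite rho0 powR0 ?mulr0// oppr_eq0.
  apply: mule_ge0; first by rewrite lee_fin ltW.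
  by apply: integral_ge0 => x _; rewrite lee_fin !mulr_ge0 ?powR_ge0.
pose K := supp Omega u; pose V := nonzero_set Omega u.
have [cK KO] : compact K /\ K `<=` Omega by [].
have [r [r0 r1 rO]] := thick_sub cK oO KO.
have KT : K `<=` thick r K by apply: sub_thick; exact: ltW.
have [phit [fi f0 fK phitE]] :=
  positive_version oO phi_sh phi_gt0 (thick_compact cK) rO.
pose W x := pos_powR c (phit x).
have W0 x : 0 <= W x by rewrite /W /pos_powR; case: ifP => _; rewrite ?powR_ge0.
pose v := signed_part Omega u; pose g := signed_source Omega u lambda.
pose A s x := v s x `^ p * rho Omega x `^ (- 2) * W x.
pose B s x := g s x `^ p * rho Omega x `^ (2 * p - 2) * W x.
have A0 s x : 0 <= A s x by rewrite !mulr_ge0 ?powR_ge0.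
have B0 s x : 0 <= B s x by rewrite !mulr_ge0 ?powR_ge0.
have half s : `|s| = 1 -> (\int[lebesgue_rV]_x (A s x)%:E <=
    N%:E * \int[lebesgue_rV]_x (B s x)%:E)%E.
  move=> s1.
  have reg i x (vx : 0 < v s x) := signed_part_regular oO cu su uC2 i vx.
  apply: (@weak_weight_bound R d Omega C0 oO bO C00 hO p c t M p1 c1 t0 M0 form K r phi phit
    cK r0 r1 rO phi_sh fi f0 fK phitE (v s) (fun i x => s * partial i u x)
    (fun i x => s * partial i (partial i u) x) (g s)).
  - exact: signed_part_continuous oO cu su s.
  - exact: signed_part_ge0.
  - exact: signed_part_supp.
  - by move=> i x /(reg i)[].
  - by move=> i x /(reg i)[].
  - by move=> i x /(reg i)[].
  - by move=> i x /(reg i)[].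
  - exact: signed_source_measurable oO cu su uC2 s.
  - exact: signed_source_ge0.
  - exact: signed_source_bounded oO cu su lap_bd lambda0 s.
  - by move=> x; exact: signed_source_bound oO cu su lambda0 s x s1.
  - exact: signed_source_out.
have mW : measurable_fun setT W.
  have mf : measurable_fun setT phit by apply/measurable_EFinP; exact: measurable_int fi.
  apply: measurable_fun_ifT; last exact: measurable_cst.
    by apply: measurable_fun_ltr => //; exact: measurable_cst.
  exact: (measurableT_comp (@measurable_powR R c) mf).
have mX (f : 'rV[R]_d -> R) (a : R) : measurable_fun setT f ->
    measurable_fun setT (fun x => f x `^ a).
  by move=> mf; exact: (measurableT_comp (@measurable_powR R a) mf).
have mA s : measurable_fun setT (fun x => (A s x)%:E).
  apply/measurable_EFinP; apply: measurable_funM => //.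
  apply: measurable_funM; apply: mX; last exact: measurable_rho.
  apply: continuous_measurable_rV; exact: signed_part_continuous oO cu su s.
have mB s : measurable_fun setT (fun x => (B s x)%:E).
  apply/measurable_EFinP; apply: measurable_funM => //.
  apply: measurable_funM; apply: mX; last exact: measurable_rho.
  exact: signed_source_measurable oO cu su uC2 s.
(* From here on [phi^c] is replaced by its Borel version [W], so that
   integrals can be split. *)
have WE : {ae lebesgue_rV, forall x, K x -> W x = phi x `^ c}.
  apply: filterS phitE => x H /KT/H[E px].
  by rewrite /W /pos_powR E px.
have LHS : (\int[lebesgue_rV]_(x in Omega) (`|u x| `^ p * phi x `^ c * rho Omega x `^ (- 2))%:E =
    \int[lebesgue_rV]_x ((A 1 x)%:E + (A (-1) x)%:E))%E.
  rewrite integral_mkcond; apply: ae_eq_integral_nonmeasurable.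
  apply: filterS WE => x WE _; rewrite patchE -EFinD.
  have [Ox|nO] := pselect (Omega x); last first.
    have nV : ~ V x by case.
    rewrite memNset// /A /v !(signed_part_out _ nV) (powR0 (lt0r_neq0 p0)).
    by rewrite !mul0r addr0.
  rewrite mem_set// (signed_part_split u p0 Ox); congr EFin.
  have [Kx|nK] := pselect (K x).
    by rewrite /A /v WE//; ring.
  by rewrite /A /v !(signed_part_supp _ nK) (powR0 (lt0r_neq0 p0)) !mul0r addr0 !mul0r.
have RHS : (\int[lebesgue_rV]_(x in V) (`|laplacian u x - lambda * u x| `^ p * phi x `^ c
       * rho Omega x `^ (2 * p - 2))%:E =
    \int[lebesgue_rV]_x ((B 1 x)%:E + (B (-1) x)%:E))%E.
  rewrite integral_mkcond; apply: ae_eq_integral_nonmeasurable.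
  apply: filterS WE => x WE _; rewrite patchE -EFinD.
  have [Vx|nV] := pselect (V x); last first.
    rewrite memNset// /B /g !signed_source_out ?(signed_part_out _ nV)//.
    by rewrite (powR0 (lt0r_neq0 p0)) !mul0r addr0.
  rewrite mem_set// (signed_source_split lambda p0 Vx) /B /g WE; last exact: nonzero_supp.
  by congr EFin; ring.
rewrite LHS RHS !ge0_integralD//; try by move=> x _; rewrite lee_fin.
rewrite ge0_muleDr; try by apply: integral_ge0 => x _; rewrite lee_fin.
by apply: leeD; apply: half; rewrite ?normrN normr1.
Qed.
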